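(* Let $1\le p\le 2$, and let $(Y_n,T_n)_{n\in\mathbb{N}}$ be a martingale difference sequence in $L^p(T)$. Let $(a_i)_{i\in\mathbb{N}}$ be a positive, non-decreasing sequence of real numbers divergent to infinity with $$\sum_{i=1}^\infty T_1\left(\frac{|Y_i|^p}{a_i^p}\right)$$ order convergent. Then $\displaystyle\frac{1}{a_n}\sum_{i=1}^n Y_i\to 0$ in order as $n$ tends to infinity.
   Context: A conditional expectation (operator) on a Dedekind complete Riesz space $F$ with weak order unit is a positive order continuous linear projection on $F$ that maps weak order units to weak order units and whose range is a Dedekind complete Riesz subspace of $F$. It is strictly positive if $T|f|=0$ implies $f=0$. $R(T)$ denotes the range of $T$. Let $E$ be a Dedekind complete Riesz space with weak order unit $e$ and let $E^u$ be its universal completion, an $f$-algebra with algebraic unit $e$; for $f\in E^u_+$ the power $f^p$ is defined by functional calculus. Let $T$ be a strictly positive conditional expectation on $E$. The natural domain of $T$ is $L^1(T)=\mathrm{dom}(T)-\mathrm{dom}(T)\subset E^u$, where $f\in\mathrm{dom}(T)$ if $f\in E^u_+$ and there is an upwards directed net $f_\alpha\uparrow f$ in $E_+$ with $(Tf_\alpha)$ order bounded in $E^u$; in this case $Tf$ is the order limit in $E^u$ of $Tf_\alpha$. $T$ is extended in this way to a conditional expectation acting on $L^1(T)$. For $1\le p<\infty$, $L^p(T)=\{x\in L^1(T): |x|^p\in L^1(T)\}$. A filtration on $L^1(T)$ is a family $(T_i)_{i\in\mathbb{N}}$ of conditional expectations on $L^1(T)$ with $T_iT_j=T_jT_i=T_i$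 for all $i<j$. $(Y_i,T_i)_{i\in\mathbb{N}}$ is a martingale difference sequence in $L^p(T)$ if $(T_i)$ is a filtration on $L^1(T)$, $Y_i\in L^p(T)\cap R(T_i)$ for all $i$, and $T_{i-1}Y_i=0$ for $i\ge 2$. A series is order convergent if its sequence of partial sums is.
   Formalization: The filtration is assumed compatible with T, i.e. T(T_i x) = T x for all x in L^1(T) and all i; without this the claim fails. Order convergence of the series and of the averages is taken in L^1(T). *)

(* Defs.v *)
From HB Require Import structures.
From mathcomp Require Import all_boot all_order all_algebra.
From mathcomp Require Import all_classical all_reals all_analysis.

Set Implicit Arguments.
Unset Strict Implicit.
Unset Printing Implicit Defensive.
Import Order.TTheory GRing.Theory Num.Theory.
Import numFieldNormedType.Exports.

Local Open Scope classical_set_scope.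
Local Open Scope ring_scope.

(* The lattice operations are fields of their own: [Order.Lattice] cannot be
   joined with [GRing.Lmodule] below the existing numeric hierarchy. *)
HB.mixin Record isRiesz (R : realType) V
    of GRing.Lmodule R V & Num.POrderedZmodule V := {
  rjoin : V -> V -> V ;
  rmeet : V -> V -> V ;
  rjoin_le : forall x y z : V, (rjoin x y <= z) = (x <= z) && (y <= z) ;
  le_rmeet : forall x y z : V, (z <= rmeet x y) = (z <= x) && (z <= y) ;
  rieszD2r : forall x y z : V, x <= y -> x + z <= y + z ;
  rieszZ_ge0 : forall (c : R) (x : V), 0 <= c -> 0 <= x -> 0 <= c *: x
}.

#[short(type="rieszType")]
HB.structure Definition Riesz (R : realType) :=
  { V of GRing.Lmodule R V & Num.POrderedZmodule V & isRiesz R V }.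

(** Notions relative to a subset [S] of a Riesz space [V].  They are applied
    to [S := setT] (the space [E]) and to [S := L1 iota T], a subset of the
    universal completion.  Suprema, infima and order limits are those of the
    ordered set [S], not of [V]. *)
Section RelativeNotions.
Context (R : realType) (V : rieszType R).
Implicit Types (S D : set V) (x y f g e : V) (T : V -> V).

Definition rabs x : V := rjoin x (- x).

Definition is_sup S D x :=
  [/\ S x, ubound D x & forall y, S y -> ubound D y -> x <= y].

Definition is_inf S D x :=
  [/\ S x, lbound D x & forall y, S y -> lbound D y -> y <= x].

Definition up_directed D :=
  D !=set0 /\
  forall x y, D x -> D y -> exists z, [/\ D z, x <= z & y <= z].

Definition down_directed D :=
  D !=set0 /\
  forall x y, D x -> D y -> exists z, [/\ D z, z <= x & z <= y].

Definition riesz_subspace S :=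
  [/\ S 0,
      forall (c : R) x y, S x -> S y -> S (c *: x + y),
      forall x y, S x -> S y -> S (rjoin x y) &
      forall x y, S x -> S y -> S (rmeet x y)].

Definition dedekind_complete S :=
  forall D, D `<=` S -> D !=set0 -> (exists2 y, S y & ubound D y) ->
  exists x, is_sup S D x.

Definition weak_order_unit S e :=
  [/\ S e, 0 <= e & forall x, S x -> rmeet (rabs x) e = 0 -> x = 0].

(* [T] is total on [V]; only its values on [S] are constrained. *)
Definition conditional_expectation S T :=
  [/\ forall x, S x -> S (T x),
      forall (c : R) x y, S x -> S y -> T (c *: x + y) = c *: T x + T y,
      forall x, S x -> 0 <= x -> 0 <= T x &
      forall x, S x -> T (T x) = T x] /\
  [/\ forall D, D `<=` S -> down_directed D -> is_inf S D 0 ->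
        is_inf S (T @` D) 0,
      forall e, weak_order_unit S e -> weak_order_unit S (T e),
      riesz_subspace (T @` S) &
      dedekind_complete (T @` S)].

Definition strictly_positive S T :=
  forall f, S f -> T (rabs f) = 0 -> f = 0.

Definition order_cvg S (x : nat -> V) (l : V) :=
  S l /\
  exists u : nat -> V,
    [/\ forall n, S (u n),
        forall n, u n.+1 <= u n,
        is_inf S (range u) 0 &
        forall n, rabs (x n - l) <= u n].

Definition order_cvg_series S (x : nat -> V) :=
  exists l, order_cvg S (fun n => \sum_(i < n.+1) x i) l.

Definition laterally_complete :=
  forall D : set V,
    (forall x, D x -> 0 <= x) ->
    (forall x y, D x -> D y -> x <> y -> rmeet x y = 0) ->
    exists s, is_sup setT D s.

(** Continuous functional calculus of [f] with respect to the unit [e]: a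
    Riesz homomorphism from the continuous functions on the real line to [V]
    mapping the constant 1 to [e] and the identity to [f].  Values at
    discontinuous functions are irrelevant. *)
Definition functional_calculus e f (Phi : (R -> R) -> V) :=
  [/\ forall (c : R) (phi psi : R -> R), continuous phi -> continuous psi ->
        Phi (fun t => c * phi t + psi t) = c *: Phi phi + Phi psi,
      forall phi psi : R -> R, continuous phi -> continuous psi ->
        Phi (fun t => Num.max (phi t) (psi t)) = rjoin (Phi phi) (Phi psi),
      Phi (fun=> 1) = e &
      Phi (fun t => t) = f].

(* For [0 <= f] the absolute value inside the power is immaterial. *)
Definition is_power e (p : R) f g :=
  exists2 Phi, functional_calculus e f Phi & g = Phi (fun t => `|t| `^ p).

Definition power e (p : R) f : V := xget 0 (is_power e p f).

End RelativeNotions.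

Definition universally_complete (R : realType) (V : rieszType R) :=
  dedekind_complete [set: V] /\ laterally_complete V.

(** [U], with the embedding [iota], is the universal completion of [E].  The
    f-algebra structure of [U] with unit [iota e] is determined by [e] and is
    only used through [functional_calculus (iota e)]. *)
Definition universal_completion (R : realType)
    (E : rieszType R) (U : rieszType R) (iota : E -> U) :=
  universally_complete U /\
  [/\ forall (c : R) (x y : E), iota (c *: x + y) = c *: iota x + iota y,
      forall x y : E, iota (rjoin x y) = rjoin (iota x) (iota y),
      injective iota &
      forall u : U, 0 < u -> exists2 x : E, 0 < x & iota x <= u].

Section NaturalDomain.
Context (R : realType).
Context (E : rieszType R) (U : rieszType R).
Context (iota : E -> U) (T : E -> E).
Implicit Types (D : set E) (f g h y : U).

(* An increasing net is represented by its range, an upwards directed set. *)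
Definition approximates D f :=
  [/\ up_directed D, forall x, D x -> 0 <= x,
      is_sup setT (iota @` D) f &
      exists b, ubound ((iota \o T) @` D) b].

Definition natural_dom : set U :=
  [set f | 0 <= f /\ exists D, approximates D f].

Definition L1 : set U :=
  [set f | exists g h, [/\ natural_dom g, natural_dom h & f = g - h]].

Definition is_extension f y :=
  exists Dg Dh g h Tg Th,
    [/\ 0 <= g /\ 0 <= h,
        approximates Dg g /\ approximates Dh h,
        f = g - h,
        is_sup setT ((iota \o T) @` Dg) Tg /\
        is_sup setT ((iota \o T) @` Dh) Th &
        y = Tg - Th].

(* The extension of [T] to [L1]. *)
Definition extension f : U := xget 0 (is_extension f).

Definition Lp (e : E) (p : R) : set U :=
  [set x | L1 x /\ exists2 y, is_power (iota e) p (rabs x) y & L1 y].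

(* Families are indexed from 0: [Ti i] is the operator of index i + 1. *)
Definition filtration (Ti : nat -> U -> U) :=
  (forall i, conditional_expectation L1 (Ti i)) /\
  forall i j, (i < j)%N -> forall x, L1 x ->
    Ti i (Ti j x) = Ti i x /\ Ti j (Ti i x) = Ti i x.

(** Compatibility of a filtration with [T]: [T] composed with any of its
    operators is [T].  The strong law of large numbers fails without it.  On
    the naturals with a point at infinity added, let [T] be the expectation of
    a probability of full support and [Ti i] the conditional expectation, with
    respect to a probability [Q] not charging infinity, given the algebra
    generated by the points below [i].  The [Ti i] are conditional
    expectations on L^1(T), but [Y i] can take the value [a i] at infinity for
    all [i > 0] while the hypothesis on the series holds, if the tails of [Q]
    decay fast enough. *)
Definition compatible (Ti : nat -> U -> U) :=
  forall i x, L1 x -> extension (Ti i x) = extension x.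

Definition martingale_difference (e : E) (p : R)
    (Y : nat -> U) (Ti : nat -> U -> U) :=
  [/\ filtration Ti,
      forall i, Lp e p (Y i) /\ (Ti i @` L1) (Y i) &
      forall i, Ti i (Y i.+1) = 0].

End NaturalDomain.

(* Main.v *)
Require Import Defs.
From HB Require Import structures.
From mathcomp Require Import all_boot all_order all_algebra.
From mathcomp Require Import all_classical all_reals all_analysis.
From mathcomp Require Import ring lra.

Set Implicit Arguments.
Unset Strict Implicit.
Unset Printing Implicit Defensive.
Import Order.TTheory GRing.Theory Num.Theory.
Import numFieldNormedType.Exports.

Local Open Scope classical_set_scope.
Local Open Scope ring_scope.

(** Write [y i = Y i / a i].  By Kronecker's lemma it is enough that the
    martingale [M] with increments [y i] converges in order in [L1], that is, that
    the maximal functions [G k] of its tails lie in [L1] and are small in mean: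
    the infimum [z] of the tail suprema of the averages satisfies
    [z <= 2 G k] for every [k], so that [Ti 0 z = 0] once the [Ti 0 (G k)] have
    infimum zero, and [Ti 0] is strictly positive because [T] factors through it
    ([strong_law]).

    The power [|Y i| ^ p] is computed in units of [e], which the operators
    [Ti i] need not fix, so an [L^p] estimate for martingales cannot be applied
    to it.  The square function [(\sum_i y i ^ 2) ^ (1/2)] is homogeneous, hence
    independent of any unit, and since [p <= 2] it is bounded, for every
    [eps > 0], by a multiple of [\sum_i |y i| ^ p] plus [(eps / 2) e]: this is
    the tangent inequality for [t ^ p] summed with Euclidean weights
    ([power_tangent], [psq_le]).  Davis' inequality
    [Ti 0 (max_n |M n|) <= 10 Ti 0 (square function)] then bounds the maximal
    functions of the tails by tails of the given series ([tail_control]).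

    Davis' inequality is proved pathwise, after Beiglboeck and Siorpaes: the
    maximum of a finite real path is at most ten times its square function plus
    the integral against the path of a predictable integrand bounded by two
    ([davis_path]).  The integral has zero expectation.  In a Riesz space the
    integrand acts through step combinations of band projections, which commute
    with a conditional expectation when the band is generated by an element of
    its range ([ce_bproj]); no multiplication is used.

    Inequalities between real numbers carry over to the Riesz space because
    real-valued lattice homomorphisms on principal ideals detect positivity
    ([ge0_of_states]).  This also shows that the functional calculus determines
    the power ([is_power_uniq]).

    Finally, that the maximal functions exist in [L1] is a monotone convergence
    theorem for the extension of [T] ([levi]).  It rests on lateral
    completeness: an increasing sequence in a universally complete space is
    bounded unless it is unbounded on some band ([lateral_bound]). *)

(** * Elementary lattice and order calculus *)

Section RieszBasics.
Context (R : realType) (V : rieszType R).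
Implicit Types (x y z t : V) (c : R) (D : set V).

Lemma rleD2r z x y : (x + z <= y + z) = (x <= y).
Proof.
apply/idP/idP => [h|]; last exact: rieszD2r.
by have := rieszD2r _ _ (- z) h; rewrite !addrK.
Qed.

Lemma rleD2l z x y : (z + x <= z + y) = (x <= y).
Proof. by rewrite !(addrC z) rleD2r. Qed.

Lemma rleD x y z t : x <= y -> z <= t -> x + z <= y + t.
Proof. by move=> h k; apply: (@le_trans _ _ (y + z)); rewrite ?rleD2r ?rleD2l. Qed.

Lemma raddr_ge0 x y : 0 <= x -> 0 <= y -> 0 <= x + y.
Proof. by move=> h k; rewrite -(addr0 0); exact: rleD. Qed.

Lemma rsubr_ge0 x y : (0 <= y - x) = (x <= y).
Proof. by rewrite -(rleD2r x 0) add0r subrK. Qed.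

Lemma rleBlDr x y z : (x - y <= z) = (x <= z + y).
Proof. by rewrite -(rleD2r y (x - y)) subrK. Qed.

Lemma rleBrDr x y z : (x <= y - z) = (x + z <= y).
Proof. by rewrite -(rleD2r z x) subrK. Qed.

Lemma rleBlDl x y z : (x - y <= z) = (x <= y + z).
Proof. by rewrite rleBlDr addrC. Qed.

Lemma rleN2 x y : (- x <= - y) = (y <= x).
Proof. by rewrite -(rsubr_ge0 (- x)) opprK addrC rsubr_ge0. Qed.

Lemma roppr_ge0 x : (0 <= - x) = (x <= 0).
Proof. by rewrite -{1}oppr0 rleN2. Qed.

Lemma rleDl x y : (x <= x + y) = (0 <= y).
Proof. by rewrite -{1}(addr0 x) rleD2l. Qed.

Lemma rleDr x y : (x <= y + x) = (0 <= y).
Proof. by rewrite addrC rleDl. Qed.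

Lemma rleZ c x y : 0 <= c -> x <= y -> c *: x <= c *: y.
Proof. by move=> c0 h; rewrite -rsubr_ge0 -scalerBr rieszZ_ge0 // rsubr_ge0. Qed.

Lemma rleZr c d x : c <= d -> 0 <= x -> c *: x <= d *: x.
Proof. by move=> cd x0; rewrite -rsubr_ge0 -scalerBl rieszZ_ge0 // subr_ge0. Qed.

Lemma rleZP c x y : 0 < c -> (c *: x <= c *: y) = (x <= y).
Proof.
move=> c0; apply/idP/idP => [|]; last by apply: rleZ; exact: ltW.
have ci : 0 <= c^-1 by rewrite invr_ge0 ltW.
by move/(rleZ ci); rewrite !scalerA mulVf ?gt_eqF // !scale1r.
Qed.

Lemma rsum_ge0 (I : Type) (r : seq I) (P : pred I) (F : I -> V) :
  (forall i, P i -> 0 <= F i) -> 0 <= \sum_(i <- r | P i) F i.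
Proof. by move=> h; elim/big_ind : _ => //; exact: raddr_ge0. Qed.

Lemma rjoin_ler x y : (x <= rjoin x y) * (y <= rjoin x y).
Proof. by have := lexx (rjoin x y); rewrite rjoin_le => /andP[]. Qed.

Lemma rmeet_lel x y : (rmeet x y <= x) * (rmeet x y <= y).
Proof. by have := lexx (rmeet x y); rewrite le_rmeet => /andP[]. Qed.

Lemma rjoinC x y : rjoin x y = rjoin y x.
Proof. by apply/le_anti; rewrite !rjoin_le !rjoin_ler. Qed.

Lemma rmeetC x y : rmeet x y = rmeet y x.
Proof. by apply/le_anti; rewrite !le_rmeet !rmeet_lel. Qed.

Lemma rjoin_r x y : x <= y -> rjoin x y = y.
Proof. by move=> h; apply/le_anti; rewrite rjoin_le h lexx rjoin_ler. Qed.

Lemma rmeet_l x y : x <= y -> rmeet x y = x.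
Proof. by move=> h; apply/le_anti; rewrite le_rmeet h lexx rmeet_lel. Qed.

Lemma rmeetS x y z t : x <= z -> y <= t -> rmeet x y <= rmeet z t.
Proof.
by move=> h k; rewrite le_rmeet (le_trans _ h) ?(le_trans _ k) // rmeet_lel.
Qed.

Lemma rjoinS x y z t : x <= z -> y <= t -> rjoin x y <= rjoin z t.
Proof.
by move=> h k; rewrite rjoin_le (le_trans h) ?(le_trans k) // rjoin_ler.
Qed.

Lemma rjoinDr x y z : rjoin x y + z = rjoin (x + z) (y + z).
Proof.
apply/le_anti/andP; split.
  by rewrite -rleBrDr rjoin_le !rleBrDr !rjoin_ler.
by rewrite rjoin_le !rleD2r !rjoin_ler.
Qed.

Lemma rmeetDr x y z : rmeet x y + z = rmeet (x + z) (y + z).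
Proof.
apply/le_anti/andP; split.
  by rewrite le_rmeet !rleD2r !rmeet_lel.
by rewrite -rleBlDr le_rmeet !rleBlDr !rmeet_lel.
Qed.

Lemma rmeetE x y : rmeet x y = - rjoin (- x) (- y).
Proof.
apply/le_anti/andP; split.
  by rewrite -rleN2 opprK rjoin_le !rleN2 !rmeet_lel.
by rewrite le_rmeet -(rleN2 x) -(rleN2 y) opprK !rjoin_ler.
Qed.

Lemma rjoin_meet x y : rjoin x y + rmeet x y = x + y.
Proof.
rewrite rmeetE; apply/eqP; rewrite subr_eq; apply/eqP.
by rewrite addrC rjoinDr addrA addNr add0r addrC addrK rjoinC.
Qed.

Lemma rjoinZ c x y : 0 <= c -> c *: rjoin x y = rjoin (c *: x) (c *: y).
Proof.
rewrite le_eqVlt => /orP[/eqP<-|c0]; first by rewrite !scale0r rjoin_r.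
apply/le_anti/andP; split; last by rewrite rjoin_le !rleZP // !rjoin_ler.
rewrite -(rleZP _ _ (_ : 0 < c^-1)) ?invr_gt0 // scalerA mulVf ?gt_eqF //.
rewrite scale1r rjoin_le -!(rleZP _ (_ *: rjoin _ _) c0) !scalerA.
by rewrite mulfV ?gt_eqF // !scale1r !rjoin_ler.
Qed.

Lemma rmeetZ c x y : 0 <= c -> c *: rmeet x y = rmeet (c *: x) (c *: y).
Proof. by move=> c0; rewrite !rmeetE scalerN rjoinZ // !scalerN. Qed.

(** The negative part of [x] is [pos (- x)]. *)
Definition pos x : V := rjoin x 0.

Lemma pos_ge0 x : 0 <= pos x. Proof. exact: (rjoin_ler x 0).2. Qed.
Lemma le_pos x : x <= pos x. Proof. exact: (rjoin_ler x 0).1. Qed.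

Lemma pos_le x y : (pos x <= y) = (x <= y) && (0 <= y).
Proof. exact: rjoin_le. Qed.

Lemma pos_id x : 0 <= x -> pos x = x.
Proof. by move=> h; rewrite /pos rjoinC rjoin_r. Qed.

Lemma posS x y : x <= y -> pos x <= pos y.
Proof. by move=> h; rewrite /pos rjoinS. Qed.

Lemma posD_le x y : pos (x + y) <= pos x + pos y.
Proof. by rewrite pos_le rleD ?le_pos // raddr_ge0 // pos_ge0. Qed.

Lemma posZ c x : 0 <= c -> pos (c *: x) = c *: pos x.
Proof. by move=> c0; rewrite /pos rjoinZ // scaler0. Qed.

Lemma posBN x : pos x - pos (- x) = x.
Proof.
rewrite /pos -{1}(subrK x 0) sub0r.
have -> : rjoin x (- x + x) = rjoin 0 (- x) + x.
  by rewrite rjoinDr add0r.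
by rewrite rjoinC addrC addrA addNr add0r.
Qed.

Lemma rabsE x : rabs x = pos x + pos (- x).
Proof.
rewrite /rabs; have := posBN x => /(congr1 (fun z => z + pos (- x) + pos (- x))).
rewrite subrK => ->; rewrite -addrA -mulr2n -scaler_nat /pos rjoinZ //.
rewrite scaler0 addrC rjoinDr scaler_nat mulr2n addrNK add0r.
by rewrite rjoinC.
Qed.

Lemma rabs_ge0 x : 0 <= rabs x.
Proof. by rewrite rabsE raddr_ge0 // pos_ge0. Qed.

Lemma ler_rabs x : (x <= rabs x) * (- x <= rabs x).
Proof. exact: rjoin_ler. Qed.

Lemma rabs_le x y : (rabs x <= y) = (x <= y) && (- x <= y).
Proof. exact: rjoin_le. Qed.

Lemma rabs_id x : 0 <= x -> rabs x = x.
Proof.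
by move=> h; rewrite rabsE pos_id // /pos rjoin_r ?addr0 // -roppr_ge0 opprK.
Qed.

Lemma rabsN x : rabs (- x) = rabs x.
Proof. by rewrite /rabs opprK rjoinC. Qed.

Lemma rabs0 : rabs (0 : V) = 0. Proof. exact: rabs_id. Qed.

Lemma rabsD_le x y : rabs (x + y) <= rabs x + rabs y.
Proof. by rewrite rabs_le opprD !rleD ?ler_rabs. Qed.

Lemma rabsZ c x : rabs (c *: x) = `|c| *: rabs x.
Proof.
wlog c0 : c / 0 <= c => [h|].
  case: (leP 0 c) => [/h//|/ltW c0].
  by rewrite -rabsN -scaleNr h ?oppr_ge0 // normrN.
by rewrite ger0_norm // /rabs rjoinZ // scalerN.
Qed.

Lemma rabs_eq0 x : rabs x = 0 -> x = 0.
Proof.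
move=> h; have := ler_rabs x; rewrite h => -[h1 h2].
by apply/le_anti; rewrite h1 -(rleN2 x 0) oppr0 h2.
Qed.

Lemma pos_le_rabs x : pos x <= rabs x.
Proof. by rewrite pos_le ler_rabs rabs_ge0. Qed.

Lemma posN_meet x : rmeet (pos x) (pos (- x)) = 0.
Proof.
have h : pos (- x) + x = pos x by rewrite -{2}(posBN x) addrC subrK.
rewrite -h -[X in rmeet _ X]addr0 !(addrC (pos (- x))) -rmeetDr rmeetE oppr0.
by rewrite -/(pos (- x)) addNr.
Qed.

(** * Disjointness of positive elements *)

Lemma disjS x y z : 0 <= x -> 0 <= z -> x <= y -> rmeet y z = 0 -> rmeet x z = 0.
Proof.
move=> x0 z0 xy h; apply/le_anti; rewrite le_rmeet x0 z0 !andbT -h.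
exact: rmeetS xy (lexx z).
Qed.

Lemma rmeetD_le x y z : 0 <= x -> 0 <= y -> 0 <= z ->
  rmeet (x + y) z <= rmeet x z + rmeet y z.
Proof.
move=> x0 y0 z0; rewrite rmeetDr le_rmeet; apply/andP; split.
  rewrite (addrC x (rmeet _ _)) rmeetDr le_rmeet [y + x]addrC rmeet_lel /=.
  by apply: (le_trans (rmeet_lel _ _).2); rewrite rleDl.
by apply: (le_trans (rmeet_lel _ _).2); rewrite rleDl le_rmeet y0 z0.
Qed.

Lemma disjD x y z : 0 <= x -> 0 <= y -> 0 <= z ->
  rmeet x z = 0 -> rmeet y z = 0 -> rmeet (x + y) z = 0.
Proof.
move=> x0 y0 z0 h k; apply/le_anti; rewrite le_rmeet z0 raddr_ge0 // !andbT.
by have := rmeetD_le x0 y0 z0; rewrite h k addr0.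
Qed.

Lemma disjZ c x z : 0 <= c -> 0 <= x -> 0 <= z -> rmeet x z = 0 ->
  rmeet (c *: x) z = 0.
Proof.
move=> c0 x0 z0 h.
have d1 : 0 < 1 + c by rewrite ltr_pwDl.
have h1 : rmeet ((1 + c) *: x) ((1 + c) *: z) = 0.
  by rewrite -rmeetZ ?h ?scaler0 // ltW.
have hz : z <= (1 + c) *: z by rewrite -{1}(scale1r z) rleZr // lerDl.
rewrite rmeetC (disjS _ _ hz) ?rieszZ_ge0 // rmeetC.
by apply: (disjS _ _ _ h1); rewrite ?rieszZ_ge0 ?rleZr ?lerDr // ltW.
Qed.

(** * Suprema *)

Definition supof D : V := xget 0 (is_sup setT D).

Lemma is_sup_uniq D x y : is_sup setT D x -> is_sup setT D y -> x = y.
Proof. by move=> [_ h1 h2] [_ k1 k2]; apply/le_anti; rewrite h2 // k2. Qed.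

Lemma supofE D x : is_sup setT D x -> supof D = x.
Proof. by move=> h; apply: is_sup_uniq (h); exact: (xgetPex 0 (ex_intro _ x h)). Qed.

Lemma is_sup_meet D s x : is_sup setT D s ->
  is_sup setT [set rmeet x d | d in D] (rmeet x s).
Proof.
case=> _ us ls; split => // [_ [d Dd <-]|g _ ug]; first exact: rmeetS (us _ Dd).
have e y : rmeet x y = y - (rjoin x y - x).
  by rewrite opprB addrA (addrC y) -(rjoin_meet x y) addrC addrA addNr add0r.
rewrite e rleBlDr; apply: ls => // d Dd.
have := ug _ (imageP _ Dd); rewrite e rleBlDr => h; apply: (le_trans h).
by rewrite rleD2l rleD2r rjoinS // us.
Qed.

Lemma is_sup_incr (f : nat -> V) n m s : (forall n, f n <= f n.+1) ->
  is_sup setT (range f) s -> (n <= m)%N -> f n <= f m <= s.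
Proof.
move=> fi [_ us _] nm; rewrite us ?andbT; last by exists m.
elim: m nm => [|m ih]; first by rewrite leqn0 => /eqP ->.
by rewrite leq_eqVlt => /orP[/eqP->//|/ih h]; exact: le_trans h (fi _).
Qed.

End RieszBasics.

(** * Real-valued lattice homomorphisms on principal ideals *)

Section Archimedean.
Context (R : realType) (V : rieszType R).
Hypothesis dc : dedekind_complete [set: V].
Implicit Types (x y : V) (D : set V).

Lemma dc_supof D : D !=set0 -> (exists y, ubound D y) -> is_sup setT D (supof D).
Proof.
move=> D0 [y uy]; have [||s hs] := dc (D := D) _ D0; [by []| by exists y |].
by rewrite (supofE hs).
Qed.

(** Bounded multiples [n x] have a supremum, which [x] cannot increase. *)
Lemma archimedean x y : (forall n : nat, n%:R *: x <= y) -> x <= 0.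
Proof.
move=> h; have [_ us ls] : is_sup setT (range (fun n : nat => n%:R *: x))
    (supof (range (fun n : nat => n%:R *: x))).
  apply: dc_supof; first by exists (0%:R *: x); exists 0%N.
  by exists y => _ [n _ <-].
set s := supof _ in us ls.
have : s <= s - x.
  apply: ls => // _ [n _ <-]; rewrite rleBrDr -{2}(scale1r x) -scalerDl.
  by apply: us; exists n.+1; rewrite // -natr1.
by rewrite rleDl roppr_ge0.
Qed.

Lemma archimedean_eps x y : (forall e : R, 0 < e -> x <= e *: y) -> x <= 0.
Proof.
move=> h; apply: (@archimedean _ (pos y)) => -[|n]; first by rewrite scale0r pos_ge0.
have n0 : 0 < n.+1%:R :> R by rewrite ltr0n.
have n1 : 0 < n.+1%:R^-1 :> R by rewrite invr_gt0.
rewrite -(rleZP _ _ n1) scalerA mulVf ?gt_eqF // scale1r.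
apply: le_trans (h _ n1) _.
by apply: rleZ; [exact: ltW|exact: le_pos].
Qed.

End Archimedean.

Definition pideal (R : realType) (V : rieszType R) (u x : V) :=
  exists c : R, rabs x <= c *: u.

(** A state of [u] is a Riesz homomorphism from the principal ideal of [u] to
    the reals; its values outside this ideal are irrelevant. *)
Record state (R : realType) (V : rieszType R) (u : V) (w : V -> R) : Prop := State {
  state_lin : forall (c : R) (x y : V), pideal u x -> pideal u y ->
    w (c *: x + y) = c * w x + w y;
  state_joinI : forall x y, pideal u x -> pideal u y ->
    w (rjoin x y) = Num.max (w x) (w y) }.

Section PrincipalIdeal.
Context (R : realType) (V : rieszType R) (u : V).
Hypothesis u0 : 0 <= u.
Implicit Types x y z : V.
Local Notation I := (pideal u).

Lemma pidealS x y : I y -> rabs x <= rabs y -> I x.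
Proof. by move=> [c h] k; exists c; exact: le_trans h. Qed.

Lemma pideal_le x y : I y -> 0 <= x -> x <= y -> I x.
Proof.
by move=> Iy x0 xy; apply: (pidealS Iy); rewrite !rabs_id // (le_trans x0).
Qed.

Lemma pideal_gen : I u.
Proof. by exists 1; rewrite scale1r rabs_id. Qed.

Lemma pideal0 : I 0. Proof. by exists 0; rewrite rabs0 scale0r. Qed.

Lemma pidealD x y : I x -> I y -> I (x + y).
Proof.
move=> [c h] [d k]; exists (c + d); rewrite scalerDl.
exact: le_trans (rabsD_le _ _) (rleD h k).
Qed.

Lemma pidealZ c x : I x -> I (c *: x).
Proof. by move=> [d h]; exists (`|c| * d); rewrite rabsZ -scalerA rleZ. Qed.

Lemma pidealN x : I x -> I (- x).
Proof. by rewrite -scaleN1r; exact: pidealZ. Qed.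

Lemma pidealB x y : I x -> I y -> I (x - y).
Proof. by move=> Ix /pidealN; exact: pidealD. Qed.

Lemma pideal_abs x : I x -> I (rabs x).
Proof. by move=> h; apply: (pidealS h); rewrite [X in X <= _]rabs_id // rabs_ge0. Qed.

Lemma pideal_join x y : I x -> I y -> I (rjoin x y).
Proof.
move=> Ix Iy; apply: (pidealS (pidealD (pideal_abs Ix) (pideal_abs Iy))).
rewrite [X in _ <= X]rabs_id ?raddr_ge0 ?rabs_ge0 // rabs_le; apply/andP; split.
  rewrite rjoin_le (le_trans (ler_rabs x).1) ?rleDl ?rabs_ge0 //.
  by rewrite (le_trans (ler_rabs y).1) ?rleDr ?rabs_ge0.
apply: (@le_trans _ _ (- x)); first by rewrite rleN2 rjoin_ler.
by rewrite (le_trans (ler_rabs x).2) // rleDl rabs_ge0.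
Qed.

Lemma pideal_pos x : I x -> I (pos x).
Proof. by move=> h; exact: pideal_join h pideal0. Qed.

Lemma pideal_sum (J : Type) (r : seq J) (F : J -> V) :
  (forall i, I (F i)) -> I (\sum_(i <- r) F i).
Proof. by move=> h; elim/big_ind : _ => // [|x y]; [exact: pideal0|exact: pidealD]. Qed.

Section StateTheory.
Context (w : V -> R).
Hypothesis sw : state u w.

Lemma stateD x y : I x -> I y -> w (x + y) = w x + w y.
Proof. by move=> Ix Iy; rewrite -{1}(scale1r x) (state_lin sw) // mul1r. Qed.

Lemma state0 : w 0 = 0.
Proof.
by apply: (@addrI _ (w 0)); rewrite -stateD ?addr0 //; exact: pideal0.
Qed.

Lemma stateZ c x : I x -> w (c *: x) = c * w x.
Proof.
by move=> Ix; rewrite -[c *: x]addr0 (state_lin sw) ?state0 ?addr0 //; exact: pideal0.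
Qed.

Lemma stateN x : I x -> w (- x) = - w x.
Proof. by move=> Ix; rewrite -scaleN1r stateZ // mulN1r. Qed.

Lemma stateB x y : I x -> I y -> w (x - y) = w x - w y.
Proof. by move=> Ix Iy; rewrite stateD ?stateN //; exact: pidealN. Qed.

Lemma state_join x y : I x -> I y -> w (rjoin x y) = Num.max (w x) (w y).
Proof. exact: (state_joinI sw). Qed.

Lemma state_meet x y : I x -> I y -> w (rmeet x y) = Num.min (w x) (w y).
Proof.
move=> Ix Iy; have Nx := pidealN Ix; have Ny := pidealN Iy.
rewrite rmeetE stateN; last exact: pideal_join.
by rewrite state_join ?stateN // oppr_max !opprK.
Qed.

Lemma state_pos x : I x -> w (pos x) = Num.max (w x) 0.
Proof. by move=> Ix; rewrite state_join ?state0 //; exact: pideal0. Qed.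

Lemma state_abs x : I x -> w (rabs x) = `|w x|.
Proof. by move=> Ix; have Nx := pidealN Ix; rewrite state_join ?stateN // maxrN. Qed.

Lemma state_le x y : I x -> I y -> x <= y -> w x <= w y.
Proof.
by move=> Ix Iy h; rewrite -(rjoin_r h) state_join // le_max lexx.
Qed.

Lemma state_ge0 x : I x -> 0 <= x -> 0 <= w x.
Proof. by move=> Ix h; rewrite -state0 state_le //; exact: pideal0. Qed.

Lemma state_sum (J : Type) (r : seq J) (F : J -> V) :
  (forall i, I (F i)) -> w (\sum_(i <- r) F i) = \sum_(i <- r) w (F i).
Proof.
move=> h; elim: r => [|i r ih]; first by rewrite !big_nil state0.
by rewrite !big_cons stateD ?ih //; exact: pideal_sum.
Qed.

End StateTheory.
End PrincipalIdeal.

Section ExistenceOfStates.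
Context (R : realType) (V : rieszType R).
Implicit Types (x y z a b v u : V) (J : set V).

Definition order_ideal J :=
  (forall x y, J x -> J y -> J (x + y)) /\
  (forall x y, J y -> rabs x <= rabs y -> J x).

Definition prime_ideal J := forall a b, 0 <= a -> 0 <= b -> rmeet a b = 0 -> J a \/ J b.

(** An ideal maximal among those avoiding [v] is prime: if it contained
    neither of two disjoint elements [a] and [b], then [v] would lie below
    [j + n a] and below [j + m b], hence below their infimum [j]. *)
Lemma exists_prime_ideal v : 0 <= v -> v <> 0 ->
  exists J, [/\ order_ideal J, J 0, ~ J v & prime_ideal J].
Proof.
move=> v0 vn0.
have [F Fi tF|J [[iJ Jv] mJ]] := @Zorn_bigcup V [set J | order_ideal J /\ ~ J v].
  split; last by move=> [J FJ]; exact: (Fi _ FJ).2.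
  split=> [x y [J FJ Jx] [K FK Ky]|x y [J FJ Jy] h].
    have [JK|KJ] := tF _ _ FJ FK.
      by exists K => //; apply: (Fi _ FK).1.1 => //; exact: JK.
    by exists J => //; apply: (Fi _ FJ).1.1 => //; exact: KJ.
  by exists J => //; exact: (Fi _ FJ).1.2 h.
have J0 : J 0.
  apply: contrapT => J0.
  have Je : forall x, ~ J x.
    by move=> x Jx; apply: J0; apply: (iJ.2 _ _ Jx); rewrite rabs0 rabs_ge0.
  apply: (mJ [set 0]); first by split=> [x /Je//|/(_ 0 erefl)/Je].
  split; last by move=> /=.
  split=> [x y -> ->|x y ->]; first by rewrite /= addr0.
  by rewrite rabs0 => h; apply: rabs_eq0; apply/le_anti; rewrite h rabs_ge0.
exists J; split=> // a b a0 b0 ab.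
have gen c : 0 <= c -> J c \/ exists j n, [/\ J j, 0 <= j & v <= j + n%:R *: c].
  move=> c0; have [|nJc] := pselect (J c); [by left|right].
  pose K : set V := [set z | exists j (n : nat), [/\ J j, 0 <= j & rabs z <= j + n%:R *: c]].
  have iK : order_ideal K.
    split=> [x y [j [n [Jj j0 hx]]] [k [m [Jk k0 hy]]]|x y [j [n [Jj j0 hy]]] xy].
      exists (j + k), (n + m)%N; split; [exact: iJ.1|exact: raddr_ge0|].
      apply: (le_trans (rabsD_le _ _)); rewrite natrD scalerDl addrACA.
      exact: rleD.
    by exists j, n; split=> //; exact: le_trans hy.
  have JK : J `<` K.
    split=> [x Jx|KJ].
      exists (rabs x), 0%N; rewrite scale0r addr0; split=> //; last exact: rabs_ge0.
      by apply: (iJ.2 _ _ Jx); rewrite [X in X <= _]rabs_id // rabs_ge0.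
    by apply: nJc; apply: KJ; exists 0, 1%N; rewrite scale1r add0r rabs_id.
  apply: contrapT => h; apply: (mJ _ JK); split=> // -[j [n [Jj j0 hv]]]; apply: h.
  by exists j, n; rewrite rabs_id in hv.
have [|[j [n [Jj j0 hj]]]] := gen a a0; [by left|].
have [|[k [m [Jk k0 hk]]]] := gen b b0; [by right|].
exfalso; apply: Jv; apply: (iJ.2 _ (j + k)); first exact: iJ.1.
rewrite !rabs_id ?raddr_ge0 //.
have na0 : 0 <= n%:R *: a by rewrite rieszZ_ge0 ?ler0n.
have mb0 : 0 <= m%:R *: b by rewrite rieszZ_ge0 ?ler0n.
have dn : rmeet (n%:R *: a) (m%:R *: b) = 0.
  apply: disjZ; rewrite ?ler0n // rmeetC; apply: disjZ; rewrite ?ler0n //.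
  by rewrite rmeetC.
rewrite -[X in _ <= X]addr0 -dn addrC rmeetDr le_rmeet; apply/andP; split.
  by apply: (le_trans hj); rewrite addrC rleD2l rleDl.
by apply: (le_trans hk); rewrite addrC rleD2l rleDr.
Qed.

Section StandardPart.
Context (J : set V) (u : V).
Hypotheses (iJ : order_ideal J) (J0 : J 0) (pJ : prime_ideal J) (u0 : 0 <= u) (Ju : ~ J u).
Local Notation I := (pideal u).

(** Modulo a prime ideal the order is total, and [stdpart z] is the real
    number infinitely close to [z] in units of [u]. *)
Definition stdpart z : R := inf [set l : R | J (pos (z - l *: u))].

Lemma idealS x y : J y -> 0 <= x -> x <= y -> J x.
Proof. by move=> Jy x0 xy; apply: (iJ.2 _ _ Jy); rewrite !rabs_id // (le_trans x0). Qed.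

Lemma idealZ (c : R) x : J x -> J (c *: x).
Proof.
move=> Jx; have Jn n : J (n%:R *: x).
  elim: n => [|n ih]; first by rewrite scale0r.
  by rewrite -natr1 scalerDl scale1r; exact: iJ.1.
apply: (iJ.2 _ _ (Jn (Num.trunc `|c|).+1)); rewrite !rabsZ rleZr ?rabs_ge0 //.
by rewrite (ger0_norm (ler0n _ _)) ltW // truncnS_gt.
Qed.

Lemma ideal_cut z l m : J (pos (z - l *: u)) -> J (pos (m *: u - z)) -> m <= l.
Proof.
move=> h k; rewrite leNgt; apply/negP => lm; apply: Ju.
have lm' : 0 < m - l by rewrite subr_gt0.
have : J ((m - l) *: u).
  apply: (idealS (iJ.1 _ _ k h)); first by rewrite rieszZ_ge0 // ltW.
  apply: le_trans (posD_le _ _); apply: le_trans (le_pos _).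
  by rewrite addrA subrK scalerBl.
by move=> /(idealZ (m - l)^-1); rewrite scalerA mulVf ?gt_eqF // scale1r.
Qed.

Lemma ideal_bounds z c : rabs z <= c *: u ->
  J (pos (z - c *: u)) /\ J (pos ((- c) *: u - z)).
Proof.
move=> h; split.
  have -> : pos (z - c *: u) = 0; last by [].
  by apply/le_anti; rewrite pos_ge0 pos_le lexx rleBlDr add0r (le_trans (ler_rabs z).1).
have -> : pos ((- c) *: u - z) = 0; last by [].
apply/le_anti; rewrite pos_ge0 pos_le lexx scaleNr addrC rleBlDr add0r.
by rewrite (le_trans (ler_rabs z).2).
Qed.

Lemma stdpart_le z l : I z -> J (pos (z - l *: u)) -> stdpart z <= l.
Proof.
move=> [c /ideal_bounds[_ h]] k; apply: ge_inf => //; exists (- c) => m /= hm.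
exact: ideal_cut hm h.
Qed.

Lemma le_stdpart z l : I z -> J (pos (l *: u - z)) -> l <= stdpart z.
Proof.
move=> [c /ideal_bounds[h _]] k; apply: lb_le_inf; first by exists c.
by move=> m /= hm; exact: ideal_cut hm k.
Qed.

Lemma stdpart_lt z l : I z -> stdpart z < l -> J (pos (z - l *: u)).
Proof.
move=> [c /ideal_bounds[h k]] zl.
have hi : has_inf [set l : R | J (pos (z - l *: u))].
  by split; [exists c|exists (- c) => m /= hm; exact: ideal_cut hm k].
have l0 : 0 < l - stdpart z by rewrite subr_gt0.
have [m /= hm ml] := inf_adherent l0 hi.
apply: (idealS hm); rewrite ?pos_ge0 // posS // rleD2l rleN2 rleZr //.
by apply: ltW; move: ml; rewrite addrC subrK.
Qed.

Lemma lt_stdpart z l : I z -> l < stdpart z -> J (pos (l *: u - z)).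
Proof.
move=> Iz lz; have [] := pJ (pos_ge0 _) (pos_ge0 _) (posN_meet (z - l *: u)).
  by move=> /(stdpart_le Iz); rewrite leNgt lz.
by rewrite opprB.
Qed.

Lemma stdpartD x y : I x -> I y -> stdpart (x + y) = stdpart x + stdpart y.
Proof.
move=> Ix Iy; have Ixy := pidealD Ix Iy.
have e2 (e : R) : 0 < e -> 0 < e / 2 by move=> ?; rewrite divr_gt0.
have eB (a b : V) (l m : R) : a - l *: u + (b - m *: u) = a + b - (l + m) *: u.
  by rewrite addrACA -opprD -scalerDl.
have eB' (a b : V) (l m : R) : l *: u - a + (m *: u - b) = (l + m) *: u - (a + b).
  by rewrite addrACA -opprD -scalerDl.
apply/le_anti/andP; split.
  apply/ler_addgt0Pr => e /e2 e0; apply: stdpart_le => //.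
  have hx : stdpart x < stdpart x + e / 2 by rewrite ltrDl.
  have hy : stdpart y < stdpart y + e / 2 by rewrite ltrDl.
  apply: (idealS (iJ.1 _ _ (stdpart_lt Ix hx) (stdpart_lt Iy hy))); first exact: pos_ge0.
  apply: le_trans (posD_le _ _); rewrite le_eqVlt; apply/orP; left; apply/eqP.
  by rewrite eB addrACA -splitr.
apply/ler_addgt0Pr => e /e2 e0; rewrite -lerBlDr; apply: le_stdpart => //.
have hx : stdpart x - e / 2 < stdpart x by rewrite ltrBlDr ltrDl.
have hy : stdpart y - e / 2 < stdpart y by rewrite ltrBlDr ltrDl.
apply: (idealS (iJ.1 _ _ (lt_stdpart Ix hx) (lt_stdpart Iy hy))); first exact: pos_ge0.
apply: le_trans (posD_le _ _); rewrite le_eqVlt; apply/orP; left; apply/eqP.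
rewrite eB'; congr (pos (_ *: _ - _)); lra.
Qed.

Lemma stdpart0 : stdpart 0 = 0.
Proof.
have I0 := pideal0 u.
apply/le_anti/andP; split; [apply: stdpart_le|apply: le_stdpart] => //;
by rewrite scale0r subr0 pos_id.
Qed.

Lemma stdpartZ c x : I x -> stdpart (c *: x) = c * stdpart x.
Proof.
have pZ d y : 0 < d -> I y -> stdpart (d *: y) <= d * stdpart y.
  move=> d0 Iy; rewrite mulrC -ler_pdivrMr //; apply/ler_addgt0Pr => e e0.
  rewrite ler_pdivrMr // mulrC; apply: stdpart_le; first exact: pidealZ.
  rewrite -scalerA -scalerBr posZ ?ltW //; apply: idealZ.
  by apply: stdpart_lt; rewrite ?ltrDl.
have pZ' d y : 0 < d -> I y -> stdpart (d *: y) = d * stdpart y.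
  move=> d0 Iy; apply/le_anti; rewrite pZ //= -ler_pdivlMl //.
  have {1}-> : y = d^-1 *: (d *: y) by rewrite scalerA mulVf ?gt_eqF // scale1r.
  by rewrite pZ ?invr_gt0 //; exact: pidealZ.
move=> Ix; have [c0|c0|->] := ltgtP c 0; last by rewrite scale0r stdpart0 mul0r.
  have h : stdpart (c *: x) + stdpart ((- c) *: x) = 0.
    rewrite -stdpartD ?scaleNr ?subrr ?stdpart0 //; first exact: pidealZ.
    by apply: pidealN; exact: pidealZ.
  by apply/eqP; rewrite -subr_eq0 -mulNr -pZ' ?oppr_gt0 // h.
exact: pZ'.
Qed.

Lemma state_stdpart : state u stdpart.
Proof.
split=> [c x y Ix Iy|x y Ix Iy].
  by rewrite stdpartD ?stdpartZ //; exact: pidealZ.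
have Ij := pideal_join Ix Iy.
have mono z t : I z -> I t -> z <= t -> stdpart z <= stdpart t.
  move=> Iz It zt; apply/ler_addgt0Pr => e e0; apply: stdpart_le => //.
  have h : stdpart t < stdpart t + e by rewrite ltrDl.
  apply: (idealS (stdpart_lt It h)); rewrite ?pos_ge0 // posS //.
  by rewrite rleD2r.
apply/le_anti/andP; split; last by rewrite ge_max !mono // rjoin_ler.
apply/ler_addgt0Pr => e e0; apply: stdpart_le => //.
set l := _ + e.
have hx : stdpart x < l by rewrite ltr_pwDr // le_max lexx.
have hy : stdpart y < l by rewrite ltr_pwDr // le_max lexx orbT.
apply: (idealS (iJ.1 _ _ (stdpart_lt Ix hx) (stdpart_lt Iy hy))); first exact: pos_ge0.
rewrite pos_le raddr_ge0 ?pos_ge0 // andbT rjoinDr rjoin_le; apply/andP; split.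
  by apply: (le_trans (le_pos (x - _))); rewrite rleDl pos_ge0.
by apply: (le_trans (le_pos (y - _))); rewrite rleDr pos_ge0.
Qed.

End StandardPart.

(** If [x] is not positive then some [v = (x^- - d u)^+], with [d > 0], is
    nonzero, and the standard part modulo a prime ideal avoiding [v] is at most
    [- d] at [x].  This transfers inequalities between finitely many elements
    from the real line to a Dedekind complete space. *)
Lemma ge0_of_states (dc : dedekind_complete [set: V]) u x : 0 <= u -> pideal u x ->
  (forall w, state u w -> 0 <= w x) -> 0 <= x.
Proof.
move=> u0 Ix h; rewrite -[x]opprK roppr_ge0.
suff : pos (- x) <= 0 by apply: le_trans; exact: le_pos.
apply: (archimedean_eps dc (y := u)) => d d0; apply: contrapT => hd.
pose v := pos (pos (- x) - d *: u).
have v0 : 0 <= v by exact: pos_ge0.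
have vn0 : v <> 0.
  move=> e; apply: hd; rewrite -[d *: u]add0r -rleBlDr -e; exact: le_pos.
have [J [iJ J0 Jv pJ]] := exists_prime_ideal v0 vn0.
have Inx : pideal u (pos (- x)) by apply: pideal_pos => //; exact: pidealN.
have Ju : ~ J u.
  move=> Ju; apply: Jv; have [c hc] := Ix.
  apply: (@idealS J iJ _ (c *: u)) => //; first exact: idealZ.
  rewrite pos_le (le_trans (rabs_ge0 x) hc) andbT.
  apply: (@le_trans _ _ (pos (- x))).
    by rewrite rleBlDr rleDl rieszZ_ge0 // ltW.
  by apply: le_trans hc; rewrite -rabsN pos_le_rabs.
have sw := state_stdpart iJ J0 pJ u0 Ju.
have dx : d <= stdpart J u (pos (- x)).
  rewrite leNgt; apply/negP => k; apply: Jv; exact: (stdpart_lt iJ J0 u0 Ju Inx k).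
have := h _ sw; move: dx; rewrite (state_pos sw); last exact: pidealN.
rewrite (stateN sw) // le_max => /orP[dx x0|]; last by rewrite leNgt d0.
by have := lt_le_trans d0 dx; rewrite oppr_gt0 ltNge x0.
Qed.

Lemma le_of_states (dc : dedekind_complete [set: V]) u x y : 0 <= u ->
  pideal u x -> pideal u y -> (forall w, state u w -> w x <= w y) -> x <= y.
Proof.
move=> u0 Ix Iy h; rewrite -rsubr_ge0; apply: (ge0_of_states dc u0).
  exact: pidealB.
by move=> w sw; rewrite (stateB sw) // subr_ge0 h.
Qed.

End ExistenceOfStates.

(** * Band projections and Euclidean norms *)

Section RealHypot.
Context (R : realType).
Implicit Types A B t : R.

Lemma sqrt_compl t : 0 <= t <= 1 -> Num.sqrt (1 - t ^+ 2) ^+ 2 = 1 - t ^+ 2.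
Proof. by move=> /andP[t0 t1]; rewrite sqr_sqrtr // subr_ge0 expr_le1. Qed.

Lemma le_hypot A B t : 0 <= A -> 0 <= B -> 0 <= t <= 1 ->
  t * A + Num.sqrt (1 - t ^+ 2) * B <= Num.sqrt (A ^+ 2 + B ^+ 2).
Proof.
move=> A0 B0 ht; have hs := sqrt_compl ht; move/andP: ht => [t0 t1].
set s := Num.sqrt (1 - _) in hs *; have s0 : 0 <= s by exact: sqrtr_ge0.
rewrite -(ler_pXn2r (ltn0Sn 1)) ?nnegrE ?sqrtr_ge0 //; last first.
  by rewrite addr_ge0 // mulr_ge0.
rewrite sqr_sqrtr ?addr_ge0 ?sqr_ge0 // -subr_ge0.
have -> : A ^+ 2 + B ^+ 2 - (t * A + s * B) ^+ 2 = (s * A - t * B) ^+ 2.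
  have -> : A ^+ 2 + B ^+ 2 = (t ^+ 2 + s ^+ 2) * (A ^+ 2 + B ^+ 2).
    by rewrite hs; ring.
  by ring.
exact: sqr_ge0.
Qed.

Lemma hypot_attained A B : 0 <= A -> 0 <= B -> exists2 t, 0 <= t <= 1 &
  Num.sqrt (A ^+ 2 + B ^+ 2) = t * A + Num.sqrt (1 - t ^+ 2) * B.
Proof.
move=> A0 B0; set r := Num.sqrt _; have r0 : 0 <= r by exact: sqrtr_ge0.
have r2 : r ^+ 2 = A ^+ 2 + B ^+ 2 by rewrite sqr_sqrtr // addr_ge0 ?sqr_ge0.
have Ar : A <= r by rewrite -(ler_pXn2r (ltn0Sn 1)) ?nnegrE // r2 lerDl sqr_ge0.
have Br : B <= r by rewrite -(ler_pXn2r (ltn0Sn 1)) ?nnegrE // r2 lerDr sqr_ge0.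
have [rp|rn] := ltP 0 r; last first.
  have rz : r = 0 by apply/le_anti; rewrite rn r0.
  have Az : A = 0 by apply/le_anti; rewrite A0 -rz Ar.
  have Bz : B = 0 by apply/le_anti; rewrite B0 -rz Br.
  by exists 0; rewrite ?lexx ?ler01 // rz Az Bz !mulr0 addr0.
exists (A / r); first by rewrite divr_ge0 //= ler_pdivrMr // mul1r.
have -> : 1 - (A / r) ^+ 2 = (B / r) ^+ 2.
  by rewrite !expr_div_n -[1](divff (_ : r ^+ 2 != 0)) ?expf_neq0 ?gt_eqF // -mulrBl r2; congr (_ / _); ring.
rewrite sqrtr_sqr ger0_norm ?divr_ge0 //.
have -> : A / r * A + B / r * B = r ^+ 2 / r by rewrite r2; ring.
by rewrite expr2 mulfK ?gt_eqF.
Qed.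

Lemma min_eq0 A B : 0 < B -> Num.min A B = 0 -> A = 0.
Proof. by move=> B0; rewrite /Num.min; case: ifP => // _ h; move: B0; rewrite h ltxx. Qed.

Lemma between_multiple (d p q : R) : 0 <= p <= Num.max d 0 ->
  0 <= q <= Num.max (- d) 0 -> exists2 t, 0 <= t <= 1 & p - q = t * d.
Proof.
have [d0|d0|->] := ltgtP d 0.
- rewrite max_l ?oppr_ge0 ?(ltW d0) // => p0 /andP[q0 qd].
  exists (q / - d); first by rewrite divr_ge0 ?oppr_ge0 ?(ltW d0) //= ler_pdivrMr ?oppr_gt0 // mul1r.
  have -> : p = 0 by apply/le_anti; rewrite andbC.
  by rewrite sub0r invrN mulrN mulNr mulfVK ?lt_eqF.
- rewrite max_r ?oppr_le0 ?(ltW d0) // => /andP[p0 pd] q0.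
  exists (p / d); first by rewrite divr_ge0 ?(ltW d0) //= ler_pdivrMr // mul1r.
  have -> : q = 0 by apply/le_anti; rewrite andbC.
  by rewrite subr0 mulfVK ?gt_eqF.
rewrite oppr0 maxxx => p0 q0; exists 0; rewrite ?lexx ?ler01 // mulr0.
have -> : q = 0 by apply/le_anti; rewrite andbC.
by rewrite subr0; apply/le_anti; rewrite andbC.
Qed.

End RealHypot.

Section BandProjection.
Context (R : realType) (V : rieszType R).
Hypothesis dc : dedekind_complete [set: V].
Implicit Types (x y z b c d u : V).

(** The projection of a positive element [y] onto the band of [b >= 0];
    [sbproj] extends it to elements of any sign. *)
Definition bproj b y := supof (range (fun m : nat => rmeet y (m%:R *: b))).

Definition sbproj b y := bproj b (pos y) - bproj b (pos (- y)).

Section Positive.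
Context (b y : V).
Hypotheses (b0 : 0 <= b) (y0 : 0 <= y).

Lemma bprojP : is_sup setT (range (fun m : nat => rmeet y (m%:R *: b))) (bproj b y).
Proof.
apply: dc_supof => //; first by exists (rmeet y (0%:R *: b)); exists 0%N.
by exists y => _ [m _ <-]; exact: (rmeet_lel _ _).1.
Qed.

Lemma bproj_ge m : rmeet y (m%:R *: b) <= bproj b y.
Proof. by have [_ us _] := bprojP; apply: us; exists m. Qed.

Lemma bproj_le z : (forall m : nat, rmeet y (m%:R *: b) <= z) -> bproj b y <= z.
Proof. by move=> h; have [_ _ ls] := bprojP; apply: ls => // _ [m _ <-]. Qed.

Lemma bproj_ge0 : 0 <= bproj b y.
Proof. by apply: le_trans (bproj_ge 0); rewrite scale0r le_rmeet y0 lexx. Qed.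

Lemma bproj_lel : bproj b y <= y.
Proof. by apply: bproj_le => m; exact: (rmeet_lel _ _).1. Qed.

(** If [r] is the infimum below, then [r + (y /\ m b) <= y /\ (m + 1) b], so
    [r] can be subtracted from the supremum. *)
Lemma bproj_compl_disj : rmeet (y - bproj b y) b = 0.
Proof.
set r := rmeet _ _; apply/le_anti/andP; split; last first.
  by rewrite le_rmeet b0 rsubr_ge0 bproj_lel.
suff : bproj b y <= bproj b y - r by rewrite rleDl roppr_ge0.
apply: bproj_le => m; rewrite rleBrDr; apply: le_trans (bproj_ge m.+1).
rewrite le_rmeet; apply/andP; split.
  rewrite -[X in _ <= X](subrK (bproj b y)) addrC.
  by apply: rleD; [exact: (rmeet_lel _ _).1|exact: bproj_ge].
rewrite -natr1 scalerDl scale1r.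
by apply: rleD; [exact: (rmeet_lel _ _).2|exact: (rmeet_lel _ _).2].
Qed.

Lemma bproj_disj c : 0 <= c -> rmeet b c = 0 -> rmeet (bproj b y) c = 0.
Proof.
move=> c0 bc; apply/le_anti/andP; split; last by rewrite le_rmeet bproj_ge0.
have [_ _ ls] := is_sup_meet c bprojP; rewrite rmeetC; apply: ls => // _ [_ [m _ <-] <-].
have mb0 : 0 <= m%:R *: b by rewrite rieszZ_ge0 ?ler0n.
rewrite -(disjZ (ler0n R m) b0 c0 bc) rmeetC.
by rewrite rmeetS // rmeet_lel.
Qed.

End Positive.

Section States.
Context (u : V) (w : V -> R).
Hypothesis sw : state u w.
Local Notation I := (pideal u).

Lemma pideal_bproj b y : 0 <= y -> I y -> I (bproj b y).
Proof. by move=> y0 Iy; apply: pideal_le Iy _ _; rewrite ?bproj_ge0 ?bproj_lel. Qed.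

Lemma pideal_sbproj b y : I y -> I (sbproj b y).
Proof.
move=> Iy; apply: pidealB; apply: pideal_bproj; rewrite ?pos_ge0 //.
  exact: pideal_pos.
by apply: pideal_pos => //; exact: pidealN.
Qed.

Lemma state_bproj b y : 0 <= b -> 0 <= y -> I b -> I y ->
  [/\ 0 <= w (bproj b y) <= w y,
      0 < w b -> w (bproj b y) = w y &
      forall c, 0 <= c -> I c -> rmeet b c = 0 -> 0 < w c -> w (bproj b y) = 0].
Proof.
move=> b0 y0 Ib Iy; have Ip := pideal_bproj b y0 Iy.
have p0 : 0 <= w (bproj b y) by apply: (state_ge0 sw) => //; exact: bproj_ge0.
have py : w (bproj b y) <= w y by apply: (state_le sw) => //; exact: bproj_lel.
split; first by rewrite p0.
  move=> wb; have Id := pidealB Iy Ip.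
  have := congr1 w (bproj_compl_disj y b0).
  rewrite (state_meet sw) // (state0 sw) (stateB sw) // => /(min_eq0 wb) /eqP.
  by rewrite subr_eq0 => /eqP.
move=> c c0 Ic bc wc; have := congr1 w (bproj_disj b0 y0 c0 bc).
by rewrite (state_meet sw) // (state0 sw) => /(min_eq0 wc).
Qed.

(** A state sees a band projection as multiplication by a number between 0
    and 1, which is an indicator wherever the state decides the band. *)
Lemma state_sbproj z d : I z -> I d -> exists2 t, 0 <= t <= 1 &
  [/\ w (sbproj (pos z) d) = t * w d, 0 < w z -> t = 1 & w z < 0 -> t = 0].
Proof.
move=> Iz Id; have Nd := pidealN Id; have Nz := pidealN Iz.
have Id1 := pideal_pos Id; have Id2 := pideal_pos Nd.
have Iz1 := pideal_pos Iz; have Iz2 := pideal_pos Nz.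
have [h1 h2 h3] := state_bproj (pos_ge0 z) (pos_ge0 d) Iz1 Id1.
have [k1 k2 k3] := state_bproj (pos_ge0 z) (pos_ge0 (- d)) Iz1 Id2.
have Ip1 := pideal_bproj (pos z) (pos_ge0 d) Id1.
have Ip2 := pideal_bproj (pos z) (pos_ge0 (- d)) Id2.
rewrite (stateB sw) //.
have wz : w (pos z) = Num.max (w z) 0 by rewrite (state_pos sw).
have wnz : w (pos (- z)) = Num.max (- w z) 0 by rewrite (state_pos sw) // (stateN sw).
have wd : w (pos d) = Num.max (w d) 0 by rewrite (state_pos sw).
have wnd : w (pos (- d)) = Num.max (- w d) 0 by rewrite (state_pos sw) // (stateN sw).
have e : w (pos d) - w (pos (- d)) = w d.
  have Ip := pideal_pos Id; have Iq := pideal_pos Nd.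
  by rewrite -(stateB sw) // posBN.
have [z0|z0|z0] := ltgtP (w z) 0.
- exists 0; first by rewrite lexx ler01.
  split=> //.
  have wc : 0 < w (pos (- z)) by rewrite wnz lt_max oppr_gt0 z0.
  rewrite (h3 _ (pos_ge0 _) Iz2 (posN_meet z) wc).
  by rewrite (k3 _ (pos_ge0 _) Iz2 (posN_meet z) wc) subr0 mul0r.
- exists 1; first by rewrite lexx ler01.
  split=> //.
  by rewrite h2 ?k2 ?mul1r // wz lt_max z0.
rewrite wd in h1; rewrite wnd in k1.
have [t t01 ht] := between_multiple h1 k1.
by exists t => //; split.
Qed.

End States.
End BandProjection.

Section Hypot.
Context (R : realType) (V : rieszType R).
Hypothesis dc : dedekind_complete [set: V].
Implicit Types (a b z : V) (t : R).

Definition hsec a b t := t *: rabs a + Num.sqrt (1 - t ^+ 2) *: rabs b.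

(** The square root of [a ^+ 2 + b ^+ 2], as an envelope of linear forms: no
    product is involved. *)
Definition rhypot a b := supof [set hsec a b t | t in [set t : R | 0 <= t <= 1]].

Lemma rhypotP a b :
  is_sup setT [set hsec a b t | t in [set t : R | 0 <= t <= 1]] (rhypot a b).
Proof.
apply: dc_supof => //; first by exists (hsec a b 0); exists 0; rewrite //= lexx ler01.
exists (rabs a + rabs b) => _ [t /= /andP[t0 t1] <-]; apply: rleD.
  by rewrite -[X in _ <= X]scale1r rleZr // rabs_ge0.
rewrite -[X in _ <= X]scale1r rleZr ?rabs_ge0 // -[X in _ <= X]sqrtr1 ler_wsqrtr //.
by rewrite gerBl sqr_ge0.
Qed.

Lemma hsec_le_rhypot a b t : 0 <= t <= 1 -> hsec a b t <= rhypot a b.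
Proof. by move=> ht; have [_ us _] := rhypotP a b; apply: us; exists t. Qed.

Lemma rhypot_le a b z : (forall t, 0 <= t <= 1 -> hsec a b t <= z) -> rhypot a b <= z.
Proof. by move=> h; have [_ _ ls] := rhypotP a b; apply: ls => // _ [t ht <-]; exact: h. Qed.

Lemma hsec_ge0 a b t : 0 <= t -> 0 <= hsec a b t.
Proof. by move=> t0; rewrite raddr_ge0 // rieszZ_ge0 ?rabs_ge0 // sqrtr_ge0. Qed.

Lemma rhypot_ge0 a b : 0 <= rhypot a b.
Proof.
by apply: le_trans (hsec_le_rhypot a b (_ : 0 <= 0 <= 1)); rewrite ?hsec_ge0 ?lexx ?ler01.
Qed.

Lemma rhypot_leD a b : rhypot a b <= rabs a + rabs b.
Proof.
apply: rhypot_le => t /andP[t0 t1]; apply: rleD.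
  by rewrite -[X in _ <= X]scale1r rleZr // rabs_ge0.
rewrite -[X in _ <= X]scale1r rleZr ?rabs_ge0 // -[X in _ <= X]sqrtr1 ler_wsqrtr //.
by rewrite gerBl sqr_ge0.
Qed.

Lemma foldr_rjoin_ge (s : seq V) z : z \in s -> z <= foldr (@rjoin R V) 0 s.
Proof.
elim: s => //= y s ih; rewrite inE => /orP[/eqP->|/ih h]; first exact: (rjoin_ler _ _).1.
exact: le_trans h (rjoin_ler _ _).2.
Qed.

Section States.
Context (u : V) (w : V -> R).
Hypothesis sw : state u w.
Local Notation I := (pideal u).

Lemma pideal_rhypot a b : I a -> I b -> I (rhypot a b).
Proof.
move=> Ia Ib; apply: pideal_le (rhypot_ge0 a b) (rhypot_leD a b).
by apply: pidealD; exact: pideal_abs.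
Qed.

Lemma pideal_hsec a b t : I a -> I b -> I (hsec a b t).
Proof. by move=> Ia Ib; apply: pidealD; apply: pidealZ; exact: pideal_abs. Qed.

Lemma state_hsec a b t : I a -> I b ->
  w (hsec a b t) = t * `|w a| + Num.sqrt (1 - t ^+ 2) * `|w b|.
Proof.
move=> Ia Ib; have ha := pideal_abs Ia; have hb := pideal_abs Ib.
by rewrite (stateD sw) ?(stateZ sw) ?(state_abs sw) //; exact: pidealZ.
Qed.

Lemma state_foldr_rjoin (s : seq V) (r : R) : 0 <= r ->
  (forall z, z \in s -> I z /\ w z <= r) ->
  I (foldr (@rjoin R V) 0 s) /\ w (foldr (@rjoin R V) 0 s) <= r.
Proof.
move=> r0; elim: s => [_|z s ih h] /=; first by rewrite (state0 sw); split=> //; exact: pideal0.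
have [] := ih; first by move=> y ys; apply: h; rewrite inE ys orbT.
have [Iz wz] := h z (mem_head _ _) => If wf.
by split; [exact: pideal_join|rewrite (state_join sw) // ge_max wz].
Qed.

(** The supremum in [rhypot] is within [(1 / n) |a|] of a finite one, which
    states preserve. *)
Lemma state_rhypot a b : I a -> I b ->
  w (rhypot a b) = Num.sqrt (w a ^+ 2 + w b ^+ 2).
Proof.
move=> Ia Ib; rewrite -(real_normK (num_real (w a))) -(real_normK (num_real (w b))).
have Ih := pideal_rhypot Ia Ib.
apply/le_anti/andP; split; last first.
  have [t ht ->] := hypot_attained (normr_ge0 (w a)) (normr_ge0 (w b)).
  rewrite -(state_hsec _ Ia Ib); apply: (state_le sw) => //; first exact: pideal_hsec.
  exact: hsec_le_rhypot.
set r := Num.sqrt _; have r0 : 0 <= r by exact: sqrtr_ge0.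
apply/ler_addgt0Pr => e e0.
pose n := (Num.trunc (`|w a| / e)).+1.
have n0 : 0 < n%:R :> R by rewrite ltr0n.
pose s := [seq hsec a b (i%:R / n%:R) | i <- iota 0 n.+1].
have ratio i : (i <= n)%N -> 0 <= (i%:R / n%:R : R) <= 1.
  by move=> hi; rewrite divr_ge0 ?ler0n //= ler_pdivrMr // mul1r ler_nat.
have hs z : z \in s -> I z /\ w z <= r.
  move=> /mapP[i]; rewrite mem_iota add0n ltnS => /andP[_ hi] ->; split; first exact: pideal_hsec.
  by rewrite state_hsec // le_hypot // ratio.
have [If wf] := state_foldr_rjoin r0 hs.
have Ina : I (n%:R^-1 *: rabs a) by apply: pidealZ; exact: pideal_abs.
have key : rhypot a b <= foldr (@rjoin R V) 0 s + n%:R^-1 *: rabs a.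
  apply: rhypot_le => t /andP[t0 t1].
  have tn0 : 0 <= t * n%:R by rewrite mulr_ge0 // ltW.
  have /andP[i1 i2] := truncn_itv tn0; set i := Num.truncn _ in i1 i2.
  have hi : (i <= n)%N.
    by rewrite -(ler_nat R) (le_trans i1) // -[X in _ <= X]mul1r ler_wpM2r // ltW.
  have it : i%:R / n%:R <= t by rewrite ler_pdivrMr.
  have ti : t <= i%:R / n%:R + n%:R^-1.
    by rewrite -[X in _ + X]div1r -mulrDl ler_pdivlMr // natr1 ltW.
  apply: (@le_trans _ _ (hsec a b (i%:R / n%:R) + n%:R^-1 *: rabs a)); last first.
    rewrite rleD2r; apply: foldr_rjoin_ge; apply/mapP.
    by exists i; rewrite // mem_iota add0n ltnS.
  rewrite /hsec addrAC -scalerDl; apply: rleD; first by rewrite rleZr // rabs_ge0.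
  rewrite rleZr ?rabs_ge0 // ler_wsqrtr // lerB // ler_pXn2r ?nnegrE //.
have := state_le sw Ih (pidealD If Ina) key.
rewrite (stateD sw) // (stateZ sw) ?(state_abs sw) //; last exact: pideal_abs.
move=> /le_trans; apply; apply: lerD => //.
rewrite mulrC ler_pdivrMr // mulrC -ler_pdivrMr //.
by apply: ltW; exact: truncnS_gt.
Qed.

End States.
End Hypot.

(** * A pathwise form of Davis' inequality *)

Section RealDavis.
Context (R : realType).
Implicit Types (x s m d A : R).

(** The potential of the pathwise inequality: its increments are dominated by
    those of the integral of [2 x / A] against the path. *)
Definition davis_potential x s A := (x ^+ 2 + s ^+ 2) / A + A - 10 * s.

(** The one-step inequality with denominators cleared.  A large enough constant
    in front of [s' - s] works because a jump is either comparable to [A], when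
    [d ^+ 2] is at most a multiple of [(s' - s) * A], or so large that it sets a
    new maximum with [A' - A] of order [Num.sqrt 2 * `|d|], when the left-hand
    side nearly cancels. *)
Lemma davis_cleared x s m d A s' m' A' : 0 <= s -> `|x| <= m -> 0 <= s' -> 0 < A ->
  0 <= A' -> s' ^+ 2 = s ^+ 2 + d ^+ 2 -> m' = Num.max m `|x + d| ->
  A ^+ 2 = s ^+ 2 + m ^+ 2 -> A' ^+ 2 = s' ^+ 2 + m' ^+ 2 ->
  (A' - A) * (A * A' - ((x + d) ^+ 2 + s' ^+ 2)) + 2 * d ^+ 2 * A' <=
  10 * (s' - s) * (A * A').
Proof.
move=> s0 xm s'0 A0 A'0 hs hm hA hA'.
have m0 : 0 <= m := le_trans (normr_ge0 x) xm.
have x2 : x ^+ 2 <= m ^+ 2 by rewrite -(real_normK (num_real x)) ler_pXn2r // nnegrE.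
have sA : s <= A by rewrite -(ler_pXn2r (ltn0Sn 1)) ?nnegrE ?(ltW A0) // hA lerDl sqr_ge0.
have mA : m <= A by rewrite -(ler_pXn2r (ltn0Sn 1)) ?nnegrE ?(ltW A0) // hA lerDr sqr_ge0.
have ss' : s <= s' by rewrite -(ler_pXn2r (ltn0Sn 1)) ?nnegrE // hs lerDl sqr_ge0.
have ds' : `|d| <= s'.
  by rewrite -(ler_pXn2r (ltn0Sn 1)) ?nnegrE // real_normK ?num_real // hs lerDr sqr_ge0.
have [new|old] := leP m `|x + d|; last first.
  (* no new maximum: the increment satisfies [`|d| <= 2 * A] *)
  rewrite max_l ?(ltW old) // in hm; rewrite {}hm in hA'.
  have dA : `|d| <= 2 * A.
    have -> : d = (x + d) - x by rewrite addrC addKr.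
    rewrite mulr2n mulrDl mul1r; apply: le_trans (ler_normB _ _) _.
    by rewrite lerD // (le_trans _ mA) // ltW.
  have d2 : d ^+ 2 <= 4 * A ^+ 2.
    rewrite -(real_normK (num_real d)).
    have -> : 4 * A ^+ 2 = (2 * A) ^+ 2 by ring.
    by rewrite ler_pXn2r // nnegrE mulr_ge0 // ltW.
  have s'A : s' <= 3 * A.
    rewrite -(ler_pXn2r (ltn0Sn 1)) ?nnegrE ?mulr_ge0 ?(ltW A0) // hs.
    have s2 : s ^+ 2 <= A ^+ 2 by rewrite ler_pXn2r // nnegrE ltW.
    by have -> : (3 * A) ^+ 2 = 9 * A ^+ 2 by [ring|]; nra.
  have AA' : A <= A' by rewrite -(ler_pXn2r (ltn0Sn 1)) ?nnegrE ?(ltW A0) // hA hA' hs; nra.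
  have hd1 : d ^+ 2 = (A' - A) * (A' + A) by nra.
  have hd2 : d ^+ 2 = (s' - s) * (s' + s) by nra.
  have q0 : 0 <= (A' - A) * ((x + d) ^+ 2 + s' ^+ 2).
    by rewrite mulr_ge0 ?subr_ge0 // addr_ge0 ?sqr_ge0.
  have h1 : (A' - A) * A * 2 <= d ^+ 2.
    by rewrite hd1 -mulrA ler_wpM2l ?subr_ge0 //; lra.
  have h2 : d ^+ 2 <= (s' - s) * (4 * A).
    by rewrite hd2 ler_wpM2l ?subr_ge0 //; lra.
  have h3 : (A' - A) * A * 2 * A' <= d ^+ 2 * A' by rewrite ler_wpM2r.
  have h4 : d ^+ 2 * A' <= (s' - s) * (4 * A) * A' by rewrite ler_wpM2r.
  nra.
(* new maximum: then [A' ^+ 2] equals [(x + d) ^+ 2 + s' ^+ 2] *)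
rewrite max_r // in hm.
have hq : A' ^+ 2 = (x + d) ^+ 2 + s' ^+ 2.
  by rewrite hA' hm real_normK ?num_real // addrC.
have -> : (A' - A) * (A * A' - ((x + d) ^+ 2 + s' ^+ 2)) + 2 * d ^+ 2 * A' =
   A' * (2 * d ^+ 2 - (A' - A) ^+ 2) by rewrite -hq; ring.
have -> : 10 * (s' - s) * (A * A') = A' * (10 * (s' - s) * A) by ring.
apply: ler_wpM2l => //.
have [small|big] := leP s' (4 * A).
  have h : (s' - s) * (s' + s) <= (s' - s) * (5 * A).
    by rewrite ler_wpM2l ?subr_ge0 //; lra.
  have k : 0 <= (A' - A) ^+ 2 by exact: sqr_ge0.
  have hd2 : d ^+ 2 = (s' - s) * (s' + s) by nra.
  nra.
have xd : `|x * d| <= A * s'.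
  by rewrite normrM ler_pM // (le_trans xm).
have /andP[xd1 xd2] : - (A * s') <= x * d <= A * s' by rewrite -ler_norml.
have d2 : d ^+ 2 <= s' ^+ 2 by rewrite hs lerDr sqr_ge0.
have hq2 : A' ^+ 2 = x ^+ 2 + s ^+ 2 + 2 * (x * d) + 2 * d ^+ 2 by rewrite hq hs; ring.
have As' : A * s' <= s' ^+ 2 / 4 by rewrite expr2; nra.
have A2 : A ^+ 2 <= s' ^+ 2 / 16.
  have -> : s' ^+ 2 / 16 = (s' / 4) ^+ 2 by field.
  by rewrite ler_pXn2r ?nnegrE ?divr_ge0 ?(ltW A0) //; lra.
have A's : A' <= 2 * s'.
  rewrite -(ler_pXn2r (ltn0Sn 1)) ?nnegrE ?mulr_ge0 //.
  have -> : (2 * s') ^+ 2 = 4 * s' ^+ 2 by ring.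
  by rewrite hq2; lra.
have AA's : A * A' <= A * (2 * s') by rewrite ler_wpM2l // ltW.
have p0 : 0 <= x ^+ 2 + s ^+ 2 by rewrite addr_ge0 ?sqr_ge0.
have last_ : A * (4 * s) <= A * s' by rewrite ler_wpM2l ?(ltW A0) //; lra.
nra.
Qed.

(** One step of the path, for a multiplier [th] that approximates [x / A]. *)
Lemma davis_step x s m d A s' m' A' th e : 0 <= e ->
  0 <= s -> `|x| <= m -> 0 <= s' -> 0 <= A -> 0 <= A' ->
  s' ^+ 2 = s ^+ 2 + d ^+ 2 -> m' = Num.max m `|x + d| ->
  A ^+ 2 = s ^+ 2 + m ^+ 2 -> A' ^+ 2 = s' ^+ 2 + m' ^+ 2 ->
  `|th| <= 1 -> (0 < A -> `|th - x / A| <= e) ->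
  davis_potential (x + d) s' A' - davis_potential x s A <=
    2 * (th * d) + 2 * e * `|d|.
Proof.
move=> e0 s0 xm s'0; rewrite le_eqVlt => /orP[/eqP A0|A0] A'0 hs hm hA hA' th1 the.
  (* the potential vanishes at [A = 0], where the quotient is zero by
     convention, and [10 * s'] leaves room for any multiplier *)
  have s2 : s ^+ 2 = 0 by nra.
  have m2 : m ^+ 2 = 0 by nra.
  have sz : s = 0 by apply/eqP; rewrite -sqrf_eq0 s2.
  have mz : m = 0 by apply/eqP; rewrite -sqrf_eq0 m2.
  have xz : x = 0 by apply/eqP; rewrite -normr_le0 -mz.
  rewrite sz xz mz add0r in hs hm hA' *; rewrite expr0n /= add0r in hs.
  have s'd : s' = `|d|.
    by apply/eqP; rewrite -(eqrXn2 (ltn0Sn 1)) // hs real_normK ?num_real.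
  rewrite max_r ?normr_ge0 // in hm.
  have hA2 : A' ^+ 2 = d ^+ 2 + s' ^+ 2 by rewrite hA' hm real_normK ?num_real // addrC.
  have q : (d ^+ 2 + s' ^+ 2) / A' = A'.
    rewrite -hA2; have [->|nz] := eqVneq A' 0; first by rewrite invr0 mulr0.
    by rewrite expr2 mulfK.
  have A'd : A' <= 2 * `|d|.
    rewrite -(ler_pXn2r (ltn0Sn 1)) ?nnegrE ?mulr_ge0 // hA2 s'd exprMn.
    rewrite real_normK ?num_real //; have := sqr_ge0 d; nra.
  have thd : - `|d| <= th * d.
    apply: lerNnormlW; rewrite normrM -[X in _ <= X]mul1r.
    by rewrite ler_wpM2r.
  have ed : 0 <= e * `|d| by rewrite mulr_ge0.
  rewrite /davis_potential q -A0 invr0 !mulr0 s'd; have := normr_ge0 d.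
  by lra.
have key := davis_cleared s0 xm s'0 A0 A'0 hs hm hA hA'.
have AA' : A <= A'.
  rewrite -(ler_pXn2r (ltn0Sn 1)) ?nnegrE ?(ltW A0) // hA hA' hs.
  have m0 : 0 <= m := le_trans (normr_ge0 x) xm.
  have : m ^+ 2 <= m' ^+ 2.
    by rewrite hm ler_pXn2r ?nnegrE // ?le_max ?lexx ?m0.
  by have := sqr_ge0 d; lra.
have A'p : 0 < A' := lt_le_trans A0 AA'.
have main : davis_potential (x + d) s' A' - davis_potential x s A <= 2 * (x / A * d).
  rewrite /davis_potential -subr_ge0 -(pmulr_rge0 _ (mulr_gt0 A0 A'p)).
  have -> : A * A' * (2 * (x / A * d) - (((x + d) ^+ 2 + s' ^+ 2) / A' + A' - 10 * s' -
     ((x ^+ 2 + s ^+ 2) / A + A - 10 * s))) =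
     10 * (s' - s) * (A * A') - (A' - A) * (A * A') -
       A * ((x + d) ^+ 2 + s' ^+ 2) + A' * (x ^+ 2 + s ^+ 2 + 2 * (x * d)).
    by field; rewrite !gt_eqF.
  have -> : x ^+ 2 + s ^+ 2 + 2 * (x * d) = (x + d) ^+ 2 + s' ^+ 2 - 2 * d ^+ 2.
    by rewrite hs; ring.
  by move: key; lra.
have err : (x / A - th) * d <= e * `|d|.
  apply: le_trans (ler_norm _) _; rewrite normrM ler_wpM2r // distrC; exact: the.
by nra.
Qed.

(** The steps telescope.  The last potential is at least [m N - 10 * s N]. *)
Lemma davis_path (N : nat) (d x s m A th : nat -> R) (e : R) : 0 <= e ->
  x 0%N = 0 -> s 0%N = 0 -> m 0%N = 0 ->
  (forall n, (n < N)%N -> [/\ x n.+1 = x n + d n, m n.+1 = Num.max (m n) `|x n.+1|,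
     s n.+1 = Num.sqrt (s n ^+ 2 + d n ^+ 2), `|th n| <= 1 &
     0 < A n -> `|th n - x n / A n| <= e]) ->
  (forall n, (n <= N)%N -> A n = Num.sqrt (s n ^+ 2 + m n ^+ 2)) ->
  m N <= 10 * s N + 2 * (\sum_(n < N) th n * d n) + 2 * e * \sum_(n < N) `|d n|.
Proof.
move=> e0 x0 s0 m0 step hA.
have sge n : (n <= N)%N -> 0 <= s n.
  by case: n => [|n] h; [rewrite s0|have [_ _ -> _ _] := step n h; exact: sqrtr_ge0].
have xm n : (n <= N)%N -> `|x n| <= m n.
  case: n => [|n] h; first by rewrite x0 m0 normr0.
  by have [_ -> _ _ _] := step n h; rewrite le_max lexx orbT.
have A0 n : (n <= N)%N -> 0 <= A n by move=> /hA ->; exact: sqrtr_ge0.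
have A2 n : (n <= N)%N -> A n ^+ 2 = s n ^+ 2 + m n ^+ 2.
  by move=> /hA ->; rewrite sqr_sqrtr // addr_ge0 ?sqr_ge0.
have pot n : (n <= N)%N -> davis_potential (x n) (s n) (A n) <=
    2 * (\sum_(i < n) th i * d i) + 2 * e * \sum_(i < n) `|d i|.
  elim: n => [|n ih] h.
    rewrite !big_ord0 hA // x0 s0 m0 /davis_potential expr0n /= addr0 sqrtr0.
    by rewrite invr0 !mulr0 !addr0 subr0.
  have [hx hm hs th1 the] := step n h.
  have := ih (ltnW h); rewrite !big_ord_recr /=.
  have hs2 : s n.+1 ^+ 2 = s n ^+ 2 + d n ^+ 2.
    by rewrite hs sqr_sqrtr // addr_ge0 ?sqr_ge0.
  rewrite hx in hm.
  have := davis_step e0 (sge _ (ltnW h)) (xm _ (ltnW h)) (sge _ h) (A0 _ (ltnW h))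
    (A0 _ h) hs2 hm (A2 _ (ltnW h)) (A2 _ h) th1 the.
  by rewrite -hx; lra.
have := pot N (leqnn N); rewrite /davis_potential => h.
have mA : m N <= A N.
  rewrite -(ler_pXn2r (ltn0Sn 1)) ?nnegrE ?A0 ?A2 ?(le_trans _ (xm N (leqnn N))) //.
  by rewrite lerDr sqr_ge0.
have : 0 <= (x N ^+ 2 + s N ^+ 2) / A N by rewrite divr_ge0 ?A0 // addr_ge0 ?sqr_ge0.
by lra.
Qed.

Lemma count_levels_lt0 (t : nat -> R) (y : R) n : y < 0 ->
  (forall j, y < j%:R -> t j = 0) -> \sum_(j < n) t j = 0.
Proof. by move=> y0 h; rewrite big1 // => j _; rewrite h // (lt_le_trans y0). Qed.

Lemma count_levels (t : nat -> R) (y : R) n : 0 <= y ->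
  (forall j, 0 <= t j <= 1) -> (forall j, j%:R < y -> t j = 1) ->
  (forall j, y < j%:R -> t j = 0) ->
  Num.min y n%:R <= \sum_(j < n) t j <= y + 1.
Proof.
move=> y0 t01 t1 t0.
suff : Num.min y n%:R <= \sum_(j < n) t j <= Num.min n%:R (y + 1).
  by move=> /andP[->]; rewrite le_min => /andP[].
elim: n => [|n /andP[l1 l2]].
  by rewrite big_ord0 ge_min le_min lexx orbT /= addr_ge0.
rewrite big_ord_recr /=; have /andP[tn0 tn1] := t01 n.
move: l2; rewrite le_min => /andP[l2 l3].
apply/andP; split; last first.
  rewrite le_min -natr1 lerD //=.
  have [yn|ny] := ltP y n%:R; first by rewrite t0 // addr0.
  lra.
rewrite ge_min -natr1; have [ny|yn] := ltP n%:R y.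
  by rewrite (min_r (ltW ny)) in l1; rewrite (t1 _ ny) lerD2r l1 orbT.
by rewrite (min_l yn) in l1; rewrite (le_trans l1) // lerDl.
Qed.

(** Levels below [`|x| / A] count fully and levels above it do not count, so at
    most the level at [`|x| / A] is in doubt. *)
Lemma step_approx (t t' : nat -> R) (x A : R) (n : nat) : 0 < A -> `|x| <= A ->
  (forall j, [/\ 0 <= t j <= 1, 0 < x - j%:R / n.+1%:R * A -> t j = 1 &
     x - j%:R / n.+1%:R * A < 0 -> t j = 0]) ->
  (forall j, [/\ 0 <= t' j <= 1, 0 < - x - j%:R / n.+1%:R * A -> t' j = 1 &
     - x - j%:R / n.+1%:R * A < 0 -> t' j = 0]) ->
  `|n.+1%:R^-1 * \sum_(j < n.+1) (t j - t' j) - x / A| <= n.+1%:R^-1.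
Proof.
move=> A0 xA; have n0 : 0 < n.+1%:R :> R by rewrite ltr0n.
wlog x0 : x xA t t' / 0 <= x => [hw|] ht ht'.
  have [/hw h|x0] := leP 0 x; first exact: h.
  have e : n.+1%:R^-1 * \sum_(j < n.+1) (t' j - t j) - (- x) / A =
      - (n.+1%:R^-1 * \sum_(j < n.+1) (t j - t' j) - x / A).
    by rewrite !sumrB; ring.
  rewrite -normrN -e.
  by apply: hw => //; rewrite ?normrN ?oppr_ge0 ?opprK // ltW.
have lev (z : R) (j : nat) : (z - j%:R / n.+1%:R * A < 0) = (n.+1%:R * z / A < j%:R).
  rewrite subr_lt0 ltr_pdivrMr // -ltr_pdivlMl //.
  by congr (_ < _); field; rewrite gt_eqF.
have lev' (z : R) (j : nat) : (0 < z - j%:R / n.+1%:R * A) = (j%:R < n.+1%:R * z / A).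
  rewrite subr_gt0 ltr_pdivlMr // -ltr_pdivrMl //.
  by congr (_ < _); field; rewrite gt_eqF.
pose y := n.+1%:R * x / A.
have y0 : 0 <= y by rewrite divr_ge0 ?mulr_ge0 // ltW.
have yn : y <= n.+1%:R.
  by rewrite ler_pdivrMr // ler_wpM2l ?(ltW n0) // (le_trans (ler_norm x)).
have hS : y <= \sum_(j < n.+1) t j <= y + 1.
  rewrite -{1}(min_l yn); apply: count_levels => // j; have [h1 h2 h3] := ht j => //.
    by rewrite -lev'.
  by rewrite -lev.
have hS' : 0 <= \sum_(j < n.+1) t' j <= 1 /\ (0 < y -> \sum_(j < n.+1) t' j = 0).
  have [xz|xp] := leP x 0.
    have {}xz : x = 0 by apply/le_anti; rewrite xz.
    have yz : y = 0 by rewrite /y xz mulr0 mul0r.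
    split; last by rewrite yz ltxx.
    rewrite -[X in _ <= _ <= X]add0r -{1}(min_l (ler0n R n.+1)).
    apply: count_levels => // j; have [h1 h2 h3] := ht' j => //.
      by move=> h; apply: h2; rewrite lev' xz oppr0 mulr0 mul0r.
    by move=> h; apply: h3; rewrite lev xz oppr0 mulr0 mul0r.
  have e0 : \sum_(j < n.+1) t' j = 0.
    apply: (@count_levels_lt0 _ (n.+1%:R * - x / A)).
      by rewrite mulrN mulNr oppr_lt0 divr_gt0 // mulr_gt0.
    by move=> j; rewrite -lev; have [] := ht' j.
  by rewrite e0 lexx ler01.
have -> : x / A = n.+1%:R^-1 * y by rewrite /y mulrA mulKf ?gt_eqF.
rewrite -mulrBr normrM (gtr0_norm (_ : 0 < n.+1%:R^-1)) ?invr_gt0 //.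
rewrite -[X in _ <= X]mulr1 ler_wpM2l ?invr_ge0 ?ler0n // sumrB.
set S := \sum_(j < n.+1) t j in hS *; set S' := \sum_(j < n.+1) t' j in hS' *.
move: hS hS' => /andP[S1 S2] [/andP[S3 S4] S5]; rewrite ler_norml.
have [yp|yz] := ltP 0 y; first by rewrite S5 //; apply/andP; split; lra.
by apply/andP; split; lra.
Qed.

End RealDavis.

(** * Davis' inequality for conditional expectations *)

Section PathwiseDavis.
Context (R : realType) (V : rieszType R).
Hypothesis dc : dedekind_complete [set: V].
Implicit Types (x d A u : V).

(** A step approximation of multiplication by [x / A], when [|x| <= A]: the
    average over the levels [j / n.+1] of the projections onto the bands where
    [x] exceeds [j / n.+1] times [A], minus those for [- x]. *)
Definition step_mul (n : nat) x A d : V := n.+1%:R^-1 *: \sum_(j < n.+1)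
  (sbproj (pos (x - (j%:R / n.+1%:R) *: A)) d -
   sbproj (pos (- x - (j%:R / n.+1%:R) *: A)) d).

Lemma state_step_mul u (w : V -> R) n x A d : state u w ->
  pideal u x -> pideal u A -> pideal u d -> `|w x| <= w A ->
  pideal u (step_mul n x A d) /\
  exists th, [/\ w (step_mul n x A d) = th * w d, `|th| <= 1 &
    0 < w A -> `|th - w x / w A| <= n.+1%:R^-1].
Proof.
move=> sw Ix IA Id xA.
have IxA (y : V) (c : R) : pideal u y -> pideal u (y - c *: A).
  by move=> Iy; apply: pidealB => //; exact: pidealZ.
have wxA (y : V) (c : R) : pideal u y -> w (y - c *: A) = w y - c * w A.
  by move=> Iy; rewrite (stateB sw) ?(stateZ sw) //; exact: pidealZ.
have Inx := pidealN Ix.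
have Isb z : pideal u (sbproj z d) by exact: pideal_sbproj.
have Idiff (j : nat) : pideal u (sbproj (pos (x - (j%:R / n.+1%:R) *: A)) d -
   sbproj (pos (- x - (j%:R / n.+1%:R) *: A)) d) by exact: pidealB.
split; first by apply: pidealZ; apply: pideal_sum => j; exact: Idiff.
have lev y : pideal u y -> {t : nat -> R & forall j, [/\ 0 <= t j <= 1,
    w (sbproj (pos (y - (j%:R / n.+1%:R) *: A)) d) = t j * w d,
    0 < w y - j%:R / n.+1%:R * w A -> t j = 1 &
    w y - j%:R / n.+1%:R * w A < 0 -> t j = 0]}.
  move=> Iy; have ex (j : nat) : exists t, [/\ 0 <= t <= 1,
      w (sbproj (pos (y - (j%:R / n.+1%:R) *: A)) d) = t * w d,
      0 < w y - j%:R / n.+1%:R * w A -> t = 1 & w y - j%:R / n.+1%:R * w A < 0 -> t = 0].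
    have [t t01 [h1 h2 h3]] := state_sbproj dc sw (IxA y (j%:R / n.+1%:R) Iy) Id.
    by exists t; split=> //; rewrite -wxA.
  exact: (choice ex).
have [t ht] := lev _ Ix; have [t' ht'] := lev _ Inx.
exists (n.+1%:R^-1 * \sum_(j < n.+1) (t j - t' j)); split.
- rewrite (stateZ sw); last by apply: pideal_sum => j; exact: Idiff.
  rewrite (state_sum sw) -?mulrA ?mulr_suml; last by move=> j; exact: Idiff.
  congr (_ * _); apply: eq_bigr => j _; rewrite (stateB sw) //.
  have [_ -> _ _] := ht j; have [_ -> _ _] := ht' j.
  by rewrite mulrBl.
- rewrite normrM gtr0_norm ?invr_gt0 // ler_pdivrMl // mulr1.
  apply: le_trans (ler_norm_sum _ _ _) _.
  have -> : n.+1%:R = \sum_(j < n.+1) (1 : R) by rewrite sumr_const card_ord.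
  apply: ler_sum => j _; have [/andP[a1 a2] _ _ _] := ht j.
  have [/andP[b1 b2] _ _ _] := ht' j; rewrite ler_norml.
  by rewrite lerBrDr lerBlDr (le_trans _ a1) ?addNr ?subr_le0 ?(le_trans a2) ?lerDl // addrC subr_le0.
move=> A0; apply: step_approx => // j; first by have [? _ ? ?] := ht j.
have [? _ h2 h3] := ht' j; split=> //.
  by rewrite -(stateN sw).
by rewrite -(stateN sw).
Qed.

Section Path.
Context (d : nat -> V).

Definition psum n : V := \sum_(i < n) d i.

(** Running maximum and square function of the path with increments [d]. *)
Fixpoint pmax n : V := if n is k.+1 then rjoin (pmax k) (rabs (psum n)) else 0.
Fixpoint psq n : V := if n is k.+1 then rhypot (psq k) (d k) else 0.

Definition pamp n : V := rhypot (psq n) (pmax n).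

Lemma psumS n : psum n.+1 = psum n + d n.
Proof. exact: big_ord_recr. Qed.

(** Read through a state, this is [davis_path] with integrand [psum n / pamp n];
    the last term pays for its step approximation. *)
Lemma davis_pathwise K N : pmax N <= 10 *: psq N +
  2 *: (\sum_(n < N) step_mul K (psum n) (pamp n) (d n)) +
  (2 * K.+1%:R^-1) *: \sum_(n < N) rabs (d n).
Proof.
pose u : V := \sum_(n < N) rabs (d n).
have u0 : 0 <= u by apply: rsum_ge0 => n _; exact: rabs_ge0.
have Id n : (n < N)%N -> pideal u (d n).
  move=> h; exists 1; rewrite scale1r /u (bigD1 (Ordinal h)) //= rleDl.
  by apply: rsum_ge0 => i _; exact: rabs_ge0.
have Ip n : (n <= N)%N -> [/\ pideal u (psum n), pideal u (pmax n) & pideal u (psq n)].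
  elim: n => [|n ih] h.
    by rewrite /psum big_ord0 /=; split; exact: pideal0.
  have [i1 i2 i3] := ih (ltnW h); have Ids := Id n h.
  have i4 : pideal u (psum n.+1) by rewrite psumS; exact: pidealD.
  split=> //=; last exact: pideal_rhypot.
  by apply: pideal_join => //; exact: pideal_abs.
have Ia n : (n <= N)%N -> pideal u (pamp n).
  by move=> /Ip[_ h1 h2]; exact: pideal_rhypot.
have [IN1 IN2 IN3] := Ip N (leqnn N).
(* what a state sees of the path *)
have path w : state u w -> (forall n, (n < N)%N -> [/\ w (psum n.+1) = w (psum n) + w (d n),
     w (pmax n.+1) = Num.max (w (pmax n)) `|w (psum n.+1)| &
     w (psq n.+1) = Num.sqrt (w (psq n) ^+ 2 + w (d n) ^+ 2)]) /\
     (forall n, (n <= N)%N -> w (pamp n) = Num.sqrt (w (psq n) ^+ 2 + w (pmax n) ^+ 2)).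
  move=> sw; split=> n h; last first.
    by have [_ i2 i3] := Ip n h; rewrite (state_rhypot dc sw).
  have [i1 i2 i3] := Ip n (ltnW h); have [j1 j2 j3] := Ip _ h; have Ids := Id n h.
  split; first by rewrite psumS (stateD sw).
    rewrite /= (state_join sw) // ?(state_abs sw) //; exact: pideal_abs.
  by rewrite /= (state_rhypot dc sw).
have xA w n : state u w -> (n < N)%N -> `|w (psum n)| <= w (pamp n).
  move=> sw h; have [step amp] := path w sw; rewrite (amp n (ltnW h)).
  have xm : `|w (psum n)| <= w (pmax n).
    case: n h => [|n] h; first by rewrite /psum big_ord0 (state0 sw) normr0.
    by have [_ -> _] := step n (ltnW h); rewrite le_max lexx orbT.
  apply: (le_trans xm); rewrite -(ler_pXn2r (ltn0Sn 1)) ?nnegrE ?sqrtr_ge0 //; last first.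
    exact: le_trans (normr_ge0 _) xm.
  by rewrite sqr_sqrtr ?addr_ge0 ?sqr_ge0 // lerDr sqr_ge0.
have smul w n : state u w -> (n < N)%N -> pideal u (step_mul K (psum n) (pamp n) (d n)) /\
   exists th, [/\ w (step_mul K (psum n) (pamp n) (d n)) = th * w (d n), `|th| <= 1 &
     0 < w (pamp n) -> `|th - w (psum n) / w (pamp n)| <= K.+1%:R^-1].
  move=> sw h; have [i1 _ _] := Ip n (ltnW h).
  by apply: state_step_mul => //; [exact: Ia (ltnW h)|exact: Id|exact: xA].
have Ism n : (n < N)%N -> pideal u (step_mul K (psum n) (pamp n) (d n)).
  move=> h; apply: pidealZ; apply: pideal_sum => j.
  by apply: pidealB; apply: pideal_sbproj => //; exact: Id.
have Isum : pideal u (\sum_(n < N) step_mul K (psum n) (pamp n) (d n)).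
  by elim/big_ind : _ => [|a b|i _]; [exact: pideal0|exact: pidealD|exact: Ism].
have Iu : pideal u u by exact: pideal_gen.
apply: (le_of_states dc u0) => //.
  apply: pidealD; last exact: pidealZ.
  by apply: pidealD; exact: pidealZ.
move=> w sw; have [step amp] := path w sw.
have thP n : {th | (n < N)%N -> [/\ w (step_mul K (psum n) (pamp n) (d n)) = th * w (d n),
    `|th| <= 1 & 0 < w (pamp n) -> `|th - w (psum n) / w (pamp n)| <= K.+1%:R^-1]}.
  apply: cid; have [h|h] := boolP (n < N)%N; last by exists 0.
  by have [_ [th hth]] := smul w n sw h; exists th.
pose th n := projT1 (thP n).
have hth n : (n < N)%N -> _ := projT2 (thP n).
rewrite (stateD sw); [|by apply: pidealD; exact: pidealZ|exact: pidealZ].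
rewrite (stateD sw); [|exact: pidealZ|exact: pidealZ].
rewrite !(stateZ sw) //.
have sumE (F : 'I_N -> V) : (forall i, pideal u (F i)) ->
    w (\sum_(i < N) F i) = \sum_(i < N) w (F i) by move=> hF; rewrite (state_sum sw).
rewrite sumE; last by move=> i; exact: Ism.
rewrite /u sumE; last by move=> i; apply: pideal_abs; exact: Id.
rewrite (eq_bigr (fun i : 'I_N => th i * w (d i))); last first.
  by move=> i _; have [] := hth i (ltn_ord i).
rewrite [X in _ <= _ + _ * X](eq_bigr (fun i : 'I_N => `|w (d i)|)); last first.
  by move=> i _; rewrite (state_abs sw) //; exact: Id.
apply: (davis_path (d := w \o d) (x := w \o psum) (s := w \o psq) (m := w \o pmax)
  (A := w \o pamp) (th := th)) => //=.
- by rewrite /psum big_ord0 (state0 sw).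
- exact: state0 sw.
- exact: state0 sw.
by move=> n h; have [a1 a2 a3] := step n h; have [b1 b2 b3] := hth n h; split.
Qed.

End Path.
End PathwiseDavis.

(** * Conditional expectations on an ideal *)

Section ConditionalExpectation.
Context (R : realType) (V : rieszType R).
Hypothesis dc : dedekind_complete [set: V].
Context (S : set V).
Hypotheses (iS : order_ideal S) (S0 : S 0).
Implicit Types (x y z b d : V).

Lemma idS x y : S y -> rabs x <= rabs y -> S x. Proof. exact: iS.2. Qed.
Lemma idD x y : S x -> S y -> S (x + y). Proof. exact: iS.1. Qed.
Lemma id_le x y : S y -> 0 <= x -> x <= y -> S x. Proof. exact: idealS. Qed.
Lemma idZ (c : R) x : S x -> S (c *: x). Proof. exact: idealZ. Qed.
Lemma idN x : S x -> S (- x). Proof. by rewrite -scaleN1r; exact: idZ. Qed.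
Lemma idB x y : S x -> S y -> S (x - y). Proof. by move=> h /idN; exact: idD. Qed.
Lemma id_abs x : S x -> S (rabs x).
Proof. by move=> h; apply: (idS h); rewrite [X in X <= _]rabs_id // rabs_ge0. Qed.
Lemma id_pos x : S x -> S (pos x).
Proof. by move=> /id_abs h; apply: (id_le h); [exact: pos_ge0|exact: pos_le_rabs]. Qed.
Lemma id_join x y : S x -> S y -> S (rjoin x y).
Proof.
move=> Sx Sy; rewrite -(subrK y (rjoin x y)) rjoinDr subrr.
by apply: idD => //; apply: id_pos; exact: idB.
Qed.
Lemma id_rhypot x y : S x -> S y -> S (rhypot x y).
Proof.
move=> /id_abs Sx /id_abs Sy.
exact: (id_le (idD Sx Sy)) (rhypot_ge0 dc x y) (rhypot_leD dc x y).
Qed.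
Lemma id_sum (J : Type) (r : seq J) (F : J -> V) :
  (forall i, S (F i)) -> S (\sum_(i <- r) F i).
Proof. by move=> h; elim/big_ind : _ => // x y; exact: idD. Qed.
Lemma id_bproj b y : 0 <= y -> S y -> S (bproj b y).
Proof.
by move=> y0 Sy; apply: (id_le Sy); [exact: bproj_ge0|exact: bproj_lel].
Qed.
Lemma id_sbproj b y : S y -> S (sbproj b y).
Proof.
by move=> Sy; apply: idB; apply: id_bproj; rewrite ?pos_ge0 //; apply: id_pos => //; exact: idN.
Qed.

Section OneOperator.
Context (T : V -> V).
Hypotheses (hT : conditional_expectation S T) (sT : strictly_positive S T).

Lemma ce_in x : S x -> S (T x). Proof. by case: hT => -[h _ _ _] _; exact: h. Qed.
Lemma ce_ge0 x : S x -> 0 <= x -> 0 <= T x.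
Proof. by case: hT => -[_ _ h _] _; exact: h. Qed.
Lemma ce_idem x : S x -> T (T x) = T x. Proof. by case: hT => -[_ _ _ h] _; exact: h. Qed.
Lemma ceD x y : S x -> S y -> T (x + y) = T x + T y.
Proof. by case: hT => -[_ h _ _] _ Sx Sy; have := h 1 x y Sx Sy; rewrite !scale1r. Qed.
Lemma ce0 : T 0 = 0.
Proof. by apply: (@addrI _ (T 0)); rewrite -ceD // !addr0. Qed.
Lemma ceZ c x : S x -> T (c *: x) = c *: T x.
Proof. by case: hT => -[_ h _ _] _ Sx; have := h c x 0 Sx S0; rewrite ce0 !addr0. Qed.
Lemma ceN x : S x -> T (- x) = - T x.
Proof. by move=> Sx; rewrite -scaleN1r ceZ // scaleN1r. Qed.
Lemma ceB x y : S x -> S y -> T (x - y) = T x - T y.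
Proof. by move=> Sx Sy; rewrite ceD ?ceN //; exact: idN. Qed.
Lemma ce_le x y : S x -> S y -> x <= y -> T x <= T y.
Proof.
move=> Sx Sy xy; rewrite -rsubr_ge0 -ceB //; apply: ce_ge0; first exact: idB.
by rewrite rsubr_ge0.
Qed.
Lemma ce_sum (J : Type) (r : seq J) (F : J -> V) :
  (forall i, S (F i)) -> T (\sum_(i <- r) F i) = \sum_(i <- r) T (F i).
Proof.
move=> h; elim: r => [|i r ih]; first by rewrite !big_nil ce0.
by rewrite !big_cons ceD ?ih //; exact: id_sum.
Qed.

(** Order continuity in terms of suprema.  Infima relative to [S] and to the
    whole space agree because [S] is an ideal. *)
Lemma ce_sup_directed (D : set V) s : D `<=` S -> up_directed D -> S s ->
  is_sup setT D s -> is_sup setT (T @` D) (T s).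
Proof.
move=> DS [[x0 Dx0] dir] Ss [_ us ls].
have [_ [oc _ _ _]] := (hT.1, hT.2).
have [] : is_inf S (T @` [set s - x | x in D]) 0.
  apply: oc.
  - by move=> _ [x Dx <-]; apply: idB => //; exact: DS.
  - split; first by exists (s - x0); exists x0.
    move=> _ _ [x Dx <-] [y Dy <-]; have [z [Dz xz yz]] := dir _ _ Dx Dy.
    by exists (s - z); split; [exists z| |]; rewrite ?rleD2l ?rleN2.
  split=> // [_ [x Dx <-]|y _ hy]; first by rewrite rsubr_ge0 us.
  rewrite -(rleD2l s) addr0 -rleBrDr; apply: ls => // x Dx.
  by rewrite rleBrDr addrC -rleBrDr; apply: hy; exists x.
move=> _ lb gl; split=> // [_ [x Dx <-]|g _ ug].
  by apply: ce_le => //; [exact: DS|exact: us].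
have h x : D x -> T s - g <= T (s - x).
  move=> Dx; rewrite ceB //; last exact: DS.
  by rewrite rleD2l rleN2; apply: ug; exists x.
have p x : D x -> pos (T s - g) <= T (s - x).
  move=> Dx; rewrite pos_le h //= ce_ge0 //; last by rewrite rsubr_ge0 us.
  by apply: idB => //; exact: DS.
have : pos (T s - g) <= 0.
  apply: gl; last by move=> _ [_ [x Dx <-] <-]; exact: p.
  have S1 : S (T (s - x0)) by apply: ce_in; apply: idB => //; exact: DS.
  exact: id_le S1 (pos_ge0 _) (p x0 Dx0).
by rewrite pos_le lexx andbT rleBlDr add0r.
Qed.

Lemma ce_sup (f : nat -> V) s : (forall n, f n <= f n.+1) -> (forall n, S (f n)) ->
  S s -> is_sup setT (range f) s -> is_sup setT (range (T \o f)) (T s).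
Proof.
move=> fi Sf Ss hs; have -> : range (T \o f) = T @` range f by rewrite image_comp.
apply: ce_sup_directed => //.
  by move=> _ [n _ <-].
split; first by exists (f 0%N); exists 0%N.
move=> _ _ [n _ <-] [m _ <-]; exists (f (maxn n m)); split; first by exists (maxn n m).
  by have /andP[] := is_sup_incr fi hs (leq_maxl n m).
by have /andP[] := is_sup_incr fi hs (leq_maxr n m).
Qed.

(** Membership in the range of [T]. *)
Definition fixd x := S x /\ T x = x.

Lemma fixdP x : (T @` S) x <-> fixd x.
Proof.
split=> [[y Sy <-]|[Sx <-]]; last by exists x.
by split; [exact: ce_in|exact: ce_idem].
Qed.

Lemma fixd_ce x : S x -> fixd (T x).
Proof. by move=> Sx; split; [exact: ce_in|exact: ce_idem]. Qed.

Lemma fixd0 : fixd 0. Proof. by split=> //; exact: ce0. Qed.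
Lemma fixdD x y : fixd x -> fixd y -> fixd (x + y).
Proof. by move=> [Sx ex] [Sy ey]; split; [exact: idD|rewrite ceD // ex ey]. Qed.
Lemma fixdZ c x : fixd x -> fixd (c *: x).
Proof. by move=> [Sx ex]; split; [exact: idZ|rewrite ceZ // ex]. Qed.
Lemma fixdN x : fixd x -> fixd (- x).
Proof. by rewrite -scaleN1r; exact: fixdZ. Qed.
Lemma fixdB x y : fixd x -> fixd y -> fixd (x - y).
Proof. by move=> h /fixdN; exact: fixdD. Qed.

Lemma fixd_join x y : fixd x -> fixd y -> fixd (rjoin x y).
Proof.
have [_ [_ _ [_ _ hj _] _]] := (hT.1, hT.2).
by move=> /fixdP hx /fixdP hy; apply/fixdP; exact: hj.
Qed.

Lemma fixd_meet x y : fixd x -> fixd y -> fixd (rmeet x y).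
Proof.
by move=> hx hy; rewrite rmeetE; apply: fixdN; apply: fixd_join; exact: fixdN.
Qed.

Lemma fixd_abs x : fixd x -> fixd (rabs x).
Proof. by move=> hx; apply: fixd_join => //; exact: fixdN. Qed.

Lemma fixd_pos x : fixd x -> fixd (pos x).
Proof. by move=> hx; apply: fixd_join => //; exact: fixd0. Qed.

(** If [z] is a supremum of fixed elements then [T z >= z], while [T] kills
    the difference. *)
Lemma fixd_sup (D : set V) z : S z -> is_sup setT D z -> (forall x, D x -> fixd x) ->
  fixd z.
Proof.
move=> Sz [_ us ls] hD; split=> //.
have zT : z <= T z.
  apply: ls => // x Dx; have [Sx {1}<-] := hD x Dx.
  by apply: ce_le => //; exact: us.
have ST := ce_in Sz.
apply/eqP; rewrite -subr_eq0; apply/eqP; apply: sT; first exact: idB.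
by rewrite rabs_id ?rsubr_ge0 // ceB // ce_idem // subrr.
Qed.

Lemma fixd_rhypot x y : fixd x -> fixd y -> fixd (rhypot x y).
Proof.
move=> hx hy; apply: (fixd_sup _ (rhypotP dc x y)).
  by apply: id_rhypot; [exact: hx.1|exact: hy.1].
by move=> _ [t _ <-]; apply: fixdD; apply: fixdZ; exact: fixd_abs.
Qed.

Lemma fixd_bproj b y : 0 <= b -> 0 <= y -> fixd b -> fixd y -> fixd (bproj b y).
Proof.
move=> b0 y0 hb hy; apply: (fixd_sup _ (bprojP dc b y)).
  by apply: id_bproj => //; exact: hy.1.
by move=> _ [m _ <-]; apply: fixd_meet => //; exact: fixdZ.
Qed.

Lemma ce_bproj_le b y : 0 <= b -> 0 <= y -> fixd b -> S y ->
  T (bproj b y) <= bproj b (T y).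
Proof.
move=> b0 y0 hb Sy.
have Sm (m : nat) : S (rmeet y (m%:R *: b)).
  apply: (id_le Sy); last exact: (rmeet_lel _ _).1.
  by rewrite le_rmeet y0 rieszZ_ge0 ?ler0n.
have inc m : rmeet y (m%:R *: b) <= rmeet y (m.+1%:R *: b).
  by apply: rmeetS => //; rewrite rleZr // ler_nat.
have [_ _ ls] := ce_sup inc Sm (id_bproj b y0 Sy) (bprojP dc b y).
apply: ls => // _ [m _ <-] /=.
apply: le_trans (bproj_ge dc b (T y) m); rewrite le_rmeet; apply/andP; split.
  by apply: ce_le => //; exact: (rmeet_lel _ _).1.
have hmb := fixdZ m%:R hb.
by have := ce_le (Sm m) hmb.1 (rmeet_lel _ _).2; rewrite hmb.2.
Qed.

Context (e : V).
Hypothesis he : weak_order_unit S e.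

(** Projections onto bands generated by fixed elements commute with [T].  The
    complement of such a band is again generated by a fixed element, because
    [T e] is a weak order unit. *)
Lemma ce_bproj b y : 0 <= b -> 0 <= y -> fixd b -> S y ->
  T (bproj b y) = bproj b (T y).
Proof.
move=> b0 y0 hb Sy; have Ty0 := ce_ge0 Sy y0.
have Sp := id_bproj b y0 Sy.
apply/le_anti; rewrite ce_bproj_le //=.
pose y' := y - bproj b y.
have y'0 : 0 <= y' by rewrite rsubr_ge0 bproj_lel.
have Sy' : S y' by exact: idB.
have [Su u0 wu] : weak_order_unit S (T e) by case: hT => _ [_ h _ _]; exact: h.
have hu : fixd (T e) by apply: fixd_ce; case: he.
pose b' := T e - bproj b (T e).
have hb' : fixd b' by apply: fixdB => //; exact: fixd_bproj.
have b'0 : 0 <= b' by rewrite rsubr_ge0 bproj_lel.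
have b'b : rmeet b' b = 0 by exact: bproj_compl_disj.
have y'b : rmeet y' b = 0 by exact: bproj_compl_disj.
have y'p : bproj b' y' = y'.
  pose q := y' - bproj b' y'.
  have q0 : 0 <= q by rewrite rsubr_ge0 bproj_lel.
  have Sq : S q by apply: idB => //; exact: id_bproj.
  have qb' : rmeet q b' = 0 by exact: bproj_compl_disj.
  have qb : rmeet q b = 0.
    by apply: (disjS q0 b0 _ y'b); rewrite rleBlDr rleDl bproj_ge0.
  have : q = 0.
    apply: wu => //; rewrite rabs_id // rmeetC -(subrK (bproj b (T e)) (T e)).
    apply: disjD => //; [exact: bproj_ge0|by rewrite rmeetC|].
    by apply: bproj_disj => //; rewrite rmeetC.
  by move/eqP; rewrite subr_eq0 => /eqP <-.
have Ty'b : rmeet (T y') b = 0.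
  rewrite -y'p; apply: (disjS _ b0 (ce_bproj_le b'0 y'0 hb' Sy')).
    by apply: ce_ge0; [exact: id_bproj|exact: bproj_ge0].
  by apply: bproj_disj => //; exact: ce_ge0.
apply: bproj_le => // m.
have Ty : T y = T (bproj b y) + T y' by rewrite -ceD // addrC subrK.
have mb0 : 0 <= m%:R *: b by rewrite rieszZ_ge0 ?ler0n.
have Tp0 : 0 <= T (bproj b y) by apply: ce_ge0 => //; exact: bproj_ge0.
have Ty'0 : 0 <= T y' by exact: ce_ge0.
rewrite {1}Ty; apply: (le_trans (rmeetD_le Tp0 Ty'0 mb0)).
have -> : rmeet (T y') (m%:R *: b) = 0.
  by rewrite rmeetC; apply: disjZ; rewrite ?ler0n // rmeetC.
by rewrite addr0; exact: (rmeet_lel _ _).1.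
Qed.

Lemma ce_sbproj b d : 0 <= b -> fixd b -> S d -> T d = 0 -> T (sbproj b d) = 0.
Proof.
move=> b0 hb Sd Td0; have Sp := id_pos Sd; have Sn := id_pos (idN Sd).
have e1 : T (pos d) = T (pos (- d)).
  by apply/eqP; rewrite -subr_eq0 -ceB // posBN Td0.
rewrite ceB ?ce_bproj ?pos_ge0 ?e1 ?subrr //; by apply: id_bproj; rewrite ?pos_ge0.
Qed.

Lemma id_step_mul n x A d : S d -> S (step_mul n x A d).
Proof.
by move=> Sd; apply: idZ; apply: id_sum => j; apply: idB; exact: id_sbproj.
Qed.

Lemma ce_step_mul n x A d : fixd x -> fixd A -> S d -> T d = 0 ->
  T (step_mul n x A d) = 0.
Proof.
move=> hx hA Sd Td0; have Sj b : S (sbproj b d) by exact: id_sbproj.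
rewrite ceZ; last by apply: id_sum => j; exact: idB.
rewrite ce_sum; last by move=> j; exact: idB.
rewrite big1 ?scaler0 // => j _; rewrite ceB // !ce_sbproj ?subrr ?pos_ge0 //.
  by apply: fixd_pos; apply: fixdB; [exact: fixdN|exact: fixdZ].
by apply: fixd_pos; apply: fixdB; [|exact: fixdZ].
Qed.

End OneOperator.

Section Davis.
Context (F : nat -> V -> V) (e : V).
Hypotheses (hF : forall i, conditional_expectation S (F i))
  (sF : forall i, strictly_positive S (F i))
  (he : weak_order_unit S e)
  (FF : forall i j, (i < j)%N -> forall x, S x ->
     F i (F j x) = F i x /\ F j (F i x) = F i x).
Context (d : nat -> V).
Hypotheses (Sd : forall n, S (d n)) (Fd : forall n, F n (d n) = 0)
  (Fd' : forall n, F n.+1 (d n) = d n).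

Lemma fixd_mono i j x : (i <= j)%N -> fixd (F i) x -> fixd (F j) x.
Proof.
rewrite leq_eqVlt => /orP[/eqP->//|ij] [Sx ex]; split=> //.
by rewrite -{1}ex (FF ij Sx).2 ex.
Qed.

Lemma fixd_path n :
  [/\ fixd (F n) (psum d n), fixd (F n) (pmax d n) & fixd (F n) (psq d n)].
Proof.
elim: n => [|n [h1 h2 h3]].
  have h := fixd0 (hF 0).
  by rewrite /psum big_ord0 /=.
have mono x : fixd (F n) x -> fixd (F n.+1) x by apply: fixd_mono.
have hd : fixd (F n.+1) (d n) by split.
have hp : fixd (F n.+1) (psum d n.+1) by rewrite psumS; apply: fixdD => //; exact: mono.
split=> //=.
  by apply: fixd_join => //; [exact: mono|exact: fixd_abs].
by apply: fixd_rhypot => //; exact: mono.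
Qed.

(** The integrals in [davis_pathwise] have zero expectation since the
    integrands are predictable, and the approximation error tends to zero. *)
Theorem davis_inequality N : F 0%N (pmax d N) <= 10 *: F 0%N (psq d N).
Proof.
have Ssum : S (\sum_(n < N) rabs (d n)) by apply: id_sum => n; exact: id_abs.
have [Sx Sm Sq] : [/\ S (psum d N), S (pmax d N) & S (psq d N)].
  by have [[? _] [? _] [? _]] := fixd_path N.
rewrite -[X in _ <= X]add0r -rleBlDr.
apply: (archimedean_eps dc (y := F 0%N (\sum_(n < N) rabs (d n)))) => c c0.
pose K := Num.truncn (2 / c).
have hK : 2 * K.+1%:R^-1 <= c.
  by rewrite ler_pdivrMr ?ltr0n // mulrC -ler_pdivrMr // ltW // truncnS_gt.
have Ss n : S (step_mul K (psum d n) (pamp d n) (d n)) by exact: id_step_mul.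
have Sss : S (\sum_(n < N) step_mul K (psum d n) (pamp d n) (d n)) by exact: id_sum.
have F0s n : F 0%N (step_mul K (psum d n) (pamp d n) (d n)) = 0.
  have [h1 h2 h3] := fixd_path n.
  have Fn : F n (step_mul K (psum d n) (pamp d n) (d n)) = 0.
    have hA := fixd_rhypot (hF n) (@sF n) h3 h2.
    exact: (ce_step_mul (hF n) (@sF n) he K h1 hA (Sd n) (Fd n)).
  case: (posnP n) => [n0|n0]; first by move: Fn; rewrite n0.
  by rewrite -(FF n0 (Ss n)).1 Fn (ce0 (hF 0%N)).
have h := davis_pathwise dc d K N.
have Sr : S (10 *: psq d N + 2 *: (\sum_(n < N) step_mul K (psum d n) (pamp d n) (d n)) +
    (2 * K.+1%:R^-1) *: \sum_(n < N) rabs (d n)).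
  by do ![apply: idD]; exact: idZ.
have := ce_le (hF 0%N) Sm Sr h.
rewrite (ceD (hF 0%N)) ?(ceZ (hF 0%N)) //; [|by apply: idD; exact: idZ|exact: idZ].
rewrite (ceD (hF 0%N)) ?(ceZ (hF 0%N)) //; [|exact: idZ|exact: idZ].
rewrite (ce_sum (hF 0%N)) // big1 ?scaler0 ?addr0 //.
rewrite -rleBlDl => /le_trans; apply; apply: rleZr => //.
by apply: (ce_ge0 (hF 0%N)) => //; apply: rsum_ge0 => n _; exact: rabs_ge0.
Qed.

End Davis.
End ConditionalExpectation.

(** * Boundedness in universally complete spaces *)

Section LateralBound.
Context (R : realType) (V : rieszType R).
Hypotheses (dc : dedekind_complete [set: V]) (lat : laterally_complete V).
Context (e : V) (X : nat -> V).
Hypotheses (he : weak_order_unit [set: V] e)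
  (X0 : forall n, 0 <= X n).
Implicit Types (x y z b : V).

Lemma rmeet_pos_le0 z b : 0 <= b -> rmeet z b <= 0 -> rmeet (pos z) b = 0.
Proof.
move=> b0 zb; have hs : is_sup setT [set z; 0] (pos z).
  by split=> // [_ [->|->]|g _ ug]; rewrite ?le_pos ?pos_ge0 // pos_le !ug //; [right|left].
apply/le_anti/andP; split; last by rewrite le_rmeet b0 pos_ge0.
have [_ _ ls] := is_sup_meet b hs; rewrite rmeetC; apply: ls => //.
by move=> _ [y [->|->] <-]; rewrite ?(rmeetC b z) ?(rmeet_lel b 0).
Qed.

Let e0 : 0 <= e. Proof. by case: he. Qed.

Definition trunc_sup (k : nat) : V := supof (range (fun n => rmeet (X n) (k%:R *: e))).

Lemma trunc_supP k : is_sup setT (range (fun n => rmeet (X n) (k%:R *: e))) (trunc_sup k).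
Proof.
apply: dc_supof => //; first by exists (rmeet (X 0%N) (k%:R *: e)); exists 0%N.
by exists (k%:R *: e) => _ [n _ <-]; exact: (rmeet_lel _ _).2.
Qed.

Let s := trunc_sup.
Let b k : V := k%:R *: e - s k.
Let c k : V := \sum_(j < k) b j.
Let g k : V := b k - bproj (c k) (b k).
Let w k : V := bproj (g k) (s k).

Let s0 k : 0 <= s k.
Proof.
have [_ us _] := trunc_supP k; apply: le_trans (us _ (imageP _ (I : [set: nat] 0%N))).
by rewrite le_rmeet X0 rieszZ_ge0 ?ler0n.
Qed.

Let b0 k : 0 <= b k.
Proof.
rewrite rsubr_ge0; have [_ _ ls] := trunc_supP k; apply: ls => // _ [n _ <-].
exact: (rmeet_lel _ _).2.
Qed.

Let c0 k : 0 <= c k. Proof. by apply: rsum_ge0 => j _; exact: b0. Qed.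

Let g0 k : 0 <= g k. Proof. by rewrite rsubr_ge0 bproj_lel. Qed.
Let gb k : g k <= b k. Proof. by rewrite rleBlDr rleDl bproj_ge0. Qed.
Let w0 k : 0 <= w k. Proof. exact: bproj_ge0. Qed.

Let g_disj j k : (j < k)%N -> rmeet (g j) (g k) = 0.
Proof.
move=> jk; have bc : g j <= c k.
  apply: (le_trans (gb j)); rewrite /c (bigD1 (Ordinal jk)) //= rleDl.
  by apply: rsum_ge0 => i _; exact: b0.
by apply: (disjS _ _ bc) => //; rewrite rmeetC; exact: bproj_compl_disj.
Qed.

Let w_disj j k : (j < k)%N -> rmeet (w j) (w k) = 0.
Proof.
move=> jk; apply: bproj_disj => //; rewrite rmeetC; apply: bproj_disj => //.
by rewrite rmeetC; exact: g_disj.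
Qed.

(** On the band of [k e - s k] the sequence stays below [s k].  Disjointifying
    these bands and gluing the [s k] by lateral completeness bounds the
    sequence, up to a part [q] on which it is unbounded. *)
Lemma lateral_bound :
  (forall q, 0 <= q -> (forall k : nat, k%:R *: q <= s k) -> q = 0) ->
  exists B, forall n, X n <= B.
Proof.
move=> hq; have [B [_ uB _]] : exists B, is_sup setT (range w) B.
  apply: lat => [_ [k _ <-]//|_ _ [j _ <-] [k _ <-] jk].
  by have [h|h|h] := ltngtP j k; [exact: w_disj|rewrite rmeetC; exact: w_disj|case: jk; rewrite h].
exists B => n; pose z := pos (X n - B).
have z0 : 0 <= z by exact: pos_ge0.
have Xb k : rmeet (pos (X n - s k)) (b k) = 0.
  apply: rmeet_pos_le0; rewrite // /b -rmeetDr rleBlDr add0r.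
  by have [_ us _] := trunc_supP k; apply: us; exists n.
have zg k : rmeet z (g k) = 0.
  apply: (@disjS _ _ _ ((s k - w k) + pos (X n - s k))) => //.
    rewrite pos_le raddr_ge0 ?pos_ge0 ?rsubr_ge0 ?bproj_lel // andbT.
    apply: (@le_trans _ _ (X n - w k)).
      by rewrite rleD2l rleN2; apply: uB; exists k.
    have -> : X n - w k = (s k - w k) + (X n - s k) by rewrite [RHS]addrC addrA subrK.
    by rewrite rleD2l le_pos.
  apply: disjD; rewrite ?pos_ge0 ?rsubr_ge0 ?bproj_lel //.
    exact: bproj_compl_disj.
  by rewrite rmeetC; apply: (disjS _ _ (gb k)); rewrite ?pos_ge0 // rmeetC.
have zb k : rmeet z (b k) = 0.
  elim/ltn_ind: k => k ih; have zc : rmeet (c k) z = 0.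
    suff [] : 0 <= c k /\ rmeet (c k) z = 0 by [].
    apply: (big_ind (fun x => 0 <= x /\ rmeet x z = 0)) => [|x y [x0 hx] [y0 hy]|i _].
    - by rewrite rmeet_l.
    - by rewrite raddr_ge0 // disjD.
    by rewrite b0 rmeetC ih.
  have p0 : 0 <= bproj (c k) (b k) by exact: bproj_ge0.
  have pz : rmeet (bproj (c k) (b k)) z = 0 by exact: bproj_disj.
  have gz : rmeet (g k) z = 0 by rewrite rmeetC zg.
  by rewrite rmeetC -(subrK (bproj (c k) (b k)) (b k)); exact: disjD (g0 k) p0 z0 gz pz.
pose q := rmeet z e.
have q0 : 0 <= q by rewrite le_rmeet z0.
have : q = 0.
  apply: hq => // k; have kq0 : 0 <= k%:R *: q by rewrite rieszZ_ge0 ?ler0n.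
  have kqe : k%:R *: q <= b k + s k.
    by rewrite subrK rleZ ?ler0n // rmeet_lel.
  have : rmeet (b k + s k) (k%:R *: q) <= rmeet (b k) (k%:R *: q) + rmeet (s k) (k%:R *: q).
    exact: rmeetD_le.
  rewrite rmeetC rmeet_l // (_ : rmeet (b k) _ = 0) ?add0r.
    by move=> /le_trans; apply; exact: (rmeet_lel _ _).1.
  rewrite rmeetC; apply: disjZ; rewrite ?ler0n //.
  by apply: (disjS _ _ _ (zb k)); rewrite ?(rmeet_lel z e).
move=> qz; have : z = 0 by case: he => _ _; apply; rewrite // rabs_id.
by move=> zz; rewrite -[B]add0r -rleBlDr -zz le_pos.
Qed.

End LateralBound.

(** * The natural domain *)

Section NaturalDomainTheory.
Context (R : realType) (E U : rieszType R) (iota : E -> U) (T : E -> E).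
Hypotheses (hE : dedekind_complete [set: E]) (hU : universal_completion iota)
  (hT : conditional_expectation [set: E] T)
  (hTpos : strictly_positive [set: E] T).
Implicit Types (x y z : E) (f g h b : U) (D : set E).

Lemma dcU : dedekind_complete [set: U]. Proof. by case: hU => -[]. Qed.

Lemma order_idealT : order_ideal [set: E]. Proof. by split. Qed.
Let iT := order_idealT.

(** * The embedding *)

Lemma iotaZD (c : R) x y : iota (c *: x + y) = c *: iota x + iota y.
Proof. by case: hU => _ []. Qed.
Lemma iotaD x y : iota (x + y) = iota x + iota y.
Proof. by rewrite -{1}(scale1r x) iotaZD scale1r. Qed.
Lemma iota0 : iota 0 = 0.
Proof. by apply: (@addrI _ (iota 0)); rewrite -iotaD !addr0. Qed.
Lemma iotaZ (c : R) x : iota (c *: x) = c *: iota x.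
Proof. by rewrite -[c *: x]addr0 iotaZD iota0 addr0. Qed.
Lemma iotaN x : iota (- x) = - iota x.
Proof. by rewrite -scaleN1r iotaZ scaleN1r. Qed.
Lemma iotaB x y : iota (x - y) = iota x - iota y.
Proof. by rewrite iotaD iotaN. Qed.
Lemma iota_join x y : iota (rjoin x y) = rjoin (iota x) (iota y).
Proof. by case: hU => _ []. Qed.
Lemma iota_meet x y : iota (rmeet x y) = rmeet (iota x) (iota y).
Proof. by rewrite !rmeetE iotaN iota_join !iotaN. Qed.
Lemma iota_inj : injective iota. Proof. by case: hU => _ []. Qed.

Lemma iota_le x y : (iota x <= iota y) = (x <= y).
Proof.
apply/idP/idP => [/rjoin_r h|/rjoin_r <-]; last by rewrite iota_join rjoin_ler.
have : rjoin x y = y by apply: iota_inj; rewrite iota_join.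
by move <-; exact: (rjoin_ler _ _).1.
Qed.

Lemma iota_ge0 x : (0 <= iota x) = (0 <= x).
Proof. by rewrite -iota0 iota_le. Qed.

Lemma iota_dense f : 0 <= f -> (forall x, 0 <= x -> iota x <= f -> x = 0) -> f = 0.
Proof.
move=> f0 h; apply/eqP; rewrite -[_ == _]negbK; apply/negP => fn0.
have fp : 0 < f by rewrite lt_neqAle eq_sym fn0.
have [_ [_ _ _ /(_ _ fp)[x x0 xf]]] := hU.
by have xz := h x (ltW x0) xf; rewrite xz ltxx in x0.
Qed.

Lemma iota_dense_le f g : (forall x, 0 <= x -> iota x <= pos (f - g) -> x = 0) -> f <= g.
Proof.
move=> /(iota_dense (pos_ge0 _)) h.
by rewrite -[g]add0r -rleBlDr -h le_pos.
Qed.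

(** If [g] bounds the image of [D] and [z] in [E] lies below the positive part
    of [iota s - g], then [s - z] still bounds [D], so [z = 0]. *)
Lemma iota_sup D s : is_sup setT D s -> is_sup setT (iota @` D) (iota s).
Proof.
move=> [_ us ls]; split=> // [_ [x Dx <-]|g _ ug]; first by rewrite iota_le us.
apply: iota_dense_le => z z0 hz.
suff : s <= s - z by rewrite rleDl roppr_ge0 => hz0; apply/le_anti; rewrite z0 andbT.
apply: ls => // x Dx; rewrite rleBrDr -iota_le iotaD.
have xg : iota x <= rmeet (iota s) g.
  by rewrite le_rmeet iota_le us //= ug //; exists x.
apply: (le_trans (rleD xg hz)); rewrite -(rleD2r g) -[X in X <= _]addrA.
have -> : pos (iota s - g) + g = rjoin (iota s) g by rewrite /pos rjoinDr subrK add0r.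
by rewrite addrC rjoin_meet.
Qed.

(** If the supremum [s] of the elements of [E] below [f] were not [f], then a
    positive [z] in [E] below [f - s] could be added to all of them. *)
Lemma iota_sup_below f : 0 <= f ->
  is_sup setT (iota @` [set y | 0 <= y /\ iota y <= f]) f.
Proof.
move=> f0; set D := [set y | _].
have hs : is_sup setT (iota @` D) (supof (iota @` D)).
  apply: (dc_supof dcU); last by exists f => _ [y [_ yf] <-].
  by exists (iota 0); exists 0 => //; split; rewrite ?iota0.
have [_ us ls] := hs; have sf : supof (iota @` D) <= f by apply: ls => // _ [y [_ yf] <-].
suff fs : f <= supof (iota @` D) by move: hs; have -> : supof (iota @` D) = f by apply/le_anti; rewrite sf.
apply: iota_dense_le => z z0; rewrite pos_id ?rsubr_ge0 // => zf.
suff : supof (iota @` D) <= supof (iota @` D) - iota z.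
  by rewrite rleDl roppr_ge0 -iota0 iota_le => hz0; apply/le_anti; rewrite z0 andbT.
apply: ls => // _ [y [y0 yf] <-]; rewrite rleBrDr -iotaD; apply: (us).
exists (y + z) => //; split; first exact: raddr_ge0.
rewrite iotaD addrC -rleBrDr; apply: (le_trans zf).
by rewrite rleD2l rleN2; apply: us; exists y.
Qed.

Lemma iota_ideal f y : 0 <= f -> f <= iota y -> exists2 x, 0 <= x & iota x = f.
Proof.
move=> f0 fy; have hf := iota_sup_below f0; set D := [set y | _] in hf.
have D0 : D 0 by split; rewrite ?iota0.
have hs : is_sup setT D (supof D).
  apply: (dc_supof hE); first by exists 0.
  by exists y => x [_ xf]; rewrite -iota_le (le_trans xf).
exists (supof D); last exact: is_sup_uniq (iota_sup hs) hf.
by case: hs => _ us _; exact: us.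
Qed.

Lemma weak_unit_iota S e : S (iota e) -> weak_order_unit [set: E] e ->
  weak_order_unit S (iota e).
Proof.
move=> Se [_ e0 we]; split; rewrite ?iota_ge0 // => f _ hf.
apply: rabs_eq0; apply: iota_dense; first exact: rabs_ge0.
move=> x x0 xf; apply: we => //; rewrite rabs_id //; apply: iota_inj.
rewrite iota_meet iota0; apply: (disjS _ _ xf hf); by rewrite iota_ge0.
Qed.

(** * Elements with bounded expectation *)

(** [tbound f b]: the values of [T] on the positive elements of [E] below [f]
    are bounded by [b].  This describes the natural domain without a choice of
    an approximating net. *)
Definition tbound f b := forall y, 0 <= y -> iota y <= f -> iota (T y) <= b.

Lemma T_le x y : x <= y -> T x <= T y. Proof. by move=> xy; exact: (ce_le iT Logic.I hT). Qed.
Lemma T_ge0 x : 0 <= x -> 0 <= T x. Proof. exact: (ce_ge0 hT). Qed.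

Lemma tboundS f g b : f <= g -> tbound g b -> tbound f b.
Proof. by move=> fg h y y0 yf; apply: h => //; exact: le_trans fg. Qed.

Lemma tbound_iota x : tbound (iota x) (iota (T x)).
Proof. by move=> y y0; rewrite !iota_le; exact: T_le. Qed.

Lemma tboundD f g b c : 0 <= f -> 0 <= g -> tbound f b -> tbound g c ->
  tbound (f + g) (b + c).
Proof.
move=> f0 g0 hf hg y y0 yfg.
have [x x0 xe] : exists2 x, 0 <= x & iota x = rmeet (iota y) f.
  by apply: (iota_ideal (y := y)); rewrite ?rmeet_lel // le_rmeet iota_ge0 y0.
have xf : iota x <= f by rewrite xe rmeet_lel.
have zg : iota (y - x) <= g.
  rewrite iotaB xe rleBlDl rmeetDr le_rmeet rleDl g0.
  exact: yfg.
have z0 : 0 <= y - x by rewrite rsubr_ge0 -iota_le xe rmeet_lel.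
rewrite -(subrK x y) addrC (ceD hT) // iotaD.
by apply: rleD; [exact: hf|exact: hg].
Qed.

Lemma tbound_directed y b D : up_directed D -> is_sup setT D y ->
  (forall x, D x -> iota (T x) <= b) -> iota (T y) <= b.
Proof.
move=> dD sD h.
have := ce_sup_directed iT Logic.I hT (fun _ _ => Logic.I) dD Logic.I sD.
by move=> /iota_sup[_ _]; apply=> // _ [_ [x Dx <-] <-]; exact: h.
Qed.

Lemma iota_sup_inv D s : is_sup setT (iota @` D) (iota s) -> is_sup setT D s.
Proof.
move=> [_ us ls]; split=> // [x Dx|g _ ug]; first by rewrite -iota_le us //; exists x.
by rewrite -iota_le; apply: ls => // _ [x Dx <-]; rewrite iota_le ug.
Qed.

(** An element [y] of [E] below the supremum of [D] is itself the supremum of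
    the [y /\ x] with [x] in [D]. *)
Lemma tbound_approx D f b : approximates iota T D f ->
  ubound ((iota \o T) @` D) b -> tbound f b.
Proof.
move=> [[[x0 Dx0] dir] D0 sD _] ub y y0 yf.
apply: (@tbound_directed y b [set rmeet y x | x in D]).
- split; first by exists (rmeet y x0); exists x0.
  move=> _ _ [x Dx <-] [z Dz <-]; have [t [Dt xt zt]] := dir _ _ Dx Dz.
  by exists (rmeet y t); split; [exists t|exact: rmeetS|exact: rmeetS].
- apply: iota_sup_inv; have := is_sup_meet (iota y) sD; rewrite (rmeet_l yf).
  by rewrite !image_comp; congr is_sup; apply: eq_imagel => x _; rewrite /= iota_meet.
move=> _ [x Dx <-]; apply: (@le_trans _ _ (iota (T x))); last by apply: ub; exists x.
by rewrite iota_le T_le // rmeet_lel.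
Qed.

Lemma approx_below f b : 0 <= f -> tbound f b ->
  approximates iota T [set y | 0 <= y /\ iota y <= f] f.
Proof.
move=> f0 h; split.
- split; first by exists 0; split; rewrite ?iota0.
  move=> x y [x0 xf] [y0 yf]; exists (rjoin x y); rewrite !rjoin_ler; split=> //.
  by split; [rewrite (le_trans x0) // rjoin_ler|rewrite iota_join rjoin_le xf].
- by move=> x [].
- exact: iota_sup_below.
by exists b => _ [y [y0 yf] <-]; exact: h.
Qed.

Lemma natural_domP f : natural_dom iota T f <-> 0 <= f /\ exists b, tbound f b.
Proof.
split=> [[f0 [D hD]]|[f0 [b hb]]]; split=> //.
  have [_ _ _ [b hb]] := hD.
  by exists b; exact: tbound_approx hD hb.
by exists [set y | 0 <= y /\ iota y <= f]; exact: approx_below hb.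
Qed.

(** * The ideal [L1] *)

Local Notation L := (L1 iota T).

Lemma dom_L1 f : natural_dom iota T f -> L f.
Proof.
move=> hf; exists f, 0; split; rewrite ?subr0 //; apply/natural_domP; split=> //.
exists 0 => y y0; rewrite -iota0 iota_le => yz.
have -> : y = 0 by apply/le_anti; rewrite yz.
by rewrite (ce0 (S:=[set: E])) // iota0.
Qed.

Lemma L1_dom f : 0 <= f -> L f -> natural_dom iota T f.
Proof.
move=> f0 [g [h [/natural_domP[g0 [b hb]] /natural_domP[h0 _] fe]]].
apply/natural_domP; split=> //; exists b; apply: tboundS hb.
by rewrite fe rleBlDr rleDl.
Qed.

Lemma L1P f : 0 <= f -> L f <-> exists b, tbound f b.
Proof.
move=> f0; split=> [/(L1_dom f0)/natural_domP[]//|h].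
by apply: dom_L1; apply/natural_domP.
Qed.

Lemma domD f g : natural_dom iota T f -> natural_dom iota T g ->
  natural_dom iota T (f + g).
Proof.
move=> /natural_domP[f0 [b hb]] /natural_domP[g0 [c hc]].
apply/natural_domP; split; first exact: raddr_ge0.
by exists (b + c); exact: tboundD.
Qed.

Lemma L1_0 : L 0.
Proof. by rewrite -iota0; apply/L1P; rewrite ?iota0 //; exists (iota (T 0)); rewrite -iota0; exact: tbound_iota. Qed.

Lemma L1_ideal : order_ideal L.
Proof.
split=> [_ _ [g [h [hg hh ->]]] [g' [h' [hg' hh' ->]]]|x f [g [h [hg hh fe]]] xf].
  by exists (g + g'), (h + h'); rewrite opprD addrACA; split=> //; exact: domD.
have /natural_domP[gh0 [b hb]] := domD hg hh.
have fgh : rabs f <= g + h.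
  have /natural_domP[g0 _] := hg; have /natural_domP[h0 _] := hh.
  rewrite fe; apply: (le_trans (rabsD_le _ _)); rewrite rabsN !rabs_id //.
have dx (z : U) : 0 <= z -> z <= rabs x -> natural_dom iota T z.
  move=> z0 zx; apply/natural_domP; split=> //; exists b; apply: tboundS hb.
  exact: le_trans zx (le_trans xf fgh).
exists (pos x), (pos (- x)); rewrite posBN; split=> //; apply: dx; rewrite ?pos_ge0 //.
  exact: pos_le_rabs.
by rewrite -rabsN pos_le_rabs.
Qed.

Lemma L1_iota x : 0 <= x -> L (iota x).
Proof. by move=> x0; apply/L1P; rewrite ?iota_ge0 //; exists (iota (T x)); exact: tbound_iota. Qed.

(** * The extension of [T] *)

Lemma ext_exists f : 0 <= f -> L f -> is_extension iota T f (extension iota T f).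
Proof.
move=> f0 Lf; have /natural_domP[_ [b hb]] := L1_dom f0 Lf.
have hD := approx_below f0 hb; set D := [set y | _] in hD.
have T00 : T 0 = 0 by exact: (ce0 (S:=[set: E])).
have h0 : approximates iota T [set 0] 0.
  split; first by split; [exists 0|move=> x y -> ->; exists 0].
  - by move=> x ->.
  - by rewrite -[X in is_sup _ _ X]iota0 image_set1; split=> // [_ -> //|y _]; exact.
  by exists 0 => _ [y -> <-]; rewrite /= T00 iota0.
have [[[x0 Dx0] _] _ _ _] := hD.
pose s := supof ((iota \o T) @` D).
have hs : is_sup setT ((iota \o T) @` D) s.
  apply: (dc_supof dcU); first by exists ((iota \o T) x0); exists x0.
  by exists b => _ [y [y0 yf] <-]; exact: hb.
apply: (xgetPex 0); exists (s - 0).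
exists D, [set 0], f, 0, s, 0; split=> //; first by rewrite subr0.
split=> //; rewrite image_set1 /= T00 iota0; split=> // [_ -> //|y _]; exact.
Qed.

(** The next two bounds hold for every representation of [f] as a difference,
    whichever one the definition of the extension selects. *)
Lemma ext_ge f x : 0 <= f -> L f -> 0 <= x -> iota x <= f ->
  iota (T x) <= extension iota T f.
Proof.
move=> f0 Lf x0 xf; have [Dg [Dh [g [h [Tg [Th [[g0 h0] [hg hh] fe [sg sh] ->]]]]]]] := ext_exists f0 Lf.
rewrite rleBrDr addrC -rleBrDr; have [_ _ lh] := sh; apply: lh => // _ [y Dy <-] /=.
have [_ Dh0 [_ uh _] _] := hh; have [_ ug _] := sg.
rewrite rleBrDr -iotaD -(ceD hT) //.
have hb : tbound g Tg by exact: tbound_approx hg ug.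
apply: hb; first by rewrite raddr_ge0 // Dh0.
rewrite iotaD -[g](subrK h) -fe addrC; apply: rleD => //.
by apply: uh; exists y.
Qed.

Lemma ext_le f b : 0 <= f -> L f -> tbound f b -> extension iota T f <= b.
Proof.
move=> f0 Lf fb; have [Dg [Dh [g [h [Tg [Th [[g0 h0] [hg hh] fe [sg sh] ->]]]]]]] := ext_exists f0 Lf.
rewrite rleBlDr; have [_ _ lg] := sg; apply: lg => // _ [y Dy <-] /=.
have [_ Dg0 [_ ug _] _] := hg; have [_ uh _] := sh.
have hb : tbound h Th by exact: tbound_approx hh uh.
apply: (tboundD f0 h0 fb hb); first exact: Dg0.
by rewrite fe subrK; apply: ug; exists y.
Qed.

Lemma ext0 : extension iota T 0 = 0.
Proof.
have L0 := L1_0; have T00 : T 0 = 0 by exact: (ce0 (S:=[set: E])).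
apply/le_anti/andP; split.
  apply: ext_le => // y y0; rewrite -{1}iota0 iota_le => yz.
  have -> : y = 0 by apply/le_anti; rewrite yz.
  by rewrite T00 iota0.
by have := ext_ge (lexx 0) L0 (lexx 0); rewrite iota0 T00 iota0; apply.
Qed.

Lemma T_eq0 x : 0 <= x -> T x <= 0 -> x = 0.
Proof.
by move=> x0 Tx; apply: hTpos => //; rewrite rabs_id //; apply/le_anti; rewrite Tx T_ge0.
Qed.

(** If [T0 |f| = 0] then the extension of [T] vanishes at [|f|], so [T] vanishes
    at the elements of [E] below [|f|]. *)
Lemma strictly_positive_factor (T0 : U -> U) :
  (forall f, L f -> extension iota T (T0 f) = extension iota T f) ->
  strictly_positive L T0.
Proof.
move=> hc f Lf Tf0; have La := id_abs L1_ideal Lf.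
have e0 : extension iota T (rabs f) = 0 by rewrite -hc // Tf0 ext0.
apply: rabs_eq0; apply: iota_dense; first exact: rabs_ge0.
move=> x x0 xf; apply: T_eq0 => //; rewrite -iota_le iota0 -e0.
by apply: ext_ge => //; exact: rabs_ge0.
Qed.

(** Order continuity of [T] along the elements [y /\ X n], which lie in [E]. *)
Lemma tbound_incr (X : nat -> U) y b : (forall n, X n <= X n.+1) ->
  (forall n, 0 <= X n) -> (forall n, tbound (X n) b) -> 0 <= y ->
  is_sup setT (range (fun n => rmeet (iota y) (X n))) (iota y) -> iota (T y) <= b.
Proof.
move=> Xi X0 Xb y0 hs.
have ex n : {x | 0 <= x /\ iota x = rmeet (iota y) (X n)}.
  apply: cid; have [] := @iota_ideal (rmeet (iota y) (X n)) y.
  - by rewrite le_rmeet iota_ge0 y0 X0.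
  - exact: (rmeet_lel _ _).1.
  by move=> x x0 xe; exists x.
pose Y n := projT1 (ex n).
have Y0 n : 0 <= Y n := (projT2 (ex n)).1.
have Ye n : iota (Y n) = rmeet (iota y) (X n) := (projT2 (ex n)).2.
have Yi n m : (n <= m)%N -> Y n <= Y m.
  elim: m => [|m ih]; first by rewrite leqn0 => /eqP ->.
  rewrite leq_eqVlt => /orP[/eqP->//|/ih h]; apply: (le_trans h).
  by rewrite -iota_le !Ye rmeetS.
apply: (@tbound_directed y b (range Y)).
- split; first by exists (Y 0%N); exists 0%N.
  move=> _ _ [n _ <-] [m _ <-]; exists (Y (maxn n m)).
  by split; [exists (maxn n m)|apply: Yi; exact: leq_maxl|apply: Yi; exact: leq_maxr].
- apply: iota_sup_inv; rewrite image_comp.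
  by rewrite (_ : iota \o Y = fun n => rmeet (iota y) (X n)) //; apply/funext => n /=.
by move=> _ [n _ <-]; apply: (Xb n); rewrite // Ye; exact: (rmeet_lel _ _).2.
Qed.

(** A positive [y] in [E] below the part where the sequence is unbounded would
    satisfy [k (T y) <= b] for all [k], hence [T y = 0] and [y = 0]; so
    [lateral_bound] applies. *)
Theorem levi e (T0 : U -> U) (X : nat -> U) (B : U) :
  weak_order_unit [set: E] e ->
  conditional_expectation L T0 ->
  (forall f, L f -> extension iota T (T0 f) = extension iota T f) ->
  (forall n, X n <= X n.+1) -> (forall n, 0 <= X n) -> (forall n, L (X n)) ->
  L B -> (forall n, T0 (X n) <= B) ->
  exists2 s, L s & is_sup setT (range X) s.
Proof.
move=> he hT0 hc Xi X0 LX LB XB.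
have T0X n : 0 <= T0 (X n) by exact: (ce_ge0 hT0).
have B0 : 0 <= B := le_trans (T0X 0%N) (XB 0%N).
have [b hb] : exists b, tbound B b by apply/L1P.
have Xb n : tbound (X n) b.
  move=> y y0 yX; apply: (le_trans (ext_ge (X0 n) (LX n) y0 yX)).
  rewrite -hc //; apply: ext_le => //; first exact: (ce_in hT0).
  exact: tboundS (XB n) hb.
have [[dc lat] _] := hU.
have hie : weak_order_unit [set: U] (iota e) by exact: weak_unit_iota.
have [Bd hBd] : exists Bd, forall n, X n <= Bd.
  apply: (lateral_bound dc lat hie X0) => q q0 hq.
  apply: iota_dense => // y y0 yq; apply: T_eq0 => //.
  rewrite -iota_le iota0; apply: (archimedean dc (y := b)) => k.
  have ky0 : 0 <= k%:R *: y by rewrite rieszZ_ge0 ?ler0n.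
  have ke0 : 0 <= k%:R *: iota e by rewrite rieszZ_ge0 ?ler0n //; case: hie.
  rewrite -iotaZ -(ceZ (S := [set: E])) //.
  apply: (@tbound_incr (fun n => rmeet (X n) (k%:R *: iota e))) => //.
  - by move=> n; exact: rmeetS.
  - by move=> n; rewrite le_rmeet X0.
  - by move=> n; apply: tboundS (Xb n); exact: (rmeet_lel _ _).1.
  have := is_sup_meet (iota (k%:R *: y)) (trunc_supP dc (iota e) X k).
  rewrite (rmeet_l (_ : iota (k%:R *: y) <= _)) ?image_comp //.
  by apply: le_trans (hq k); rewrite iotaZ rleZ ?ler0n.
have hs : is_sup setT (range X) (supof (range X)).
  apply: (dc_supof dc); first by exists (X 0%N); exists 0%N.
  by exists Bd => _ [n _ <-].
exists (supof (range X)) => //.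
have s0 : 0 <= supof (range X).
  by apply: le_trans (X0 0%N) _; case: hs => _ us _; apply: us; exists 0%N.
apply/L1P => //; exists b => y y0 ys; apply: (tbound_incr Xi X0 Xb y0).
by have := is_sup_meet (iota y) hs; rewrite (rmeet_l ys) image_comp.
Qed.

End NaturalDomainTheory.

(** * Powers *)

Section RealPowers.
Context (R : realType) (p : R).
Hypothesis hp : 1 <= p <= 2.
Implicit Types (t r eps a : R).

Lemma continuous_abs_powR : continuous (fun t : R => `|t| `^ p).
Proof.
have /andP[p1 _] := hp; have p0 : 0 < p by exact: lt_le_trans ltr01 p1.
move=> x; have [->|x0] := eqVneq x 0.
  apply/cvgrPdist_lt => eps eps0; rewrite /= normr0 powR0 ?gt_eqF //.
  apply/nbhs_ballP; exists (Num.min 1 eps); first by rewrite /= lt_min ltr01.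
  move=> t; rewrite /ball /= !sub0r !normrN (ger0_norm (powR_ge0 _ _)) => t1.
  move: t1; rewrite lt_min => /andP[t1 te]; apply: le_lt_trans te.
  have [->|tn0] := eqVneq `|t| 0; first by rewrite powR0 ?gt_eqF.
  by rewrite ge1r_powR // lt_neqAle eq_sym tn0 normr_ge0 ltW.
apply: (@continuous_comp _ _ _ (fun t : R => `|t|) (fun t => t `^ p)); first exact: norm_continuous.
apply: differentiable_continuous; apply/derivable1_diffP; apply: derivable_powR.
by rewrite in_itv /= andbT normr_gt0.
Qed.

Lemma powR_le_quartic t d : 0 < d -> `|t| `^ p <= 1 + (4 * d)^-1 + d * t ^+ 4.
Proof.
move=> d0; have /andP[p1 p2] := hp.
have h1 : `|t| `^ p <= 1 + t ^+ 2.
  have [t1|t1] := leP `|t| 1.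
    have p0 : 0 <= p by exact: le_trans ler01 p1.
    have := @ge0_ler_powR R p p0 `|t| 1; rewrite !nnegrE ler01 normr_ge0 powR1.
    move=> /(_ isT isT t1).
    by have := sqr_ge0 t; lra.
  have : `|t| `^ p <= `|t| `^ 2%:R by rewrite ler_powR // ltW.
  by rewrite powR_mulrn // real_normK ?num_real // => /le_trans; apply; rewrite lerDr.
apply: (le_trans h1); rewrite -addrA lerD2l -subr_ge0.
have -> : (4 * d)^-1 + d * t ^+ 4 - t ^+ 2 = d * (t ^+ 2 - (2 * d)^-1) ^+ 2.
  by field; rewrite gt_eqF.
by rewrite mulr_ge0 ?sqr_ge0 // ltW.
Qed.

(** Deviation of the power from its value at [t0]: small near [t0], linear at
    finite distance, and negligible against a faster function at infinity. *)
Lemma powR_dist t0 d : 0 < d -> exists2 C, 0 <= C & forall t,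
  `| `|t| `^ p - `|t0| `^ p | <= d + C * `|t - t0| + d * t ^+ 4.
Proof.
move=> d0; have /cvgrPdist_lt/(_ d d0) := @continuous_abs_powR t0.
move=> /nbhs_ballP[e /= e0 he].
pose K := 1 + (4 * d)^-1 + `|t0| `^ p.
have K0 : 0 <= K by rewrite !addr_ge0 ?powR_ge0 ?ler01 // invr_ge0 mulr_ge0 // ltW.
exists (K / e) => [|t]; first by rewrite divr_ge0 // ltW.
have q0 : 0 <= d * t ^+ 4 by rewrite mulr_ge0 ?(ltW d0) // exprn_even_ge0.
have l0 : 0 <= K / e * `|t - t0| by rewrite !mulr_ge0 // invr_ge0 ltW.
have [near_|far] := ltP `|t - t0| e.
  have := he t; rewrite /ball /= distrC => /(_ near_) h.
  rewrite distrC; lra.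
have Kl : K <= K / e * `|t - t0|.
  by rewrite mulrAC -mulrA -{1}(mulr1 K) ler_wpM2l // ler_pdivlMr // mul1r.
apply: le_trans (ler_normB _ _) _; rewrite !(ger0_norm (powR_ge0 _ _)).
have := powR_le_quartic t d0; rewrite -/K => h.
have eK : K = 1 + (4 * d)^-1 + `|t0| `^ p by [].
clearbody K; lra.
Qed.

(** Affine minorants of [t ^ p] from the tangents [2 r t - r ^ 2] of [t ^ 2].
    The factor 2 on the right makes room for [t > 1], where [t ^ p] may be
    smaller than [t ^ 2]. *)
Lemma powR_tangent t r eps a : 0 <= t -> 0 <= r <= 1 -> 0 < eps -> 0 < a ->
  2 * r * (t / a) - eps * r ^+ 2 <= 2 * (eps * eps^-1 `^ p) * ((a `^ p)^-1 * t `^ p).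
Proof.
move=> t0 /andP[r0 r1] eps0 a0; have /andP[p1 p2] := hp.
have p0 : 0 <= p by exact: le_trans ler01 p1.
pose s := t / a / eps; have s0 : 0 <= s by rewrite !divr_ge0 // ltW.
have key : 2 * r * s - r ^+ 2 <= 2 * s `^ p.
  have [s1|s1] := leP s 1; last first.
    have : s <= s `^ p by rewrite le1r_powR // ltW.
    have : 0 <= (1 - r) * (2 * s - 1 - r) by rewrite mulr_ge0; lra.
    by nra.
  have : s ^+ 2 <= s `^ p.
    have [->|sn0] := eqVneq s 0; first by rewrite expr0n powR_ge0.
    have sp : 0 < s by rewrite lt_neqAle eq_sym sn0.
    by rewrite -powR_mulrn // ger_powR // sp.
  by have := sqr_ge0 (s - r); have := sqr_ge0 s; nra.
have -> : (a `^ p)^-1 * t `^ p = (t / a) `^ p.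
  rewrite powRM ?invr_ge0 ?(ltW a0) // mulrC; congr (_ * _).
  by rewrite -[in RHS]powR_inv1 ?(ltW a0) // powRAC powR_inv1 ?powR_ge0.
have -> : 2 * (eps * eps^-1 `^ p) * (t / a) `^ p = eps * (2 * s `^ p).
  by rewrite /s [in RHS]powRM ?divr_ge0 ?invr_ge0 ?(ltW a0) ?(ltW eps0) //; ring.
have -> : 2 * r * (t / a) - eps * r ^+ 2 = eps * (2 * r * s - r ^+ 2).
  by rewrite /s; field; rewrite !gt_eqF.
by rewrite ler_wpM2l // ltW.
Qed.

End RealPowers.

Section FunctionalCalculus.
Context (R : realType) (V : rieszType R).
Hypothesis dc : dedekind_complete [set: V].
Context (p : R).
Hypothesis hp : 1 <= p <= 2.
Implicit Types (e f g : V) (phi psi : R -> R).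

Section Calculus.
Context (e f : V) (Phi : (R -> R) -> V).
Hypothesis hPhi : functional_calculus e f Phi.

Lemma fc_lin (c : R) phi psi : continuous phi -> continuous psi ->
  Phi (fun t => c * phi t + psi t) = c *: Phi phi + Phi psi.
Proof. by case: hPhi => h _ _ _; exact: h. Qed.

Lemma fc_le phi psi : continuous phi -> continuous psi ->
  (forall t, phi t <= psi t) -> Phi phi <= Phi psi.
Proof.
case: hPhi => _ h _ _ cphi cpsi hle.
have : Phi (fun t => Num.max (phi t) (psi t)) = rjoin (Phi phi) (Phi psi) by exact: h.
have -> : (fun t => Num.max (phi t) (psi t)) = psi by apply/funext => t; exact: max_r.
by move=> ->; exact: (rjoin_ler _ _).1.
Qed.

Lemma fc_affine (a b : R) : Phi (fun t => a * t + b) = a *: f + b *: e.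
Proof.
case: hPhi => lin _ P1 Pid.
have c1 : continuous (fun _ : R => 1 : R) by move=> ?; exact: cvg_cst.
have cid : continuous (fun t : R => t) by move=> ?.
have c0 : continuous (fun _ : R => 0 : R) by move=> ?; exact: cvg_cst.
have P0 : Phi (fun=> 0) = 0.
  have := lin 1 _ _ c0 c0; rewrite scale1r.
  have -> : (fun _ : R => 1 * 0 + 0 : R) = fun=> 0 by apply/funext => t; rewrite mulr0 addr0.
  by move=> /(congr1 (fun z => z - Phi (fun=> 0))); rewrite subrr addrK.
have Pb : Phi (fun=> b) = b *: e.
  have := lin b _ _ c1 c0; rewrite P1 P0 [RHS]addr0 => <-.
  by congr Phi; apply/funext => t; rewrite mulr1 addr0.
have cb : continuous (fun _ : R => b) by move=> ?; exact: cvg_cst.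
by rewrite -Pb -Pid -lin.
Qed.

Lemma fc_dist (a : R) : Phi (fun t => `|t - a|) = rabs (f - a *: e).
Proof.
case: hPhi => lin hmax _ _.
have ca (b c : R) : continuous (fun t : R => b * t + c).
  by move=> t; apply: cvgD; [apply: cvgM; [exact: cvg_cst|exact: cvg_id]|exact: cvg_cst].
have := hmax _ _ (ca 1 (- a)) (ca (-1) a).
rewrite !fc_affine !scaleNr !scale1r.
rewrite /rabs opprB addrC [a *: e - f]addrC => <-.
by congr Phi; apply/funext => t; rewrite mul1r mulN1r [- t + a]addrC -maxrN opprB.
Qed.

End Calculus.

(** A state maps [Phi (|t| ^ p)] to the power of the state of [f], relative to
    that of [e], whatever the calculus [Phi].  The membership of [Phi (t ^ 4)]
    in the ideal controls the power at infinity, where [Phi] need not be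
    determined by its values on piecewise affine functions. *)
Lemma state_power e f Phi u (w : V -> R) : 0 <= e -> functional_calculus e f Phi ->
  state u w -> pideal u e -> pideal u f ->
  pideal u (Phi (fun t => `|t| `^ p)) -> pideal u (Phi (fun t => t ^+ 4)) ->
  w (Phi (fun t => `|t| `^ p)) = if w e == 0 then 0 else w e * `|w f / w e| `^ p.
Proof.
move=> e0 hPhi sw Ie If Ig Iq.
have cg := continuous_abs_powR hp.
have cq : continuous (fun t : R => t ^+ 4) by move=> t; exact: exprn_continuous.
have ca (b c : R) : continuous (fun t : R => b * t + c).
  by move=> t; apply: cvgD; [apply: cvgM; [exact: cvg_cst|exact: cvg_id]|exact: cvg_cst].
have cd (a : R) : continuous (fun t : R => `|t - a|).
  move=> t; apply: (@continuous_comp _ _ _ (fun t : R => t - a) (fun t => `|t|)); last exact: norm_continuous.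
  by apply: cvgB; [exact: cvg_id|exact: cvg_cst].
have we0 : 0 <= w e by exact: (state_ge0 sw).
have wq0 : 0 <= w (Phi (fun t => t ^+ 4)).
  apply: (state_ge0 sw) => //; have := fc_affine hPhi 0 0; rewrite !scale0r addr0 => <-.
  by apply: (fc_le hPhi) => // t; rewrite mul0r addr0 exprn_even_ge0.
have wg0 : 0 <= w (Phi (fun t => `|t| `^ p)).
  apply: (state_ge0 sw) => //; have := fc_affine hPhi 0 0; rewrite !scale0r addr0 => <-.
  by apply: (fc_le hPhi) => // t; rewrite mul0r addr0 powR_ge0.
set q := w (Phi (fun t => t ^+ 4)) in wq0 *; set g := w _ in wg0 *.
have [we|we] := eqVneq (w e) 0.
  apply/le_anti; rewrite wg0 andbT; apply/ler_addgt0Pr => d d0; rewrite add0r.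
  pose d' := d / (q + 1); have q1 : 0 < q + 1 by rewrite ltr_wpDl.
  have d'0 : 0 < d' by rewrite divr_gt0.
  have h : Phi (fun t => `|t| `^ p) <= (1 + (4 * d')^-1) *: e + d' *: Phi (fun t => t ^+ 4).
    have := fc_lin hPhi d' cq (ca 0 (1 + (4 * d')^-1)).
    rewrite (fc_affine hPhi) scale0r add0r [RHS]addrC => <-.
    apply: (fc_le hPhi) => //; last first.
      by move=> t; rewrite mul0r add0r addrC; exact: powR_le_quartic.
    by move=> t; apply: cvgD; [apply: cvgM; [exact: cvg_cst|exact: cq]|exact: ca].
  have I1 : pideal u ((1 + (4 * d')^-1) *: e) by exact: pidealZ.
  have I2 : pideal u (d' *: Phi (fun t => t ^+ 4)) by exact: pidealZ.
  have := state_le sw Ig (pidealD I1 I2) h.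
  rewrite (stateD sw) // !(stateZ sw) // we mulr0 add0r => /le_trans; apply.
  rewrite -/q /d' mulrAC ler_pdivrMr // ler_wpM2l ?(ltW d0) // lerDl.
  exact: ler01.
pose t0 := w f / w e; have wep : 0 < w e by rewrite lt_neqAle eq_sym we.
suff : `|g - w e * `|t0| `^ p| <= 0.
  by rewrite normr_le0 subr_eq0 => /eqP.
apply/ler_addgt0Pr => d d0; rewrite add0r.
pose d' := d / (w e + q); have weq : 0 < w e + q by rewrite ltr_wpDr.
have d'0 : 0 < d' by rewrite divr_gt0.
have [C C0 hC] := powR_dist hp t0 d'0.
pose z := d' *: e + C *: rabs (f - t0 *: e) + d' *: Phi (fun t => t ^+ 4).
have Ifd : pideal u (f - t0 *: e) by apply: pidealB => //; exact: pidealZ.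
have Iz1 : pideal u (d' *: e) by exact: pidealZ.
have Iz2 : pideal u (C *: rabs (f - t0 *: e)) by apply: pidealZ; exact: pideal_abs.
have Iz3 : pideal u (d' *: Phi (fun t => t ^+ 4)) by exact: pidealZ.
have wz : w z = d.
  rewrite (stateD sw) ?(stateD sw) ?(stateZ sw) ?(state_abs sw) //; try exact: pidealD.
    rewrite (stateB sw) ?(stateZ sw) //; last exact: pidealZ.
    rewrite /t0 mulfVK // subrr normr0 mulr0 addr0 -mulrDr -/q /d'.
    by rewrite mulfVK // gt_eqF.
  exact: pideal_abs.
have Iz : pideal u z by rewrite /z; apply: pidealD => //; exact: pidealD.
pose psi t := d' + C * `|t - t0| + d' * t ^+ 4.
have cpsi : continuous psi.
  move=> t; apply: cvgD; last by apply: cvgM; [exact: cvg_cst|exact: cq].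
  by apply: cvgD; [exact: cvg_cst|apply: cvgM; [exact: cvg_cst|exact: cd]].
have Ppsi : Phi psi = z.
  have c1 : continuous (fun t : R => C * `|t - t0| + (0 * t + d')).
    by move=> t; apply: cvgD; [apply: cvgM; [exact: cvg_cst|exact: cd]|exact: ca].
  have -> : psi = (fun t => d' * t ^+ 4 + (C * `|t - t0| + (0 * t + d'))).
    by apply/funext => t; rewrite /psi; ring.
  rewrite (fc_lin hPhi _ cq c1) (fc_lin hPhi _ (cd t0) (ca 0 d')) (fc_affine hPhi) (fc_dist hPhi).
  by rewrite scale0r add0r addrC [X in X + _ = _]addrC.
have Ie' : pideal u (`|t0| `^ p *: e) by exact: pidealZ.
have up : Phi (fun t => `|t| `^ p) <= `|t0| `^ p *: e + z.
  have := fc_lin hPhi 1 cpsi (ca 0 (`|t0| `^ p)).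
  rewrite scale1r (fc_affine hPhi) scale0r add0r Ppsi [RHS]addrC => <-.
  apply: (fc_le hPhi) => //.
    by move=> t; apply: cvgD; [apply: cvgM; [exact: cvg_cst|exact: cpsi]|exact: ca].
  move=> t; have := hC t; rewrite ler_norml /psi => /andP[_ ?]; lra.
have down : `|t0| `^ p *: e <= Phi (fun t => `|t| `^ p) + z.
  have := fc_lin hPhi 1 cpsi cg; rewrite scale1r Ppsi [RHS]addrC => <-.
  have := fc_affine hPhi 0 (`|t0| `^ p); rewrite scale0r add0r => <-.
  apply: (fc_le hPhi) => //.
    by move=> t; apply: cvgD; [apply: cvgM; [exact: cvg_cst|exact: cpsi]|exact: cg].
  move=> t; have := hC t; rewrite ler_norml /psi => /andP[? _]; lra.
have := state_le sw Ig (pidealD Ie' Iz) up.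
rewrite (stateD sw Ie' Iz) (stateZ sw _ Ie) wz -/g => h1.
have := state_le sw Ie' (pidealD Ig Iz) down.
rewrite (stateD sw Ig Iz) (stateZ sw _ Ie) wz -/g => h2.
by rewrite ler_distl lerBlDr [w e * _]mulrC h1 h2.
Qed.

Lemma is_power_uniq e f g g' : 0 <= e -> is_power e p f g -> is_power e p f g' -> g = g'.
Proof.
move=> e0 [Phi hPhi ->] [Psi hPsi ->].
pose s := [:: e; f; Phi (fun t => `|t| `^ p); Phi (fun t => t ^+ 4);
           Psi (fun t => `|t| `^ p); Psi (fun t => t ^+ 4)].
pose u := \sum_(z <- s) rabs z.
have u0 : 0 <= u by apply: rsum_ge0 => z _; exact: rabs_ge0.
have Is z : z \in s -> pideal u z.
  move=> zs; exists 1; rewrite scale1r /u (big_rem z) //= rleDl.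
  by apply: rsum_ge0 => y _; exact: rabs_ge0.
have eqw w : state u w -> w (Phi (fun t => `|t| `^ p)) = w (Psi (fun t => `|t| `^ p)).
  move=> sw; rewrite (state_power e0 hPhi sw) ?(state_power e0 hPsi sw) //;
  by apply: Is; rewrite !inE eqxx ?orbT.
have I1 : pideal u (Phi (fun t => `|t| `^ p)) by apply: Is; rewrite !inE eqxx ?orbT.
have I2 : pideal u (Psi (fun t => `|t| `^ p)) by apply: Is; rewrite !inE eqxx ?orbT.
by apply/le_anti/andP; split; apply: (le_of_states dc u0) => // w sw; rewrite eqw.
Qed.

Lemma powerE e f g : 0 <= e -> is_power e p f g -> power e p f = g.
Proof.
move=> e0 hg; apply: is_power_uniq (hg) => //.
exact: (xgetPex 0 (ex_intro _ g hg)).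
Qed.

Lemma power_ge0 e f g : is_power e p f g -> 0 <= g.
Proof.
move=> [Phi hPhi ->]; have := fc_affine hPhi 0 0; rewrite !scale0r addr0 => <-.
apply: (fc_le hPhi); last by move=> t; rewrite mul0r addr0 powR_ge0.
  by move=> t; apply: cvgD; [apply: cvgM; [exact: cvg_cst|exact: cvg_id]|exact: cvg_cst].
exact: continuous_abs_powR.
Qed.

(** The only lower bounds on the power that enter the estimates. *)
Lemma power_tangent e f g (r eps a : R) : is_power e p f g -> 0 <= r <= 1 ->
  0 < eps -> 0 < a ->
  (2 * r) *: (a^-1 *: f) - (eps * r ^+ 2) *: e <=
  (2 * (eps * eps^-1 `^ p)) *: ((a `^ p)^-1 *: g).
Proof.
move=> [Phi hPhi ->] hr eps0 a0; have cg := continuous_abs_powR hp.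
have ca (b c : R) : continuous (fun t : R => b * t + c).
  by move=> t; apply: cvgD; [apply: cvgM; [exact: cvg_cst|exact: cvg_id]|exact: cvg_cst].
rewrite !scalerA -scaleNr -(fc_affine hPhi).
set c := _ * (a `^ p)^-1.
have := fc_lin hPhi c cg (ca 0 0); rewrite (fc_affine hPhi) !scale0r !addr0 => <-.
apply: (fc_le hPhi) => //.
  by move=> t; apply: cvgD; [apply: cvgM; [exact: cvg_cst|exact: cg]|exact: ca].
move=> t; rewrite mul0r !addr0.
have [t0|t0] := leP 0 t.
  have := powR_tangent hp t0 hr eps0 a0; rewrite ger0_norm // /c => h.
  by rewrite -[X in _ <= X]mulrA -mulrA [a^-1 * t]mulrC.
have /andP[r0 r1] := hr.
apply: (@le_trans _ _ 0); last first.
  by rewrite /c !mulr_ge0 ?powR_ge0 ?invr_ge0 ?powR_ge0 // ltW.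
have h1 : 2 * r / a * t <= 0 by rewrite mulr_ge0_le0 ?(ltW t0) // !mulr_ge0 ?invr_ge0 // ltW.
have h2 : 0 <= eps * r ^+ 2 by rewrite mulr_ge0 ?sqr_ge0 // ltW.
lra.
Qed.

End FunctionalCalculus.

(** * The strong law *)

(** Euclidean norms are suprema of linear forms [\sum_j r j * |D j|] with
    [\sum_j r j ^+ 2 = 1]; the tangent inequalities bound each of these. *)
Lemma norm_le_of_tangents (R : realType) N (D W : nat -> R) (C eps E : R) :
  0 <= eps -> 0 <= E ->
  (forall j r, (j < N)%N -> 0 <= r <= 1 ->
     2 * r * `|D j| - eps * r ^+ 2 * E <= 2 * C * W j) ->
  Num.sqrt (\sum_(j < N) D j ^+ 2) <= C * (\sum_(j < N) W j) + eps / 2 * E.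
Proof.
move=> eps0 E0 tan; set q := Num.sqrt _; have q0 : 0 <= q by exact: sqrtr_ge0.
have q2 : q ^+ 2 = \sum_(j < N) D j ^+ 2.
  by rewrite sqr_sqrtr //; apply: sumr_ge0 => j _; exact: sqr_ge0.
have eE : 0 <= eps * E by rewrite mulr_ge0.
have [qp|qn] := ltP 0 q; last first.
  have -> : q = 0 by apply/le_anti; rewrite qn.
  have : 0 <= \sum_(j < N) 2 * C * W j.
    apply: sumr_ge0 => j _; have := tan j 0 (ltn_ord j); rewrite lexx ler01.
    by rewrite expr0n /= !(mulr0, mul0r) subr0; apply.
  by rewrite -mulr_sumr; lra.
have Dq (j : 'I_N) : `|D j| <= q.
  rewrite -(ler_pXn2r (ltn0Sn 1)) ?nnegrE // real_normK ?num_real // q2.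
  by rewrite (bigD1 j) //= lerDl; apply: sumr_ge0 => i _; exact: sqr_ge0.
have : \sum_(j < N) (2 / q - eps * E / q ^+ 2) * D j ^+ 2 <= \sum_(j < N) 2 * C * W j.
  apply: ler_sum => j _; have := tan j (`|D j| / q) (ltn_ord j).
  rewrite divr_ge0 //= ler_pdivrMr // mul1r Dq => /(_ isT); apply: le_trans.
  rewrite expr_div_n real_normK ?num_real // -[D j ^+ 2](real_normK (num_real (D j))).
  by rewrite le_eqVlt; apply/orP; left; apply/eqP; field; rewrite gt_eqF.
rewrite -!mulr_sumr -q2.
have -> : (2 / q - eps * E / q ^+ 2) * q ^+ 2 = 2 * q - eps * E by field; rewrite gt_eqF.
by lra.
Qed.

Section SquareFunctionBound.
Context (R : realType) (V : rieszType R).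
Hypothesis dc : dedekind_complete [set: V].
Context (d W : nat -> V) (e : V) (C eps : R).
Hypotheses (eps0 : 0 <= eps) (e0 : 0 <= e) (W0 : forall j, 0 <= W j)
  (tangent : forall j r, 0 <= r <= 1 ->
     (2 * r) *: rabs (d j) - (eps * r ^+ 2) *: e <= (2 * C) *: W j).

Lemma psq_le N : psq d N <= C *: (\sum_(j < N) W j) + (eps / 2) *: e.
Proof.
pose u : V := e + \sum_(j < N) (rabs (d j) + W j).
have dW0 j : 0 <= rabs (d j) + W j by rewrite raddr_ge0 // rabs_ge0.
have s0 : 0 <= \sum_(j < N) (rabs (d j) + W j) by apply: rsum_ge0 => j _.
have u0 : 0 <= u by rewrite raddr_ge0.
have Iu : pideal u u by exact: pideal_gen.
have Ie : pideal u e by apply: (pideal_le Iu); rewrite // rleDl.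
have IdW j : (j < N)%N -> pideal u (rabs (d j) + W j).
  move=> h; apply: (pideal_le Iu) => //; rewrite /u (bigD1 (Ordinal h)) //= addrCA rleDl.
  by rewrite raddr_ge0 // rsum_ge0.
have Id j : (j < N)%N -> pideal u (d j).
  move=> /IdW h; apply: (pidealS h); rewrite [X in _ <= X]rabs_id // rleDl //.
have IW j : (j < N)%N -> pideal u (W j).
  by move=> /IdW h; apply: (pideal_le h) => //; rewrite rleDr rabs_ge0.
have Iq n : (n <= N)%N -> pideal u (psq d n).
  elim: n => [_|n ih h] /=; first exact: pideal0.
  by apply: pideal_rhypot => //; [exact: ih (ltnW h)|exact: Id].
have IWs : pideal u (\sum_(j < N) W j).
  by elim/big_ind : _ => [|x y|j _]; [exact: pideal0|exact: pidealD|exact: IW].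
have I1 : pideal u (C *: (\sum_(j < N) W j)) by exact: pidealZ.
have I2 : pideal u ((eps / 2) *: e) by exact: pidealZ.
apply: (le_of_states dc u0); [exact: Iq|exact: pidealD|move=> w sw].
rewrite (stateD sw I1 I2) (stateZ sw _ IWs) (stateZ sw _ Ie).
have wW : w (\sum_(j < N) W j) = \sum_(j < N) w (W j).
  have h n : (n <= N)%N -> pideal u (\sum_(j < n) W j) /\
      w (\sum_(j < n) W j) = \sum_(j < n) w (W j).
    elim: n => [_|n ih h]; first by rewrite !big_ord0 (state0 sw); split => //; exact: pideal0.
    have [i1 i2] := ih (ltnW h); rewrite !big_ord_recr /= (stateD sw i1 (IW _ h)) i2.
    by split=> //; apply: pidealD => //; exact: IW.
  by have [] := h N (leqnn N).
have wq n : (n <= N)%N -> w (psq d n) = Num.sqrt (\sum_(j < n) w (d j) ^+ 2).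
  elim: n => [_|n ih h] /=; first by rewrite big_ord0 sqrtr0 (state0 sw).
  rewrite (state_rhypot dc sw) ?Iq ?Id ?(ltnW h) //; [|exact: Iq (ltnW h)|exact: Id].
  rewrite ih ?(ltnW h) // big_ord_recr /= sqr_sqrtr //.
  by apply: sumr_ge0 => j _; exact: sqr_ge0.
have we0 : 0 <= w e by exact: (state_ge0 sw).
have tan j r : (j < N)%N -> 0 <= r <= 1 ->
    2 * r * `|w (d j)| - eps * r ^+ 2 * w e <= 2 * C * w (W j).
  move=> h hr; have J1 : pideal u ((2 * r) *: rabs (d j)).
    by apply: pidealZ; apply: pideal_abs; exact: Id.
  have J2 : pideal u ((eps * r ^+ 2) *: e) by exact: pidealZ.
  have J3 : pideal u ((2 * C) *: W j) by apply: pidealZ; exact: IW.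
  have := state_le sw (pidealB J1 J2) J3 (tangent j hr).
  rewrite (stateB sw J1 J2) (stateZ sw _ Ie) (stateZ sw _ (IW _ h)).
  by rewrite (stateZ sw _ (pideal_abs (Id _ h))) (state_abs sw (Id _ h)).
rewrite wW wq //.
exact: (@norm_le_of_tangents _ _ (w \o d) (w \o W) _ _ _ eps0 we0 tan).
Qed.

End SquareFunctionBound.

Section Abel.
Context (R : realType) (V : rieszType R).

Lemma sum_tail (f : nat -> V) k N : \sum_(i < (k + N).+1) f i =
  \sum_(i < k.+1) f i + \sum_(j < N) f (k + j).+1.
Proof. by rewrite -addSn big_split_ord. Qed.

(** Summation by parts. *)
Lemma abel_bound (d : nat -> V) (b : nat -> R) (G : V) N :
  (forall j, 0 <= b j) -> (forall j, b j <= b j.+1) ->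
  (forall n, (n <= N)%N -> rabs (psum d n) <= G) -> 0 <= G ->
  rabs (\sum_(j < N) b j *: d j) <= (2 * b N.-1) *: G.
Proof.
move=> b0 bi hG G0; case: N hG => [|N] hG.
  by rewrite big_ord0 rabs0 rieszZ_ge0 // mulr_ge0.
have key n : (n <= N)%N ->
    rabs (\sum_(j < n.+1) b j *: d j - b n *: psum d n.+1) <= (b n - b 0%N) *: G.
  elim: n => [_|n ih h].
    by rewrite big_ord_recl big_ord0 addr0 psumS /psum big_ord0 add0r subrr rabs0 subrr scale0r.
  have -> : \sum_(j < n.+2) b j *: d j - b n.+1 *: psum d n.+2 =
     (\sum_(j < n.+1) b j *: d j - b n *: psum d n.+1) - (b n.+1 - b n) *: psum d n.+1.
    rewrite big_ord_recr /= psumS scalerDr scalerBl opprD opprB.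
    by rewrite addrACA [b n.+1 *: d n.+1 - _]subrr addr0 addrA subrK.
  apply: (le_trans (rabsD_le _ _)); rewrite rabsN rabsZ ger0_norm ?subr_ge0 //.
  have -> : b n.+1 - b 0%N = (b n - b 0%N) + (b n.+1 - b n) by ring.
  rewrite [X in _ <= X]scalerDl; apply: rleD; first exact: ih (ltnW h).
  by rewrite rleZ ?subr_ge0 // hG // ltnW.
rewrite -[X in rabs X](subrK (b N *: psum d N.+1)); apply: (le_trans (rabsD_le _ _)).
have -> : (2 * b N) *: G = b N *: G + b N *: G by rewrite -scalerDl; congr (_ *: _); ring.
apply: rleD; last by rewrite rabsZ ger0_norm // rleZ // hG.
by apply: (le_trans (key N (leqnn N))); rewrite rleZr // gerBl.
Qed.

End Abel.

Section StrongLaw.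
Context (R : realType) (V : rieszType R).
Hypothesis dc : dedekind_complete [set: V].
Context (S : set V).
Hypotheses (iS : order_ideal S) (S0 : S 0).
Context (F : nat -> V -> V) (e : V).
Hypotheses (hF : forall i, conditional_expectation S (F i))
  (sF : forall i, strictly_positive S (F i))
  (he : weak_order_unit S e)
  (FF : forall i j, (i < j)%N -> forall x, S x ->
     F i (F j x) = F i x /\ F j (F i x) = F i x).
Hypothesis levi0 : forall (X : nat -> V) (B : V), (forall n, X n <= X n.+1) ->
  (forall n, 0 <= X n) -> (forall n, S (X n)) -> S B -> (forall n, F 0%N (X n) <= B) ->
  exists2 s, S s & is_sup setT (range X) s.
Context (y W : nat -> V) (C : R -> R).
Hypotheses (Sy : forall n, S (y n)) (Fy : forall n, F n (y n) = y n)
  (mds : forall n, F n (y n.+1) = 0)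
  (SW : forall n, S (W n)) (W0 : forall n, 0 <= W n)
  (C0 : forall eps, 0 < eps -> 0 < C eps)
  (tangent : forall eps j r, 0 < eps -> 0 <= r <= 1 ->
     (2 * r) *: rabs (y j) - (eps * r ^+ 2) *: e <= (2 * C eps) *: W j)
  (sumW : order_cvg_series S (fun i => F 0%N (W i))).

Let d k j := y (k + j).+1.

Let F0_tower k x : S x -> F 0%N (F k x) = F 0%N x.
Proof.
by case: k => [|k] Sx; [rewrite (ce_idem (hF 0))|rewrite (FF _ Sx).1].
Qed.

(** Davis' inequality for the increments after time [k], the bound [psq_le] of
    their square function, and the convergence of the series give a bound for
    the expectations of the running maxima that does not depend on their
    length; [levi0] then provides their supremum [G]. *)
Lemma tail_control : exists v : nat -> V, [/\ forall n, S (v n),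
  is_inf S (range v) 0 & forall k, exists G, [/\ S G, 0 <= G,
    forall n, rabs (psum (d k) n) <= G &
    forall eps, 0 < eps -> F 0%N G <= (20 * C eps) *: v k + (5 * eps) *: F 0%N e]].
Proof.
have [l [_ [v [Sv vd vinf hv]]]] := sumW.
have [Se e0 _] := he.
exists v; split=> // k.
have Sd j : S (d k j) by exact: Sy.
have hFk i : conditional_expectation S (F (k + i)) by exact: hF.
have [_ lv _] := vinf.
have v0 n : 0 <= v n by apply: lv; exists n.
have vmono n m : (n <= m)%N -> v m <= v n.
  elim: m => [|m ih]; first by rewrite leqn0 => /eqP ->.
  by rewrite leq_eqVlt => /orP[/eqP->//|/ih h]; exact: le_trans (vd m) h.
have Sq N : S (psq (d k) N).
  by elim: N => [|N ih] //=; exact: id_rhypot.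
have Sp N : S (psum (d k) N) by apply: id_sum.
have Sm N : S (pmax (d k) N).
  by elim: N => [|N ih] //=; apply: id_join => //; exact: id_abs.
have Fpos x : S x -> 0 <= x -> 0 <= F 0%N x by exact: (ce_ge0 (hF 0)).
have davis N : F 0%N (pmax (d k) N) <= 10 *: F 0%N (psq (d k) N).
  have h : F (k + 0)%N (pmax (d k) N) <= 10 *: F (k + 0)%N (psq (d k) N).
    apply: (@davis_inequality _ _ dc S iS S0 (fun i => F (k + i)%N) e) => //.
    - by move=> i j ij x Sx; apply: FF => //; rewrite ltn_add2l.
    by move=> n; rewrite addnS; exact: Fy.
  rewrite addn0 in h; rewrite -(F0_tower k (Sm N)) -(F0_tower k (Sq N)).
  have Sq' := ce_in (hF k) (Sq N).
  rewrite -(ceZ S0 (hF 0)) //; apply: (ce_le iS S0 (hF 0)) => //.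
    exact: (ce_in (hF k)).
  exact: idZ.
have sumF N : \sum_(j < N) F 0%N (W (k + j).+1) <= 2 *: v k.
  have -> : \sum_(j < N) F 0%N (W (k + j).+1) =
     \sum_(i < (k + N).+1) F 0%N (W i) - \sum_(i < k.+1) F 0%N (W i).
    by rewrite (sum_tail (fun i => F 0%N (W i))) addrAC subrr add0r.
  have -> : 2 *: v k = v k + v k by rewrite scaler_nat mulr2n.
  have h1 := le_trans (ler_rabs _).1 (hv (k + N)%N).
  have h2 := le_trans (ler_rabs _).2 (hv k).
  rewrite opprB in h2.
  have -> : \sum_(i < (k + N).+1) F 0%N (W i) - \sum_(i < k.+1) F 0%N (W i) =
    (\sum_(i < (k + N).+1) F 0%N (W i) - l) + (l - \sum_(i < k.+1) F 0%N (W i)).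
    by rewrite addrA subrK.
  apply: rleD => //; apply: (le_trans h1); apply: vmono; exact: leq_addr.
have SvC eps : S ((20 * C eps) *: v k + (5 * eps) *: F 0%N e).
  by apply: idD => //; apply: idZ => //; exact: (ce_in (hF 0)).
have bound eps N : 0 < eps ->
    F 0%N (pmax (d k) N) <= (20 * C eps) *: v k + (5 * eps) *: F 0%N e.
  move=> eps0; apply: (le_trans (davis N)).
  have SWs : S (\sum_(j < N) W (k + j).+1) by apply: id_sum.
  have hq : psq (d k) N <= C eps *: (\sum_(j < N) W (k + j).+1) + (eps / 2) *: e.
    apply: (psq_le dc (W := fun j => W (k + j).+1)) => // [|j r]; first exact: ltW.
    exact: tangent.
  have S1 : S (C eps *: (\sum_(j < N) W (k + j).+1)) by exact: idZ.
  have S2 : S ((eps / 2) *: e) by exact: idZ.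
  have := ce_le iS S0 (hF 0) (Sq N) (idD iS S1 S2) hq.
  rewrite (ceD (hF 0)) // !(ceZ S0 (hF 0)) // (ce_sum iS S0 (hF 0)) // => h.
  have ten : (0 : R) <= 10 by exact: ler0n.
  apply: (le_trans (rleZ ten h)); rewrite scalerDr !scalerA; apply: rleD.
    apply: (@le_trans _ _ ((10 * C eps) *: (2 *: v k))).
      by rewrite rleZ // mulr_ge0 // ltW // C0.
    rewrite scalerA le_eqVlt; apply/orP; left; apply/eqP; congr (_ *: _); ring.
  have -> : 10 * (eps / 2) = 5 * eps by field.
  exact: lexx.
have m0 N : 0 <= pmax (d k) N.
  by case: N => [|N] //=; apply: (le_trans (rabs_ge0 _)); exact: (rjoin_ler _ _).2.
have mi N : pmax (d k) N <= pmax (d k) N.+1 by exact: (rjoin_ler _ _).1.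
have [G SG hG] := levi0 mi m0 Sm (SvC 1) (fun N => bound 1 N ltr01).
have [_ uG _] := hG.
exists G; split=> //.
- by apply: le_trans (m0 0%N) _; apply: uG; exists 0%N.
- case=> [|n]; first by rewrite /psum big_ord0 rabs0; apply: le_trans (m0 0%N) _; apply: uG; exists 0%N.
  by apply: (@le_trans _ _ (pmax (d k) n.+1)); [exact: (rjoin_ler _ _).2|apply: uG; exists n.+1].
move=> eps eps0; have [_ _ ls] := ce_sup iS S0 (hF 0) mi Sm SG hG.
by apply: ls => // _ [N _ <-] /=; exact: bound.
Qed.

Context (a : nat -> R).
Hypotheses (a0 : forall i, 0 < a i) (ai : forall i j, (i <= j)%N -> a i <= a j)
  (ainf : a n @[n --> \oo] --> +oo).

Let x n := (a n)^-1 *: \sum_(i < n.+1) a i *: y i.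

Let x_bound k G n : 0 <= G -> (forall m, rabs (psum (d k) m) <= G) -> (k <= n)%N ->
  rabs (x n) <= (a n)^-1 *: rabs (\sum_(i < k.+1) a i *: y i) + 2 *: G.
Proof.
move=> G0 hG kn; have [N nE] : exists N, n = (k + N)%N by exists (n - k)%N; rewrite subnKC.
subst n; rewrite /x rabsZ ger0_norm ?invr_ge0 ?(ltW (a0 _)) //.
have -> : \sum_(i < (k + N).+1) a i *: y i =
    \sum_(i < k.+1) a i *: y i + \sum_(j < N) a (k + j).+1 *: d k j.
  exact: (sum_tail (fun i => a i *: y i)).
have an0 : 0 < (a (k + N)%N)^-1 by rewrite invr_gt0.
apply: (@le_trans _ _ ((a (k + N)%N)^-1 *: (rabs (\sum_(i < k.+1) a i *: y i) +
   (2 * a (k + N)%N) *: G))); last first.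
  rewrite scalerDr rleD2l scalerA le_eqVlt; apply/orP; left; apply/eqP.
  by congr (_ *: _); rewrite mulrCA mulVf ?mulr1 // gt_eqF.
rewrite rleZP //; apply: (le_trans (rabsD_le _ _)); rewrite rleD2l.
case: N {kn an0} => [|N].
  by rewrite big_ord0 rabs0 rieszZ_ge0 // mulr_ge0 // ltW.
have := @abel_bound _ _ (d k) (fun j => a (k + j).+1) G N.+1 _ _ (fun m _ => hG m) G0.
rewrite /= addnS; apply=> j; first exact: ltW.
by apply: ai; rewrite ltnS leq_add2l.
Qed.

(** Kronecker's lemma: the dominating sequence consists of the suprema of the
    tails of [rabs (x n)]. *)
Theorem strong_law : order_cvg S x 0.
Proof.
have [v [Sv vinf hv]] := tail_control.
have Fe := ce_in (hF 0).
have Sx0 k : S (\sum_(i < k.+1) a i *: y i) by apply: id_sum => // i; exact: idZ.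
have Sx n : S (x n) by exact: idZ.
have [G [SG G0 hG _]] := hv 0%N.
pose M := (a 0%N)^-1 *: rabs (\sum_(i < 1) a i *: y i) + 2 *: G.
have xM n : rabs (x n) <= M.
  apply: (le_trans (x_bound G0 hG (leq0n n))); rewrite rleD2r rleZr ?rabs_ge0 //.
  by rewrite lef_pV2 ?posrE // ai.
have SM : S M by apply: idD => //; apply: idZ => //; exact: id_abs.
pose D n : set V := [set rabs (x m) | m in [set m | (n <= m)%N]].
have hu n : is_sup setT (D n) (supof (D n)).
  apply: (dc_supof dc); first by exists (rabs (x n)); exists n => /=.
  by exists M => _ [m _ <-].
have xu n m : (n <= m)%N -> rabs (x m) <= supof (D n).
  by move=> nm; have [_ us _] := hu n; apply: us; exists m.
have uM n : supof (D n) <= M by have [_ _ ls] := hu n; apply: ls => // _ [m _ <-].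
have u0 n : 0 <= supof (D n) := le_trans (rabs_ge0 _) (xu n n (leqnn n)).
split=> //; exists (fun n => supof (D n)); split.
- by move=> n; exact: (id_le iS SM).
- move=> n; have [_ _ ls] := hu n.+1; apply: ls => // _ [m nm <-]; apply: xu.
  exact: ltnW nm.
- split=> // [_ [n _ <-]//|z0 Sz0 lz0].
  suff : pos z0 = 0 by move=> h; rewrite -h le_pos.
  pose z := pos z0; have zp : 0 <= z by exact: pos_ge0.
  have Sz : S z by exact: id_pos.
  have zu n : z <= supof (D n) by rewrite pos_le u0 andbT; apply: lz0; exists n.
  (* let [n] tend to infinity in [x_bound], for a fixed [k] *)
  have zG k G' : 0 <= G' -> (forall m, rabs (psum (d k) m) <= G') -> z <= 2 *: G'.
    move=> G'0 hG'; rewrite -[X in _ <= X]add0r -rleBlDr.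
    apply: (archimedean_eps dc (y := rabs (\sum_(i < k.+1) a i *: y i))) => c c0.
    have /cvgryPge/(_ c^-1)[N _ hN] := ainf.
    pose n := maxn N k; have cn : (a n)^-1 <= c.
      rewrite -[c]invrK lef_pV2 ?posrE ?invr_gt0 //; apply: hN => /=; exact: leq_maxl.
    rewrite rleBlDr; apply: (le_trans (zu n)); have [_ _ ls] := hu n.
    apply: ls => // _ [m /= nm <-].
    apply: (le_trans (x_bound G'0 hG' (leq_trans (leq_maxr N k) nm))).
    rewrite rleD2r rleZr ?rabs_ge0 //; apply: le_trans cn.
    by rewrite lef_pV2 ?posrE // ai.
  have FzG k eps : 0 < eps -> F 0%N z <= (40 * C eps) *: v k + (10 * eps) *: F 0%N e.
    move=> eps0; have [G' [SG' G'0 hG' FG']] := hv k.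
    have S2 : S (2 *: G') by exact: idZ.
    have := ce_le iS S0 (hF 0) Sz S2 (zG k G' G'0 hG').
    rewrite (ceZ S0 (hF 0)) // => /le_trans; apply.
    have two : (0 : R) <= 2 by exact: ler0n.
    apply: (le_trans (rleZ two (FG' eps eps0))); rewrite scalerDr !scalerA.
    by rewrite le_eqVlt; apply/orP; left; apply/eqP; congr (_ *: _ + _ *: _); ring.
  have [Se _ _] := he.
  have SFz : S (F 0%N z) by exact: Fe.
  have Fz : F 0%N z <= 0.
    apply: (archimedean_eps dc (y := 10 *: F 0%N e)) => eps eps0.
    rewrite scalerA mulrC -[X in _ <= X]add0r -rleBlDr.
    have c0 : 0 < 40 * C eps by rewrite mulr_gt0 // C0.
    have ci : 0 < (40 * C eps)^-1 by rewrite invr_gt0.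
    rewrite -(rleZP _ _ ci) scaler0; have [_ _ gl] := vinf; apply: gl.
      by apply: idZ => //; apply: idB => //; apply: idZ => //; exact: Fe.
    move=> _ [k _ <-]; rewrite -(rleZP _ _ c0) scalerA mulfV ?gt_eqF // scale1r.
    by rewrite rleBlDr FzG.
  apply: (@sF 0%N) => //; rewrite rabs_id //; apply/le_anti; rewrite Fz.
  exact: (ce_ge0 (hF 0)).
by move=> n; rewrite subr0; exact: xu.
Qed.

End StrongLaw.

Theorem theorem6p1 (R : realType)
    (E : rieszType R) (U : rieszType R) (iota : E -> U)
    (e : E) (T : E -> E) (p : R)
    (Y : nat -> U) (Ti : nat -> U -> U) (a : nat -> R)
    (hE : dedekind_complete [set: E])
    (he : weak_order_unit [set: E] e)
    (hU : universal_completion iota)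
    (hT : conditional_expectation [set: E] T)
    (hTpos : strictly_positive [set: E] T)
    (hp : 1 <= p <= 2)
    (hY : martingale_difference iota T e p Y Ti)
    (hcompat : compatible iota T Ti)
    (ha0 : forall i, 0 < a i)
    (ha : forall i j, (i <= j)%N -> a i <= a j)
    (hainf : a n @[n --> \oo] --> +oo)
    (hsum : order_cvg_series (L1 iota T)
       (fun i => Ti 0%N ((a i `^ p)^-1 *: power (iota e) p (rabs (Y i))))) :
  order_cvg (L1 iota T)
    (fun n => (a n)^-1 *: \sum_(i < n.+1) Y i) 0.
Proof.
have dc := dcU hU.
have iL := L1_ideal hE hU hT.
have L0 := L1_0 hU hT.
have [_ e0 _] := he.
have Le : L1 iota T (iota e) by exact: L1_iota.
have wu : weak_order_unit (L1 iota T) (iota e) by exact: (weak_unit_iota hU Le he).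
have ie0 : 0 <= iota e by rewrite (iota_ge0 hU).
have [[hF FF] hYi mds] := hY.
have sF i : strictly_positive (L1 iota T) (Ti i).
  by apply: (strictly_positive_factor hE hU hT hTpos) => f Lf; exact: hcompat.
have LY i : L1 iota T (Y i) by have [[]] := hYi i.
have hpow i : is_power (iota e) p (rabs (Y i)) (power (iota e) p (rabs (Y i))) /\
    L1 iota T (power (iota e) p (rabs (Y i))).
  have [[_ [g hg Lg]] _] := hYi i.
  by rewrite (powerE dc hp ie0 hg).
pose y i := (a i)^-1 *: Y i.
pose W i := (a i `^ p)^-1 *: power (iota e) p (rabs (Y i)).
have Ly i : L1 iota T (y i) by exact: idZ.
have LW i : L1 iota T (W i) by apply: idZ => //; exact: (hpow i).2.
have W0 i : 0 <= W i.
  apply: rieszZ_ge0; first by rewrite invr_ge0 powR_ge0.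
  exact: (power_ge0 hp (hpow i).1).
have FY i : Ti i (Y i) = Y i.
  have [_ [z Lz <-]] := hYi i; exact: (ce_idem (hF i)).
have sl := @strong_law _ _ dc _ iL L0 Ti (iota e) hF sF wu FF
  _ y W (fun eps => eps * eps^-1 `^ p) Ly _ _ LW W0 _ _ hsum a ha0 ha hainf.
have -> : (fun n => (a n)^-1 *: \sum_(i < n.+1) Y i) =
    (fun n => (a n)^-1 *: \sum_(i < n.+1) a i *: y i).
  apply/funext => n; congr (_ *: _); apply: eq_bigr => i _.
  by rewrite scalerA mulfV ?scale1r // gt_eqF.
apply: sl.
- move=> X B Xi X0 LX LB XB.
  by apply: (levi hE hU hT hTpos he (hF 0%N)) LB XB => // f Lf; exact: hcompat.
- by move=> n; rewrite /y (ceZ L0 (hF n)) // FY.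
- by move=> n; rewrite /y (ceZ L0 (hF n)) // mds scaler0.
- by move=> eps eps0; rewrite mulr_gt0 // powR_gt0 // invr_gt0.
move=> eps j r eps0 hr.
have -> : rabs (y j) = (a j)^-1 *: rabs (Y j).
  by rewrite rabsZ ger0_norm // invr_ge0 ltW.
exact: (power_tangent hp (hpow j).1 hr eps0 (ha0 j)).
Qed.
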